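(* Let $q:\mathcal{S}_0=\bigsqcup_{\lambda\in\Lambda}S_\lambda\to Z$ and $q':\mathcal{S}'_0=\bigsqcup_{\lambda'\in\Lambda'}S'_{\lambda'}\to Z'$ be striped atlases with graphs $G=(\Lambda,H,\xi,\sigma)$ and $G'=(\Lambda',H',\xi',\sigma')$. (1) If $(h,k)$ is an equivalence of $q$ and $q'$, then $(\nu,\eta,\delta,\tau)$ is an isomorphism $G\to G'$, where $\nu(\lambda)$ is defined by $h(S_\lambda)=S'_{\nu(\lambda)}$, $\eta(X)=h(X)$ for $X\in H$, and, writing $h|_{S_\lambda}(x,y)=(\alpha(x,y),\beta(y))$ (with each $\alpha_y=\alpha(\cdot,y)$ a homeomorphism of $\mathbb{R}$ for interior $y$ and $\beta$ a homeomorphism of the $y$-intervals), $\delta(\lambda)=+1$ if the $\alpha_y$ are increasing and $-1$ otherwise, $\tau(\lambda)=+1$ if $\beta$ is increasing and $-1$ otherwise. (2) Conversely, every isomorphism $G\to G'$ is induced in this way by some equivalence of the striped atlases $q$ and $q'$.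
   Context: Strips, boundary intervals ($\partial_\pm S$), model strips, canonical foliations and foliated homeomorphisms: a strip is $S\subset\mathbb{R}^2$ with $\mathbb{R}\times(u,v)\subset S\subset\mathbb{R}\times[u,v]$, $u<v$, open in $\mathbb{R}\times[u,v]$; $\partial_-S=S\cap(\mathbb{R}\times\{u\})$, $\partial_+S=S\cap(\mathbb{R}\times\{v\})$; boundary intervals are the components of $\partial S=\partial_-S\cup\partial_+S$; leaves of the canonical foliation are the lines $\mathbb{R}\times\{t\}$, $t\in(u,v)$, and the boundary intervals. Each of $\partial_\pm S$ is linearly ordered by $(a,x)<(b,x)$ iff $a<b$, inducing a linear order on the boundary intervals in $\partial_-S$ and on those in $\partial_+S$. Striped atlas: a quotient map $q:\mathcal{S}_0=\bigsqcup_{\lambda\in\Lambda}S_\lambda\to Z$ onto a 2-manifold from an at most countable disjoint union of strips, together with families $\{X_\gamma\}_{\gamma\in\Gamma}$, $\{Y_\gamma\}_{\gamma\in\Gamma}$ of mutually distinct boundary intervals such that $q$ is injective off $\bigcup_\gamma(X_\gamma\cup Y_\gamma)$, $q(X_\gamma)=q(Y_\gamma)$, and $q|_{X_\gamma},q|_{Y_\gamma}$ are embeddings with closed images. Gluing maps $\phi_\gamma=(q|_{X_\gamma})^{-1}\circ q|_{Y_\gamma}:Y_\gamma\to X_\gamma$. Equivalence of atlases $q,q'$: a pair of foliated homeomorphisms $h:\mathcal{S}_0\to\mathcal{S}'_0$, $k:Z\to Z'$ with $q'\circ h=k\circ q$ (foliation on $Z$: images of the leaves of the strips). For a homeomorphism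 $f$ between open horizontal intervals let $\mathrm{or}(f)=+1$ if $f$ preserves the order of first coordinates and $-1$ otherwise. Graph of the atlas $q$: $G=(\Lambda,H,\xi,\sigma)$ where $\Lambda$ is the index set of strips (vertices); $H=\bigsqcup_\lambda(d_{-1}(\lambda)\sqcup d_{+1}(\lambda))$, where $d_{-1}(\lambda)$ (resp. $d_{+1}(\lambda)$) is the set of boundary intervals of $\partial_-S_\lambda$ (resp. $\partial_+S_\lambda$) with its linear order (half-edges), $d(\lambda)=d_{-1}(\lambda)\sqcup d_{+1}(\lambda)$; $\xi:H\to H$ is the involution with $\xi(X_\gamma)=Y_\gamma$, $\xi(Y_\gamma)=X_\gamma$ and $\xi(X)=X$ for all other $X$; unordered pairs $\{X,\xi(X)\}$ with $X\ne\xi(X)$ are closed edges, and $\sigma(X_\gamma,Y_\gamma)=\sigma(Y_\gamma,X_\gamma)=\mathrm{or}(\phi_\gamma)\in\{\pm1\}$. An isomorphism $G\to G'$ is a quadruple $(\nu,\eta,\delta,\tau)$ with bijections $\nu:\Lambda\to\Lambda'$, $\eta:H\to H'$ and maps $\delta,\tau:\Lambda\to\{\pm1\}$ such that: (a) $\eta(d_s(\lambda))=d'_{\tau(\lambda)s}(\nu(\lambda))$ for all $\lambda$ and $s\in\{\pm1\}$, and both restrictions $\eta|_{d_{\pm1}(\lambda)}$ are increasing if $\delta(\lambda)=+1$ and decreasing if $\delta(\lambda)=-1$; (b) $\xi'\circ\eta=\eta\circ\xi$; (c) for every closed edge $\{X,Y\}$ of $G$ with $X\in d(\lambda)$, $Y=\xi(X)\in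 d(\mu)$: $\delta(\lambda)\,\sigma(X,Y)=\sigma'(\eta(X),\eta(Y))\,\delta(\mu)$. *)

(* Defs.v *)
From HB Require Import structures.
From mathcomp Require Import all_boot all_order all_algebra.
From mathcomp Require Import all_classical all_reals all_analysis.
Set Implicit Arguments. Unset Strict Implicit. Unset Printing Implicit Defensive.
Import Order.TTheory GRing.Theory Num.Theory.
Import numFieldNormedType.Exports.
Local Open Scope classical_set_scope.
Local Open Scope ring_scope.

Section StripedDefs.
Variable R : realType.
Notation P2 := (R * R)%type.

Definition relopen {T : topologicalType} (A U : set T) : Prop :=
  exists O : set T, open O /\ U = A `&` O.

Definition homeo_on {T U : topologicalType} (A : set T) (B : set U)
  (f : T -> U) : Prop :=
  exists g : U -> T,
    [/\ (forall a, A a -> B (f a)), (forall b, B b -> A (g b)),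
        (forall a, A a -> g (f a) = a) & (forall b, B b -> f (g b) = b)]
    /\ ({within A, continuous f} /\ {within B, continuous g}).

Definition halfplane : set P2 := [set p | 0 <= p.2].
Definition two_manifold (Z : topologicalType) : Prop :=
  hausdorff_space Z /\
  forall z : Z, exists U : set Z, [/\ open U, U z &
    exists (W : set P2) (f : Z -> P2),
      [/\ W `<=` halfplane, relopen halfplane W & homeo_on U W f]].

Definition is_strip (S : set P2) (u v : R) : Prop :=
  [/\ u < v,
      [set p : P2 | u < p.2 < v] `<=` S,
      S `<=` [set p : P2 | u <= p.2 <= v] &
      relopen [set p : P2 | u <= p.2 <= v] S].

Definition bdry_minus (S : set P2) (u : R) : set P2 := S `&` [set p | p.2 = u].
Definition bdry_plus (S : set P2) (v : R) : set P2 := S `&` [set p | p.2 = v].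
Definition bdry (S : set P2) (u v : R) : set P2 :=
  bdry_minus S u `|` bdry_plus S v.

Definition boundary_interval (S : set P2) (u v : R) (X : set P2) : Prop :=
  exists2 x, bdry S u v x & X = connected_component (bdry S u v) x.

Definition strip_leaf (S : set P2) (u v : R) (L : set P2) : Prop :=
  (exists t, u < t < v /\ L = [set p : P2 | p.2 = t])
  \/ boundary_interval S u v L.

(* the order on boundary intervals lying on a common horizontal line *)
Definition int_lt (X Y : set P2) : Prop :=
  forall a b, X a -> Y b -> a.1 < b.1.

End StripedDefs.

(* Raw data of a striped atlas: strips S_lam (with their bounds u_lam < v_lam)
   indexed by Lam, the surface Z, the map q (on the disjoint union, a point of
   which is a pair (lam, p) with p in S_lam), and the gluing families X, Y
   whose members are boundary intervals, i.e. half-edges (lam, X). *)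
Record atlas_data (R : realType) := AtlasData {
  Lam : Type;
  Gam : Type;
  Zsp : topologicalType;
  St : Lam -> set (R * R);
  su : Lam -> R;
  sv : Lam -> R;
  q : Lam -> R * R -> Zsp;
  Xg : Gam -> Lam * set (R * R);
  Yg : Gam -> Lam * set (R * R)
}.
Arguments Lam {R} a. Arguments Gam {R} a. Arguments Zsp {R} a.
Arguments St {R} a _ _. Arguments su {R} a _. Arguments sv {R} a _.
Arguments q {R} a _ _. Arguments Xg {R} a _. Arguments Yg {R} a _.

Section Atlas.
Variable R : realType.
Notation P2 := (R * R)%type.
Variable A : atlas_data R.

Definition dom : set (Lam A * P2) := [set x | St A x.1 x.2].

Definition halfedge (X : Lam A * set P2) : Prop :=
  boundary_interval (St A X.1) (su A X.1) (sv A X.1) X.2.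

Definition dside (s : int) (l : Lam A) (X : set P2) : Prop :=
  halfedge (l, X) /\
  X `<=` [set p : P2 | p.2 = (if s < 0 then su A l else sv A l)].

Definition glued (l : Lam A) (p : P2) : Prop :=
  exists g, ((Xg A g).1 = l /\ (Xg A g).2 p) \/ ((Yg A g).1 = l /\ (Yg A g).2 p).

Definition qimage (X : Lam A * set P2) : set (Zsp A) := q A X.1 @` X.2.

Definition is_striped_atlas : Prop :=
  [/\ countable [set: Lam A],
      (forall l, is_strip (St A l) (su A l) (sv A l)) &
      (forall g, halfedge (Xg A g) /\ halfedge (Yg A g))] /\
  [/\
      [/\ (forall g g', Xg A g = Xg A g' -> g = g'),
          (forall g g', Yg A g = Yg A g' -> g = g') &
          (forall g g', Xg A g <> Yg A g')],
      (forall z : Zsp A, exists l p, St A l p /\ q A l p = z),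
      (forall V : set (Zsp A),
          open V <-> forall l, relopen (St A l) (St A l `&` q A l @^-1` V)) &
      [/\ two_manifold R (Zsp A),
          (forall l p m r, St A l p -> St A m r -> ~ glued l p -> ~ glued m r ->
              q A l p = q A m r -> l = m /\ p = r),
          (forall g, qimage (Xg A g) = qimage (Yg A g)) &
          (forall g, [/\ homeo_on (Xg A g).2 (qimage (Xg A g)) (q A (Xg A g).1),
                        homeo_on (Yg A g).2 (qimage (Yg A g)) (q A (Yg A g).1),
                        closed (qimage (Xg A g)) & closed (qimage (Yg A g))])]].

(* or(phi_g) for the gluing map phi_g = (q|X_g)^-1 o q|Y_g : Y_g -> X_g *)
Definition orient (g : Gam A) : int :=
  if `[< forall y1 y2 x1 x2 : P2,
         (Yg A g).2 y1 -> (Yg A g).2 y2 -> (Xg A g).2 x1 -> (Xg A g).2 x2 ->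
         q A (Xg A g).1 x1 = q A (Yg A g).1 y1 ->
         q A (Xg A g).1 x2 = q A (Yg A g).1 y2 ->
         y1.1 < y2.1 -> x1.1 < x2.1 >] then 1 else -1.

(* xi_rel X Y  <->  Y = xi(X)  (graph of the involution xi : H -> H) *)
Definition xi_rel (X Y : Lam A * set P2) : Prop :=
  (exists g, X = Xg A g /\ Y = Yg A g) \/
  (exists g, X = Yg A g /\ Y = Xg A g) \/
  [/\ halfedge X, (forall g, X <> Xg A g /\ X <> Yg A g) & Y = X].

(* sigma_rel X Y s  <->  {X,Y} is a closed edge and sigma(X,Y) = s *)
Definition sigma_rel (X Y : Lam A * set P2) (s : int) : Prop :=
  exists g, ((X = Xg A g /\ Y = Yg A g) \/ (X = Yg A g /\ Y = Xg A g))
            /\ s = orient g.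

Definition sopen (U : set (Lam A * P2)) : Prop :=
  U `<=` dom /\ forall l, relopen (St A l) [set p | U (l, p)].

Definition sleaf (L : set (Lam A * P2)) : Prop :=
  exists l (M : set P2), strip_leaf (St A l) (su A l) (sv A l) M /\
    L = [set x | x.1 = l /\ M x.2].
Definition zleaf (W : set (Zsp A)) : Prop :=
  exists2 L, sleaf L & W = [set q A x.1 x.2 | x in L].

End Atlas.
Arguments dom {R} A _. Arguments halfedge {R} A _. Arguments dside {R} A _ _ _.
Arguments glued {R} A _ _. Arguments qimage {R} A _.
Arguments is_striped_atlas {R} A. Arguments orient {R} A _.
Arguments xi_rel {R} A _ _. Arguments sigma_rel {R} A _ _ _.
Arguments sopen {R} A _. Arguments sleaf {R} A _. Arguments zleaf {R} A _.

Section Maps.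
Variable R : realType.
Notation P2 := (R * R)%type.
Variables A A' : atlas_data R.

Definition sign (s : int) : Prop := s = 1 \/ s = -1.

Definition fol_homeo_strips (h : Lam A * P2 -> Lam A' * P2) : Prop :=
  (exists g : Lam A' * P2 -> Lam A * P2,
    [/\ (forall x, dom A x -> dom A' (h x)), (forall y, dom A' y -> dom A (g y)),
        (forall x, dom A x -> g (h x) = x) & (forall y, dom A' y -> h (g y) = y)] /\
    ((forall U, sopen A' U -> sopen A (dom A `&` h @^-1` U)) /\
        (forall U, sopen A U -> sopen A' (dom A' `&` g @^-1` U))))
  /\ (forall L, sleaf A L -> sleaf A' (h @` L)).

Definition fol_homeo_surf (k : Zsp A -> Zsp A') : Prop :=
  (exists g : Zsp A' -> Zsp A,
     [/\ cancel k g, cancel g k, continuous k & continuous g])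
  /\ (forall W, zleaf A W -> zleaf A' (k @` W)).

Definition atlas_equiv (h : Lam A * P2 -> Lam A' * P2) (k : Zsp A -> Zsp A') : Prop :=
  [/\ fol_homeo_strips h, fol_homeo_surf k &
      forall l p, St A l p -> q A' (h (l, p)).1 (h (l, p)).2 = k (q A l p)].

Definition graph_iso (nu : Lam A -> Lam A')
    (eta : Lam A * set P2 -> Lam A' * set P2) (delta tau : Lam A -> int) : Prop :=
  [/\ bijective nu,
      set_bij (halfedge A) (halfedge A') eta &
      (forall l, sign (delta l) /\ sign (tau l))] /\
  [/\
      (forall l s, sign s ->
         [/\ [set eta (l, X) | X in dside A s l]
               = [set (nu l, X') | X' in dside A' (tau l * s) (nu l)] &
             forall X X', dside A s l X -> dside A s l X' -> int_lt X X' ->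
               if delta l == 1 then int_lt (eta (l, X)).2 (eta (l, X')).2
               else int_lt (eta (l, X')).2 (eta (l, X)).2]),
      (forall X Y, halfedge A X -> xi_rel A X Y -> xi_rel A' (eta X) (eta Y)) &
      (forall l m X Y s s', halfedge A (l, X) -> halfedge A (m, Y) ->
         xi_rel A (l, X) (m, Y) -> (l, X) <> (m, Y) ->
         sigma_rel A (l, X) (m, Y) s -> sigma_rel A' (eta (l, X)) (eta (m, Y)) s' ->
         delta l * s = s' * delta m)].

Definition induced_by (h : Lam A * P2 -> Lam A' * P2) (nu : Lam A -> Lam A')
    (eta : Lam A * set P2 -> Lam A' * set P2) (delta tau : Lam A -> int) : Prop :=
  [/\ (forall l, [set h (l, p) | p in St A l] = [set (nu l, p') | p' in St A' (nu l)]),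
      (forall l X, halfedge A (l, X) ->
         eta (l, X) = (nu l, [set (h (l, p)).2 | p in X])),
      (forall l, delta l =
         if `[< forall y x1 x2 : R, su A l < y < sv A l -> x1 < x2 ->
                  (h (l, (x1, y))).2.1 < (h (l, (x2, y))).2.1 >] then 1 else -1) &
      (forall l, tau l =
         if `[< forall p1 p2 : P2, St A l p1 -> St A l p2 -> p1.2 < p2.2 ->
                  (h (l, p1)).2.2 < (h (l, p2)).2.2 >] then 1 else -1)].

End Maps.
Arguments fol_homeo_strips {R} A A' h. Arguments fol_homeo_surf {R} A A' k.
Arguments atlas_equiv {R} A A' h k. Arguments graph_iso {R} A A' nu eta delta tau.
Arguments induced_by {R} A A' h nu eta delta tau.

(* Main.v *)
Require Import Defs.
From HB Require Import structures.
From mathcomp Require Import all_boot all_order all_algebra.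
From mathcomp Require Import all_classical all_reals all_analysis.
From mathcomp Require Import ring lra zify.
Import Order.TTheory GRing.Theory Num.Theory.
Import numFieldNormedType.Exports.
Set Implicit Arguments. Unset Strict Implicit. Unset Printing Implicit Defensive.
Local Open Scope classical_set_scope.
Local Open Scope ring_scope.

(** An equivalence maps each strip onto a strip by a leaf-preserving homeomorphism.
   Interior lines separate a strip and boundary intervals do not, so such a map is
   fiberwise of the form (alpha (x, y), beta y); the signs delta and tau are constant
   because any two pairs of points can be joined by segments inside the strip, along
   which the compared coordinates never coincide.

   Both directions need that q identifies nothing besides what the gluing maps
   prescribe.  The definition only says that q is injective off the glued
   intervals; the rest comes from Z being a 2-manifold: a disk around an interior
   point, or two half-disks glued along X_g and Y_g, has an open image by
   invariance of domain, so no third sheet can meet it.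

   Conversely, choose monotone bijections X -> eta X for all half-edges, free on each
   X_g and transported by q to Y_g; condition (c) makes the transported map
   monotone in the right direction.  On each side of a strip they assemble to a
   monotone bijection between open subsets of a line, and such a bijection f is the
   pointwise limit of a continuous family of self-homeomorphisms of the line,
   obtained from truncated inf-convolutions of f.  Blending the families of the two
   sides extends the boundary map over the strip, and the extensions glue. *)

(** * Winding numbers and invariance of domain in the plane *)

Section Winding.
Variable R : realType.
Notation P2 := (R * R)%type.
Implicit Types (x y z w : P2) (a b r s : R).

(** Integrality of winding numbers is never established. The winding sum of a finely sampled closed
    loop has vanishing sine and positive cosine, and the intermediate value theorem then keeps it
    constant along a homotopy. Charts of the surface may take values in the half-plane; being
    injective maps into the plane all the same, they reduce interior and boundary points of the
    surface to one statement about the plane.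

    The extension over a strip is delicate because a boundary map lives on an open subset of a line,
    possibly with infinitely many gaps, and may be bounded or unbounded near the end of a component,
    while every interior row must be mapped bijectively onto a whole line. Continuity of the
    boundary maps is not assumed either: a monotone bijection between open sets of lines can be
    approximated from one side, and this is what the envelopes use. Likewise, joint continuity of
    the extension and of its inverse comes from monotonicity along rows and continuity along
    verticals. *)

Definition dotp z w : R := z.1 * w.1 + z.2 * w.2.
Definition crossp z w : R := z.1 * w.2 - z.2 * w.1.
(** The signed angle from [z] to [w], meaningful only when [dotp z w] is positive: [atan] sees less
    than a quarter turn, so loops must be sampled finely. *)
Definition ang z w : R := atan (crossp z w / dotp z w).

(** Rotation by [a] up to a positive factor, so that angles add along a polygon without normalizing
    its vertices. *)
Definition rotated a z w := exists2 r, 0 < r &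
  w = (r * (cos a * z.1 - sin a * z.2), r * (sin a * z.1 + cos a * z.2)).

Lemma dotp_gt0 z : z <> (0, 0) -> 0 < dotp z z.
Proof.
case: z => z1 z2 nz; rewrite /dotp /=.
have [z10|z10] := eqVneq z1 0; have [z20|z20] := eqVneq z2 0.
- by exfalso; apply: nz; rewrite z10 z20.
- by rewrite z10 mul0r add0r -expr2 exprn_even_gt0.
- by rewrite z20 mul0r addr0 -expr2 exprn_even_gt0.
- by rewrite addr_gt0 // -expr2 exprn_even_gt0.
Qed.

Lemma rotated_ang z w : 0 < dotp z w -> rotated (ang z w) z w.
Proof.
move=> d0; set a := ang z w.
have ca : 0 < cos a by apply: cos_gt0_pihalf; rewrite atan_gtNpi2 atan_ltpi2.
have sa : sin a = cos a * (crossp z w / dotp z w).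
  by rewrite -[crossp _ _ / _]atanK -/(ang z w) -/a /tan mulrC divfK // gt_eqF.
have nz : z <> (0, 0).
  by move=> z0; move: d0; rewrite /dotp z0 /= !mul0r addr0 ltxx.
have zz := dotp_gt0 nz.
exists (dotp z w / (dotp z z * cos a)).
  by rewrite divr_gt0 // mulr_gt0.
rewrite sa {sa nz}; move: (cos a) ca => c c0; clear a.
case: w z d0 zz => [w1 w2] [z1 z2]; rewrite /dotp /crossp /= => d0 zz.
by congr (_, _); field; rewrite ?gt_eqF.
Qed.

Lemma rotated0 z : rotated 0 z z.
Proof.
exists 1 => //; case: z => z1 z2; rewrite sin0 cos0 /=.
by congr (_, _); ring.
Qed.

Lemma rotated_trans a b x y z :
  rotated a x y -> rotated b y z -> rotated (a + b) x z.
Proof.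
move=> [r r0 ->] [s s0 ->] /=; exists (r * s); first exact: mulr_gt0.
by rewrite cosD sinD; congr (_, _); ring.
Qed.

Lemma rotated_self a z : z <> (0, 0) -> rotated a z z -> sin a = 0 /\ 0 < cos a.
Proof.
move=> /dotp_gt0 zz [r r0 e].
have e1 : z.1 = r * (cos a * z.1 - sin a * z.2) by rewrite {1}e.
have e2 : z.2 = r * (sin a * z.1 + cos a * z.2) by rewrite {1}e.
have rc : dotp z z * (r * cos a - 1) = 0.
  transitivity (z.1 * (r * (cos a * z.1 - sin a * z.2) - z.1)
    + z.2 * (r * (sin a * z.1 + cos a * z.2) - z.2)); first by rewrite /dotp; ring.
  by rewrite -e1 -e2 !subrr !mulr0 addr0.
have rs : dotp z z * (r * sin a) = 0.
  transitivity (z.1 * (r * (sin a * z.1 + cos a * z.2) - z.2)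
    - z.2 * (r * (cos a * z.1 - sin a * z.2) - z.1)); first by rewrite /dotp; ring.
  by rewrite -e1 -e2 !subrr !mulr0 subr0.
move/eqP: rc; rewrite mulf_eq0 gt_eqF //= subr_eq0 => /eqP rc.
move/eqP: rs; rewrite !mulf_eq0 gt_eqF //= gt_eqF //= => /eqP ->; split => //.
by rewrite -(pmulr_rgt0 _ r0) rc.
Qed.

Lemma rotated_opp a z : z <> (0, 0) -> rotated a z (- z.1, - z.2) -> cos a < 0.
Proof.
move=> /dotp_gt0 zz [r r0 [e1 e2]].
have rc : dotp z z * (r * cos a + 1) = 0.
  transitivity (z.1 * (r * (cos a * z.1 - sin a * z.2) + z.1)
    + z.2 * (r * (sin a * z.1 + cos a * z.2) + z.2)); first by rewrite /dotp; ring.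
  by rewrite -e1 -e2 !addNr !mulr0 addr0.
move/eqP: rc; rewrite mulf_eq0 gt_eqF //= addr_eq0 => /eqP rc.
by rewrite -(pmulr_rlt0 _ r0) rc ltrN10.
Qed.

(** For a closed polygon with small steps around the origin, 2 pi times its winding number. *)
Definition wsum (n : nat) (c : nat -> P2) : R := \sum_(i < n) ang (c i) (c i.+1).

Lemma rotated_wsum n c : (forall i, (i < n)%N -> 0 < dotp (c i) (c i.+1)) ->
  rotated (wsum n c) (c 0%N) (c n).
Proof.
rewrite /wsum; elim: n => [|n IH] H; first by rewrite big_ord0; exact: rotated0.
rewrite big_ord_recr /=; apply: rotated_trans; last exact/rotated_ang/H.
by apply: IH => i ni; apply: H; rewrite ltnS ltnW.
Qed.

(** The values of [f] lie in 2 pi Z. Were [f] to increase, the intermediate value theorem would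
    produce a value exceeding [f 0] by less than pi, and its sine would be positive. *)
Lemma sin0_not_increasing (f : R -> R) : continuous f ->
  (forall t, sin (f t) = 0 /\ 0 < cos (f t)) -> f 0 < f 1 -> False.
Proof.
move=> cf H f01; set m := Num.min (f 1 - f 0) 1.
have m0 : 0 < m by rewrite lt_min subr_gt0 f01 ltr01.
have [c _ fc] : exists2 c, c \in `[0 : R, 1] & f c = f 0 + m.
  apply: IVT => //; first exact: continuous_subspaceT.
  rewrite (min_idPl (ltW f01)) (max_idPr (ltW f01)) lerDl (ltW m0) /=.
  by rewrite -lerBrDl ge_min lexx.
have sm : 0 < sin m.
  apply: sin_gt0_pi; rewrite m0 /= (@lt_le_trans _ _ 2) ?pi_ge2 //.
  by rewrite gt_min ltr1n orbT.
have [sc _] := H c; have [s0 c0] := H 0.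
move: sc; rewrite fc sinD s0 mul0r add0r => /eqP.
by rewrite mulf_eq0 !gt_eqF.
Qed.

Lemma sin0_const (f : R -> R) : continuous f ->
  (forall t, sin (f t) = 0 /\ 0 < cos (f t)) -> f 0 = f 1.
Proof.
move=> cf H; apply/eqP; case: ltgtP => // h; exfalso.
  exact: (sin0_not_increasing cf H).
apply: (@sin0_not_increasing (fun t => - f t)).
- by move=> t; apply: cvgN; exact: cf.
- by move=> t; rewrite sinN cosN; have [-> ?] := H t; rewrite oppr0.
- by rewrite ltrN2.
Qed.

Lemma continuous_pair (T : topologicalType) (f g : T -> R) :
  continuous f -> continuous g -> continuous (fun t => (f t, g t) : P2).
Proof.
by move=> cf cg t; apply: (cvg_pair (cf t) (cg t)).
Qed.

Lemma continuous_fstf (T : topologicalType) (f : T -> P2) :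
  continuous f -> continuous (fun t => (f t).1).
Proof. by move=> cf t; apply: (cvg_comp _ _ (cf t)); exact: cvg_fst. Qed.

Lemma continuous_sndf (T : topologicalType) (f : T -> P2) :
  continuous f -> continuous (fun t => (f t).2).
Proof. by move=> cf t; apply: (cvg_comp _ _ (cf t)); exact: cvg_snd. Qed.

Lemma continuousDf (T : topologicalType) (f g : T -> R) :
  continuous f -> continuous g -> continuous (fun t => f t + g t).
Proof. by move=> cf cg t; apply: cvgD; [exact: cf|exact: cg]. Qed.

Lemma continuousBf (T : topologicalType) (f g : T -> R) :
  continuous f -> continuous g -> continuous (fun t => f t - g t).
Proof. by move=> cf cg t; apply: cvgB; [exact: cf|exact: cg]. Qed.

Lemma continuousMf (T : topologicalType) (f g : T -> R) :
  continuous f -> continuous g -> continuous (fun t => f t * g t).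
Proof. by move=> cf cg t; apply: cvgM; [exact: cf|exact: cg]. Qed.

Lemma continuous_compf (T U V : topologicalType) (f : T -> U) (g : U -> V) :
  continuous f -> continuous g -> continuous (fun t => g (f t)).
Proof. by move=> cf cg t; apply: cvg_comp; [exact: cf|exact: cg]. Qed.

Lemma continuous_clamp a b : continuous (fun t : R => Num.max a (Num.min t b)).
Proof.
move=> t; apply: (@continuous_max R R (fun=> a) (fun t => Num.min t b) t).
  exact: cvg_cst.
by apply: (@continuous_min R R id (fun=> b) t); [exact: cvg_id|exact: cvg_cst].
Qed.

Lemma continuous_dotp (T : topologicalType) (f g : T -> P2) :
  continuous f -> continuous g -> continuous (fun t => dotp (f t) (g t)).
Proof.
by move=> cf cg; apply: continuousDf; apply: continuousMf;
   (apply: continuous_fstf || apply: continuous_sndf).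
Qed.

Lemma continuous_crossp (T : topologicalType) (f g : T -> P2) :
  continuous f -> continuous g -> continuous (fun t => crossp (f t) (g t)).
Proof.
by move=> cf cg; apply: continuousBf; apply: continuousMf;
   (apply: continuous_fstf || apply: continuous_sndf).
Qed.

Lemma continuous_ang (T : topologicalType) (f g : T -> P2) :
  continuous f -> continuous g -> (forall t, 0 < dotp (f t) (g t)) ->
  continuous (fun t => ang (f t) (g t)).
Proof.
move=> cf cg d0 t; apply: cvg_comp; last exact: continuous_atan.
apply: cvgM; first exact: continuous_crossp.
by apply: cvgV; [rewrite gt_eqF|exact: continuous_dotp].
Qed.

(** A nonzero vector has positive product with itself, hence with nearby values of [H]; compactness
    of the rectangle makes the admissible step uniform. The loop parameter runs over [0, 2] because
    angles are written [pi * s]. *)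
Lemma dotp_unif (H : P2 -> P2) : continuous H ->
  (forall s (t : R), 0 <= s <= 2 -> 0 <= t <= 1 -> H (s, t) <> (0, 0)) ->
  exists2 d, 0 < d & forall s (t : R) s', 0 <= s <= 2 -> 0 <= t <= 1 ->
    `|s' - s| < d -> 0 < dotp (H (s, t)) (H (s', t)).
Proof.
move=> cH nH; pose K : set P2 := `[0, 2] `*` `[0, 1].
have : compact K by apply: compact_setX; exact: segment_compact.
move=> /compact_near_coveringP /(_ R 0^'+
  (fun d x => forall s', `|s' - x.1| < d -> 0 < dotp (H x) (H (s', x.2)))) [].
  move=> [s t] [/= sK tK].
  have c2 : continuous (fun z : P2 * P2 => dotp (H z.1) (H z.2)).
    by apply: continuous_dotp; apply: continuous_compf => // z;
       [exact: cvg_fst|exact: cvg_snd].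
  have d0 : 0 < dotp (H (s, t)) (H (s, t)).
    by apply/dotp_gt0/nH; move: sK tK; rewrite /= !in_itv.
  have := c2 ((s, t), (s, t)) _ (@lt_nbhsr _ _ _ d0).
  move=> /nbhs_ballP[e /= e0 He].
  exists (ball (s, t) (e / 2), [set d | d < e / 2]) => /=.
    split; first by apply: nbhsx_ballx; rewrite divr_gt0.
    by apply: nbhs_right_lt; rewrite divr_gt0.
  move=> [[s1 t1] d] [/= [b1 b2] de] s' s'd.
  apply: (He ((s1, t1), (s', t1))); split; split => //=.
  - by apply: le_ball b1; lra.
  - by apply: le_ball b2; lra.
  - move: b1 s'd; rewrite /ball /= => b1 s'd.
    have -> : s - s' = (s - s1) - (s' - s1) by ring.
    apply: (le_lt_trans (ler_normB _ _)).
    by have := ltr_leD b1 (ltW (lt_trans s'd de)); rewrite -splitr.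
  - by apply: le_ball b2; lra.
move=> e /= e0 He; have e20 : 0 < e / 2 by rewrite divr_gt0.
exists (e / 2) => // s t s' s2 t1 ss'.
apply: (He (e / 2) _ _ (s, t)) => //=.
  by rewrite sub0r normrN gtr0_norm //; lra.
Qed.

(** [N] samples per half turn: sample [N + i] has the parameter antipodal to that of sample [i], and
    sample [N.*2] closes the loop. *)
Definition sample (H : P2 -> P2) (N : nat) (t : R) (i : nat) : P2 :=
  H (i%:R / N%:R, t).

(** With steps below the uniform bound, the winding sum depends continuously on the time and cannot
    leave its value in 2 pi Z. A threshold [N0] is given, not a single [N], so that successive
    homotopies can share one sampling. *)
Lemma wsum_homotopy (H : P2 -> P2) : continuous H ->
  (forall s (t : R), 0 <= s <= 2 -> 0 <= t <= 1 -> H (s, t) <> (0, 0)) ->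
  (forall t : R, H (0, t) = H (2, t)) ->
  exists N0 : nat, forall N, (N0 <= N)%N -> (0 < N)%N ->
    (forall i, (i < N.*2)%N -> 0 < dotp (sample H N 1 i) (sample H N 1 i.+1)) /\
    wsum N.*2 (sample H N 0) = wsum N.*2 (sample H N 1).
Proof.
move=> cH nH lH; have [d d0 Hd] := dotp_unif cH nH.
exists (Num.bound d^-1) => N N0N N0.
have Nr : 0 < N%:R :> R by rewrite ltr0n.
have Nd : N%:R^-1 < d.
  rewrite -[d]invrK ltf_pV2 ?posrE ?invr_gt0 //.
  apply: (lt_le_trans (archi_boundP _)); first by rewrite invr_ge0 ltW.
  by rewrite ler_nat.
have pos t i : 0 <= t <= 1 -> (i < N.*2)%N ->
    0 < dotp (sample H N t i) (sample H N t i.+1).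
  move=> t1 iN; apply: Hd => //.
    rewrite divr_ge0 //= ler_pdivrMr // -natrM ler_nat mulnC muln2; exact: ltnW.
  by rewrite -mulrBl -natrB // subSnn mul1r gtr0_norm // invr_gt0.
split; first by move=> i iN; apply: pos => //; rewrite ler01 lexx.
(* Clamping the time to [0, 1] makes the winding sum a continuous function on the whole line, as
   [sin0_const] requires. *)
pose tau (t : R) := Num.max 0 (Num.min t 1).
have tau01 t : 0 <= tau t <= 1.
  by rewrite le_max lexx /= ge_max ler01 ge_min lexx orbT.
have ctau : continuous tau.
  exact: continuous_clamp.
pose f t := wsum N.*2 (sample H N (tau t)).
have -> : 0 = tau 0 by rewrite /tau (min_idPl ler01) maxxx.
have -> : 1 = tau 1 by rewrite /tau minxx (max_idPr ler01).
apply: (@sin0_const f).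
  rewrite /f /wsum => t.
  apply: cvg_big => [|i _].
    by apply: continuousDf => z; [exact: cvg_fst|exact: cvg_snd].
  apply: (@continuous_ang R (fun t => sample H N (tau t) i)
      (fun t => sample H N (tau t) i.+1)).
  - by apply: continuous_compf => //; apply: continuous_pair => // u; exact: cvg_cst.
  - by apply: continuous_compf => //; apply: continuous_pair => // u; exact: cvg_cst.
  - by move=> u; apply: pos.
move=> t; have n0 : sample H N (tau t) 0 <> (0, 0).
  by apply: nH => //; rewrite mul0r lexx ler0n.
apply: (rotated_self n0).
have {2}-> : sample H N (tau t) 0 = sample H N (tau t) N.*2.
  rewrite /sample mul0r lH; congr (H (_, _)).
  by rewrite -muln2 natrM mulrC mulKf // gt_eqF.
by apply: rotated_wsum => i iN; apply: pos.
Qed.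

End Winding.

(** * Invariance of domain by means of an odd loop *)

Section Invariance.
Variable R : realType.
Notation P2 := (R * R)%type.

Definition sq (e : R) (p : P2) := `|p.1| <= e /\ `|p.2| <= e.
Definition vsub (p r : P2) : P2 := (p.1 - r.1, p.2 - r.2).
(** The factor [a] may be negative and then gives the antipode, so a homotopy can pass through the
    center; [s] counts half turns. *)
Definition circ (e a s : R) : P2 := (a * (e * cos (pi * s)), a * (e * sin (pi * s))).

Lemma vsub_neq0 p r : p <> r -> vsub p r <> (0, 0).
Proof.
move=> pr [/eqP + /eqP]; rewrite !subr_eq0 => /eqP h1 /eqP h2.
by apply: pr; case: p r h1 h2 => ? ? [? ?] /= -> ->.
Qed.

Lemma continuous_vsub (T : topologicalType) (f g : T -> P2) :
  continuous f -> continuous g -> continuous (fun t => vsub (f t) (g t)).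
Proof.
move=> cf cg; apply: continuous_pair; apply: continuousBf;
  (exact: continuous_fstf || exact: continuous_sndf).
Qed.

Lemma continuous_circ (T : topologicalType) e (a s : T -> R) :
  continuous a -> continuous s -> continuous (fun t => circ e (a t) (s t)).
Proof.
move=> ca cs; have cps : continuous (fun t => pi * s t).
  by apply: continuousMf => // t; exact: cvg_cst.
apply: continuous_pair; apply: continuousMf => //; apply: continuousMf;
  try (by move=> t; exact: cvg_cst); apply: (continuous_compf cps).
- exact: continuous_cos.
- exact: continuous_sin.
Qed.

Lemma sq_circ e a s : 0 <= e -> `|a| <= 1 -> sq e (circ e a s).
Proof.
move=> e0 a1; split; rewrite /= !normrM (ger0_norm e0) -[leRHS]mul1r;
  apply: ler_pM => //; rewrite ?mulr_ge0 // -[leRHS]mulr1 ler_wpM2l //.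
- by rewrite ler_norml cos_geN1 cos_le1.
- by rewrite ler_norml sin_geN1 sin_le1.
Qed.

Lemma circ_inj e a b s : 0 < e -> circ e a s = circ e b s -> a = b.
Proof.
move=> e0 [h1 h2]; apply/eqP; rewrite -subr_eq0; apply/eqP.
have : (a - b) * e = 0.
  rewrite -[LHS]mulr1 -(cos2Dsin2 (pi * s)).
  transitivity ((a * (e * cos (pi * s)) - b * (e * cos (pi * s))) * cos (pi * s)
     + (a * (e * sin (pi * s)) - b * (e * sin (pi * s))) * sin (pi * s)).
    by ring.
  by rewrite h1 h2 !subrr !mul0r addr0.
by move/eqP; rewrite mulf_eq0 [e == 0]gt_eqF // orbF => /eqP.
Qed.

Lemma circ0 e s : circ e 0 s = (0, 0). Proof. by rewrite /circ !mul0r. Qed.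

Lemma circ_period e a : circ e a 0 = circ e a 2.
Proof. by rewrite /circ mulr0 cos0 sin0 mulr_natr cos2pi sin2pi. Qed.

Lemma circ_antipode e a s : circ e a (s + 1) = circ e (- a) s.
Proof.
by rewrite /circ mulrDr mulr1 cosDpi sinDpi; congr (_, _); ring.
Qed.

Lemma wsum_const n (c : nat -> P2) : (forall i, c i.+1 = c i) -> wsum n c = 0.
Proof.
move=> cE; rewrite /wsum big1 // => i _.
by rewrite cE /ang /crossp [X in _ - X]mulrC subrr mul0r atan0.
Qed.

(* Half of an odd loop turns z into - z, so the two equal halves of its winding
   sum have negative cosine and cannot vanish. *)
Lemma wsum_odd (n : nat) (c : nat -> P2) : c 0%N <> (0, 0) ->
  (forall i, (i < n)%N -> 0 < dotp (c i) (c i.+1)) ->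
  (forall i, c (n + i)%N = (- (c i).1, - (c i).2)) -> wsum n.*2 c <> 0.
Proof.
move=> c0 pos odd; rewrite /wsum -addnn big_split_ord /=.
have -> : \sum_(i < n) ang (c (n + i)%N) (c (n + i).+1) = wsum n c.
  apply: eq_bigr => i _; rewrite -addnS !odd /ang; congr atan; congr (_ / _).
    by rewrite /crossp /= !mulNr !mulrN !opprK.
  by rewrite /dotp /= !mulNr !mulrN !opprK.
rewrite -/(wsum n c) => /eqP; rewrite -mulr2n mulrn_eq0 /= => /eqP w0.
have cn := odd 0%N; rewrite addn0 in cn.
have := rotated_wsum pos; rewrite w0 cn.
by move=> /(rotated_opp c0); rewrite cos0 ltr10.
Qed.

(** Injectivity is asked on the square only, so that a map known on a square can be used after
    clamping the plane to it. *)
Theorem invariance_of_domain (G : P2 -> P2) (e : R) : 0 < e -> continuous G ->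
  (forall p r, sq e p -> sq e r -> G p = G r -> p = r) ->
  exists2 d, 0 < d & forall w, `|w.1 - (G (0, 0)).1| < d ->
    `|w.2 - (G (0, 0)).2| < d -> exists2 p, sq e p & G p = w.
Proof.
move=> e0 cG iG; set o := G (0, 0).
have sqc a s : `|a| <= 1 -> sq e (circ e a s) by apply: sq_circ; exact: ltW.
have cst (T : topologicalType) (x : R) : continuous (fun _ : T => x).
  by move=> t; exact: cvg_cst.
have cstp (T : topologicalType) (x : P2) : continuous (fun _ : T => x).
  by move=> t; exact: cvg_cst.
have cfst : continuous (fun p : P2 => p.1) by move=> p; exact: cvg_fst.
have csnd : continuous (fun p : P2 => p.2) by move=> p; exact: cvg_snd.
(* The sum distance from [o] to the image of the circle of radius [e]; its minimum [f m] is positive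
   by injectivity. *)
pose f s := `|(G (circ e 1 s)).1 - o.1| + `|(G (circ e 1 s)).2 - o.2|.
have cGc : continuous (fun s => G (circ e 1 s)).
  by apply: (continuous_compf (g := G)) => //; apply: continuous_circ => // t; exact: cvg_id.
have cf : continuous f.
  apply: continuousDf => s; apply: cvg_norm; apply: cvgB; try exact: cvg_cst.
    exact: continuous_fstf.
  exact: continuous_sndf.
have [m /= _ fm] : exists2 m, m \in `[0 : R, 2] &
    forall t, t \in `[0 : R, 2] -> f m <= f t.
  by apply: EVT_min => //; exact: continuous_subspaceT.
have fm0 : 0 < f m.
  have : G (circ e 1 m) <> o.
    move=> h; have : circ e 1 m = circ e 0 m.
      by rewrite circ0; apply: iG h; [apply: sqc; rewrite normr1|split; rewrite normr0 ltW].
    by move/(circ_inj e0)/eqP; rewrite oner_eq0.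
  move=> h; rewrite lt_neqAle addr_ge0 // andbT eq_sym paddr_eq0 //.
  apply/negP => /andP[]; rewrite !normr_eq0 !subr_eq0 => /eqP h1 /eqP h2; apply: h.
  by move: h1 h2; case: (G _) => ? ?; case: (o) => ? ? /= -> ->.
(* With both coordinates of [w] within [f m / 2] of those of [o], the segment from [w] to [o] stays
   at sum distance below [f m] from [o], hence off the image of the circle. This keeps [H2] away
   from 0. *)
exists (f m / 2); first by rewrite divr_gt0.
move=> w w1 w2; apply: contrapT => nw.
have {}nw p : sq e p -> G p <> w by move=> sp gp; apply: nw; exists p.
(* If w were not attained, H1, H2 and H3 would deform a constant loop into the
   odd loop G (x / 2) - G (- x / 2); H3 avoids 0 because G is injective. *)
pose H1 (p : P2) := vsub (G (circ e p.2 p.1)) w.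
pose H2 (p : P2) := vsub (G (circ e 1 p.1))
  ((1 - p.2) * w.1 + p.2 * o.1, (1 - p.2) * w.2 + p.2 * o.2).
pose H3 (p : P2) := vsub (G (circ e (1 - p.2 / 2) p.1)) (G (circ e (- (p.2 / 2)) p.1)).
have cH1 : continuous H1.
  by apply: continuous_vsub => //; apply: (continuous_compf (g := G)) => //; exact: continuous_circ.
have cH2 : continuous H2.
  apply: continuous_vsub; first exact: (continuous_compf (g := fun s => G (circ e 1 s))).
  by apply: continuous_pair; apply: continuousDf; apply: continuousMf => //; exact: continuousBf.
have ch : continuous (fun p : P2 => p.2 / 2) by exact: continuousMf.
have cH3 : continuous H3.
  apply: continuous_vsub; apply: (continuous_compf (g := G)) => //; apply: continuous_circ => //.
    exact: continuousBf.
  by move=> p; apply: cvgN; exact: ch.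
have n1 (s t : R) : 0 <= s <= 2 -> 0 <= t <= 1 -> H1 (s, t) <> (0, 0).
  move=> _ /andP[t0 t1]; apply/vsub_neq0/nw/sqc; by rewrite ger0_norm.
have n2 (s t : R) : 0 <= s <= 2 -> 0 <= t <= 1 -> H2 (s, t) <> (0, 0).
  move=> s2 /andP[t0 t1]; apply: vsub_neq0 => /= h.
  have : f m <= f s by apply: fm; rewrite in_itv.
  apply/negP; rewrite -ltNge /f h /= [ltRHS]splitr.
  have hb (x y : R) : `|x - y| < f m / 2 -> `|(1 - t) * x + t * y - y| < f m / 2.
    have -> : (1 - t) * x + t * y - y = (1 - t) * (x - y) by ring.
    apply: le_lt_trans; rewrite normrM ler_piMl // ger0_norm ?subr_ge0 //.
    by rewrite lerBlDr lerDl.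
  by apply: ltrD; apply: hb.
have n3 (s t : R) : 0 <= s <= 2 -> 0 <= t <= 1 -> H3 (s, t) <> (0, 0).
  move=> _ /andP[t0 t1]; apply: vsub_neq0 => /= /iG h.
  have /(circ_inj e0) : circ e (1 - t / 2) s = circ e (- (t / 2)) s.
    by apply: h; apply: sqc; rewrite ler_norml; lra.
  lra.
have l1 (t : R) : H1 (0, t) = H1 (2, t) by rewrite /H1 /= circ_period.
have l2 (t : R) : H2 (0, t) = H2 (2, t) by rewrite /H2 /= circ_period.
have l3 (t : R) : H3 (0, t) = H3 (2, t) by rewrite /H3 /= !circ_period.
have [N1 W1] := wsum_homotopy cH1 n1 l1.
have [N2 W2] := wsum_homotopy cH2 n2 l2.
have [N3 W3] := wsum_homotopy cH3 n3 l3.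
pose N := (N1 + N2 + N3).+1.
have [|_ {}W1] := W1 N _ isT; first by rewrite /N; lia.
have [|_ {}W2] := W2 N _ isT; first by rewrite /N; lia.
have [|pos {}W3] := W3 N _ isT; first by rewrite /N; lia.
have e12 : sample H1 N 1 = sample H2 N 0.
  by apply/funext => i; rewrite /sample /H1 /H2 /= subr0 !mul1r !mul0r !addr0; case: (w).
have e23 : sample H2 N 1 = sample H3 N 0.
  apply/funext => i; rewrite /sample /H2 /H3 /= subrr !mul0r !mul1r !add0r subr0 oppr0 circ0.
  by rewrite -/o; case: (o).
apply: (@wsum_odd N (sample H3 N 1)).
- by apply: n3; rewrite ?ler01 ?lexx // mul0r lexx ler0n.
- by move=> i iN; apply: pos; rewrite -addnn ltn_addr.
- move=> i; rewrite /sample /H3 /=.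
  have -> : (N + i)%:R / N%:R = i%:R / N%:R + 1 :> R.
    by rewrite natrD mulrDl divff ?pnatr_eq0 // addrC.
  rewrite !circ_antipode opprK.
  have -> : 1 - 1 / 2 = 1 / 2 :> R by lra.
  by rewrite /vsub /= !opprB.
- rewrite -W3 -e23 -W2 -e12 -W1; apply: wsum_const => i.
  by rewrite /sample /H1 /= !circ0.
Qed.

End Invariance.

(** * Relative continuity in the plane and disks in surfaces *)

Section PlaneContinuity.
Variable R : realType.
Notation P2 := (R * R)%type.
Implicit Types (p r : P2) (A B : set P2).

Definition near2 (e : R) p r := `|r.1 - p.1| < e /\ `|r.2 - p.2| < e.

Lemma near2E e p : near2 e p = ball p e.
Proof. by apply/funext => r; rewrite /near2 !(distrC r.1) !(distrC r.2). Qed.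

Lemma near2xx e p : 0 < e -> near2 e p p.
Proof. by move=> e0; split; rewrite subrr normr0. Qed.

Lemma near2_le e d p r : e <= d -> near2 e p r -> near2 d p r.
Proof. by move=> ed [h1 h2]; split; apply: lt_le_trans ed. Qed.

Lemma open_near2 e p : open (near2 e p : set P2).
Proof. rewrite near2E; exact: ball_open. Qed.

Lemma nbhs_near2 p (V : set P2) :
  nbhs p V <-> exists2 e, 0 < e & forall r, near2 e p r -> V r.
Proof.
split; first by move=> /nbhs_ballP[e e0 eV]; exists e => // r; rewrite near2E; exact: eV.
by move=> [e e0 eV]; apply/nbhs_ballP; exists e => //; rewrite -near2E.
Qed.

Lemma relopenP A U : relopen A U <-> U `<=` A /\
  forall p, U p -> exists2 e, 0 < e & forall r, A r -> near2 e p r -> U r.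
Proof.
split=> [[Q [oQ ->]]|[UA H]].
  split=> [p [] //|p [Ap Qp]].
  have /nbhs_near2[e e0 eO] : nbhs p Q by exact: open_nbhs_nbhs.
  by exists e => // r Ar rp; split => //; exact: eO.
pose I := [set x : P2 * R | U x.1 /\ forall r, A r -> near2 x.2 x.1 r -> U r].
exists (\bigcup_(x in I) near2 x.2 x.1); split.
  by apply: bigcup_open => x _; exact: open_near2.
apply/seteqP; split=> [p Up|p [Ap [x [_ xU] px]]]; last exact: xU.
split; first exact: UA.
by have [e e0 eU] := H p Up; exists (p, e) => //; exact: near2xx.
Qed.

(** Equivalent to [{within A, continuous f}] by [withinP]; the explicit radii suit estimates
    relative to strips, which need be neither open nor closed. *)
Definition cts (T : topologicalType) A (f : P2 -> T) := forall p, A p ->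
  forall V, open V -> V (f p) ->
  exists2 e, 0 < e & forall r, A r -> near2 e p r -> V (f r).

Lemma withinP (T : topologicalType) A (f : P2 -> T) :
  {within A, continuous f} <-> cts A f.
Proof.
rewrite subspace_continuousP; split=> H p Ap.
  move=> V oV Vp; have /nbhs_near2[e e0 eV] := H p Ap V (open_nbhs_nbhs (conj oV Vp)).
  by exists e => // r Ar pr; exact: eV.
move=> V; rewrite nbhsE => -[Q [oQ Qp] QV].
have [e e0 eQ] := H p Ap Q oQ Qp.
by apply/nbhs_near2; exists e => // r pr Ar; exact/QV/eQ.
Qed.

Lemma within_comp (T U V : topologicalType) (A : set T) (B : set U)
    (f : T -> U) (g : U -> V) : {within A, continuous f} ->
  (forall a, A a -> B (f a)) -> {within B, continuous g} ->
  {within A, continuous (g \o f)}.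
Proof.
rewrite !subspace_continuousP => cf AB cg a Aa.
apply: (cvg_comp _ _ _ (cg _ (AB _ Aa))) => P BP.
have := cf a Aa _ BP; rewrite /fmap /within /= !nbhs_simpl /=.
by apply: filterS => x Px Ax; exact: (Px Ax (AB _ Ax)).
Qed.

Lemma cts_comp (T : topologicalType) A B (f : P2 -> P2) (g : P2 -> T) :
  cts A f -> (forall p, A p -> B (f p)) -> cts B g -> cts A (g \o f).
Proof.
move=> /withinP cf AB /withinP cg; apply/withinP; exact: within_comp cf AB cg.
Qed.

Lemma cts_subset (T : topologicalType) A B (f : P2 -> T) :
  A `<=` B -> cts B f -> cts A f.
Proof.
move=> AB cf p Ap V oV Vp; have [e e0 eV] := cf p (AB _ Ap) V oV Vp.
by exists e => // r Ar; apply: eV; exact: AB.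
Qed.

Lemma ctsR A (f : P2 -> R) : cts A f <-> forall p, A p -> forall e, 0 < e ->
  exists2 d, 0 < d & forall r, A r -> near2 d p r -> `|f r - f p| < e.
Proof.
split=> H p Ap.
  move=> e e0; have [d d0 dV] := H p Ap _ (ball_open (f p) e) (ballxx _ e0).
  by exists d => // r Ar pr; rewrite distrC; exact: dV.
move=> V oV Vp; have /nbhs_ballP[e e0 eV] : nbhs (f p) V by exact: open_nbhs_nbhs.
have [d d0 dV] := H p Ap e e0; exists d => // r Ar pr; apply: eV.
by rewrite /ball /= distrC; exact: dV.
Qed.

Lemma cts_pair A (f : P2 -> P2) :
  cts A f <-> cts A (fun p => (f p).1) /\ cts A (fun p => (f p).2).
Proof.
split=> [H|[/ctsR H1 /ctsR H2] p Ap V oV Vp].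
  split; apply/ctsR => p Ap e e0;
    have [d d0 dV] := H p Ap _ (@open_near2 e (f p)) (near2xx _ e0);
    by exists d => // r Ar pr; case: (dV r Ar pr).
have /nbhs_near2[e e0 eV] : nbhs (f p) V by exact: open_nbhs_nbhs.
have [d1 d10 h1] := H1 p Ap e e0; have [d2 d20 h2] := H2 p Ap e e0.
exists (Num.min d1 d2); first by rewrite lt_min d10 d20.
move=> r Ar pr; apply: eV; split.
  by apply: h1 => //; apply: near2_le pr; rewrite ge_min lexx.
by apply: h2 => //; apply: near2_le pr; rewrite ge_min lexx orbT.
Qed.

Lemma cts_near2 A (f : P2 -> P2) : cts A f <-> forall p, A p -> forall e, 0 < e ->
  exists2 d, 0 < d & forall r, A r -> near2 d p r -> near2 e (f p) (f r).
Proof.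
split=> H p Ap.
  by move=> e e0; exact: H p Ap _ (@open_near2 e (f p)) (near2xx _ e0).
move=> V oV Vp; have /nbhs_near2[e e0 eV] : nbhs (f p) V by exact: open_nbhs_nbhs.
have [d d0 dV] := H p Ap e e0; exists d => // r Ar pr; exact/eV/dV.
Qed.

Lemma cts_continuous (T : topologicalType) A (f : P2 -> T) : continuous f -> cts A f.
Proof. by move=> cf; apply/withinP; exact: continuous_subspaceT. Qed.

Lemma ctsT_continuous (T : topologicalType) (f : P2 -> T) : cts setT f -> continuous f.
Proof.
by move=> cf; rewrite continuous_subspace_setT; apply/withinP.
Qed.

Definition clamp2 (e : R) p : P2 :=
  (Num.max (- e) (Num.min p.1 e), Num.max (- e) (Num.min p.2 e)).

Lemma clamp2_sq e p : 0 <= e -> sq e (clamp2 e p).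
Proof.
by move=> e0; split; rewrite ler_norml le_max lexx /= ge_max ge_min lexx orbT andbT ge0_cp.
Qed.

Lemma clamp2_id e p : sq e p -> clamp2 e p = p.
Proof.
case: p => a b [/=]; rewrite !ler_norml => /andP[a1 a2] /andP[b1 b2].
by rewrite /clamp2 /= (min_idPl a2) (min_idPl b2) (max_idPr a1) (max_idPr b1).
Qed.

Lemma continuous_clamp2 e : continuous (clamp2 e).
Proof.
apply: continuous_pair;
  apply: (continuous_compf (g := fun t => Num.max (- e) (Num.min t e))).
- by move=> ?; exact: cvg_fst.
- exact: continuous_clamp.
- by move=> ?; exact: cvg_snd.
- exact: continuous_clamp.
Qed.

(** Follow the disk by a chart at its center. On a smaller square that lands in the chart domain the
    composite is injective into the plane, invariance of domain makes its image a neighborhood, and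
    the chart pulls this back to [Z]. *)
Theorem two_manifold_disk (Z : topologicalType) (F : P2 -> Z) :
  two_manifold R Z -> cts (sq 1) F ->
  (forall p r, sq 1 p -> sq 1 r -> F p = F r -> p = r) ->
  exists V : set Z, [/\ open V, V (F (0, 0)) & V `<=` F @` sq 1].
Proof.
move=> [_ mZ] cF iF.
have [U [oU U0 [W [f [_ _ [g [[fW gU gK fK] [cf cg]]]]]]]] := mZ (F (0, 0)).
have sq0 (e : R) : 0 <= e -> sq e (0, 0) by move=> e0; split; rewrite normr0.
have [e1 e10 He1] := cF _ (sq0 1 ler01) U oU U0.
pose e := Num.min 1 (e1 / 2).
have e0 : 0 < e by rewrite lt_min ltr01 divr_gt0.
have sq1 (p : P2) : sq e p -> sq 1 p.
  by move=> [h1 h2]; split; [apply: le_trans h1 _|apply: le_trans h2 _];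
     rewrite ge_min lexx.
have ee1 : e < e1 by rewrite gt_min; apply/orP; right; lra.
have FU (p : P2) : sq e p -> U (F p).
  move=> sp; apply: He1 (sq1 _ sp) _; case: sp => h1 h2.
  by split; rewrite subr0; [apply: le_lt_trans h1 _|apply: le_lt_trans h2 _].
pose G := f \o (F \o clamp2 e).
have cG : continuous G.
  apply: ctsT_continuous; apply/withinP.
  apply: (within_comp (B := U) (g := f)) => //.
    apply/withinP; apply: (cts_comp (B := sq e)).
    - exact/cts_continuous/continuous_clamp2.
    - by move=> p _; apply: clamp2_sq; exact: ltW.
    - exact: cts_subset cF.
  by move=> p _; apply/FU/clamp2_sq/ltW.
have Gsq (p : P2) : sq e p -> G p = f (F p) by move=> sp; rewrite /G /= clamp2_id.
have [p r sp sr|d d0 Hd] := invariance_of_domain e0 cG.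
  rewrite !Gsq // => h; apply: iF; try exact: sq1.
  by rewrite -(gK _ (FU _ sp)) -(gK _ (FU _ sr)) h.
exists (U `&` f @^-1` near2 d (f (F (0, 0)))); split.
- rewrite openE => u [Uu fu]; apply: filterI; first exact: open_nbhs_nbhs.
  have h : nbhs u [set x | U x -> near2 d (f (F (0, 0))) (f x)].
    move: cf; rewrite subspace_continuousP => /(_ u Uu).
    by move=> /(_ _ (open_nbhs_nbhs (conj (@open_near2 d (f (F (0, 0)))) fu))).
  have Uu' : nbhs u U by exact: open_nbhs_nbhs.
  apply: (@filterS _ (nbhs u) _ (U `&` [set x | U x -> near2 d (f (F (0, 0))) (f x)])).
    by move=> x [Ux]; exact.
  exact: filterI.
- by split => //=; exact: near2xx.
- move=> u [Uu [h1 h2]]; have G0 : G (0, 0) = f (F (0, 0)) by apply/Gsq/sq0/ltW.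
  have [||p sp] := Hd (f u); rewrite ?G0 // Gsq // => h; exists p; first exact: sq1.
  by rewrite -(gK _ (FU _ sp)) h gK.
Qed.

End PlaneContinuity.

(** * Strips and their boundary intervals *)

Section Strips.
Variable R : realType.
Notation P2 := (R * R)%type.
Implicit Types (p r c : P2) (A B S X Y : set P2).

Definition seg p c (t : R) : P2 :=
  (p.1 + t * (c.1 - p.1), p.2 + t * (c.2 - p.2)).

Lemma seg0 p c : seg p c 0 = p.
Proof. by case: p => a b; rewrite /seg !mul0r !addr0. Qed.

Lemma seg1 p c : seg p c 1 = c.
Proof. by case: c => a b; rewrite /seg !mul1r !subrKC. Qed.

(** Two points travel along their segments simultaneously; if the compared values never agree, the
    intermediate value theorem forbids an exchange of order. The signs of gluing maps, rows and
    levels are all shown constant in this way. *)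
Lemma seg_sign A B (phi psi : P2 -> R) p1 p2 c1 c2 : cts A phi -> cts B psi ->
  (forall t, 0 <= t <= 1 -> A (seg p1 c1 t)) ->
  (forall t, 0 <= t <= 1 -> B (seg p2 c2 t)) ->
  (forall t, 0 <= t <= 1 -> phi (seg p1 c1 t) <> psi (seg p2 c2 t)) ->
  phi p1 < psi p2 -> phi c1 < psi c2.
Proof.
move=> cphi cpsi pA pB neq lt.
pose k (t : R) := Num.max 0 (Num.min t 1).
have k01 t : 0 <= k t <= 1 by rewrite le_max lexx /= ge_max ler01 ge_min lexx orbT.
have kid t : 0 <= t <= 1 -> k t = t.
  by move=> /andP[t0 t1]; rewrite /k (min_idPl t1) (max_idPr t0).
have ck : continuous (fun z : P2 => k z.1).
  by apply: (continuous_compf (g := k)); [move=> z; exact: cvg_fst|exact: continuous_clamp].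
have cst (a : R) : continuous (fun z : P2 => a) by move=> z; exact: cvg_cst.
have cseg p c : cts setT (fun z : P2 => seg p c (k z.1)).
  by apply/cts_continuous/continuous_pair; apply: continuousDf => //; exact: continuousMf.
have c1' : continuous (fun z : P2 => phi (seg p1 c1 (k z.1))).
  by apply/ctsT_continuous/(cts_comp (cseg p1 c1) _ cphi) => z _; exact: pA.
have c2' : continuous (fun z : P2 => psi (seg p2 c2 (k z.1))).
  by apply/ctsT_continuous/(cts_comp (cseg p2 c2) _ cpsi) => z _; exact: pB.
pose f (t : R) := psi (seg p2 c2 (k t)) - phi (seg p1 c1 (k t)).
have cf : continuous f.
  have ci : continuous (fun t : R => (t, 0) : P2).
    by apply: continuous_pair => t; [exact: cvg_id|exact: cvg_cst].
  exact: (continuousBf (continuous_compf ci c2') (continuous_compf ci c1')).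
have k0 : k 0 = 0 by apply: kid; rewrite lexx ler01.
have k1 : k 1 = 1 by apply: kid; rewrite lexx ler01.
rewrite ltNge; apply/negP => le.
have [t _ ft] : exists2 t, t \in `[0 : R, 1] & f t = 0.
  apply: IVT => //; first exact: continuous_subspaceT.
  rewrite /f k0 k1 !seg0 !seg1 ge_min le_max !subr_le0 !subr_ge0 le (ltW lt).
  by rewrite orbT.
by apply: (neq (k t)) => //; apply/eqP; rewrite eq_sym -subr_eq0; apply/eqP.
Qed.

Lemma is_interval_fst X : connected X -> is_interval [set x | exists y, X (x, y)].
Proof.
move=> cX; apply/connected_intervalP.
have -> : [set x | exists y, X (x, y)] = fst @` X.
  apply/seteqP; split=> [x [y Xy]|_ [[x y] Xy <-]]; first by exists (x, y).
  by exists y.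
apply: connected_continuous_connected => //.
by apply: continuous_subspaceT => p; exact: cvg_fst.
Qed.

Lemma is_interval_snd X : connected X -> is_interval (snd @` X).
Proof.
move=> cX; apply/connected_intervalP/connected_continuous_connected => //.
by apply: continuous_subspaceT => p; exact: cvg_snd.
Qed.

Variables (S : set P2) (u v : R).
Hypothesis hS : is_strip S u v.

Let uv : u < v. Proof. by case: hS. Qed.
Lemma strip_interior p : u < p.2 < v -> S p. Proof. by case: hS => _ H _ _; exact: H. Qed.
Lemma strip_bounds p : S p -> u <= p.2 <= v. Proof. by case: hS => _ _ H _; exact: H. Qed.

Lemma strip_open p : S p ->
  exists2 e, 0 < e & forall r, u <= r.2 <= v -> near2 e p r -> S r.
Proof. by case: hS => _ _ _ /relopenP[_ H]; exact: H. Qed.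

Lemma seg_interior p c t : u <= p.2 <= v -> u < c.2 < v -> 0 < t <= 1 ->
  u < (seg p c t).2 < v.
Proof.
move=> /andP[p1 p2] /andP[c1 c2] /andP[t0 t1] /=.
have -> : p.2 + t * (c.2 - p.2) = (1 - t) * p.2 + t * c.2 by ring.
have h1 : (1 - t) * u <= (1 - t) * p.2 by rewrite ler_wpM2l // subr_ge0.
have h2 : (1 - t) * p.2 <= (1 - t) * v by rewrite ler_wpM2l // subr_ge0.
have h3 : t * u < t * c.2 by rewrite ltr_pM2l.
have h4 : t * c.2 < t * v by rewrite ltr_pM2l.
lra.
Qed.

Lemma seg_strip p c t : S p -> u < c.2 < v -> 0 <= t <= 1 -> S (seg p c t).
Proof.
move=> Sp hc /andP[]; rewrite le_eqVlt => /orP[/eqP <- _|t0 t1]; first by rewrite seg0.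
by apply/strip_interior/seg_interior => //; [exact: strip_bounds|rewrite t0].
Qed.

(** Every point of [A] is joined to the center of the strip by a segment that is interior except
    perhaps at its start, so [A] may miss any part of the boundary. *)
Lemma strip_sign A (f : P2 -> R) : A `<=` S -> (forall p, u < p.2 < v -> A p) ->
  cts A f -> (forall p, A p -> f p <> 0) -> forall p r, A p -> A r ->
  0 < f p -> 0 < f r.
Proof.
move=> AS iA cf f0 p r Ap Ar fp; pose c : P2 := (0, (u + v) / 2).
have ic : u < c.2 < v by move: uv; rewrite /=; lra.
have segA q : A q -> forall t, 0 <= t <= 1 -> A (seg q c t).
  move=> Aq t /andP[]; rewrite le_eqVlt => /orP[/eqP <- _|t0 t1]; first by rewrite seg0.
  by apply/iA/seg_interior => //; [exact/strip_bounds/AS|rewrite t0].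
have cst : cts A (fun _ => 0 : R) by apply: cts_continuous => x; exact: cvg_cst.
have fc : 0 < f c.
  apply: (seg_sign (phi := fun _ => 0) (p1 := p) cst cf (segA p Ap) (segA p Ap) _ fp).
  by move=> t t1 /esym; apply: f0; exact: segA.
case: (ltgtP (f r) 0) => // [h|/(f0 _ Ar)//].
have : f c < 0.
  apply: (seg_sign (psi := fun _ => 0) (p2 := r) cf cst (segA r Ar) (segA r Ar) _ h).
  by move=> t t1; apply: f0; exact: segA.
by move=> /(lt_trans fc); rewrite ltxx.
Qed.

Lemma bdryP p : bdry S u v p <-> S p /\ (p.2 = u \/ p.2 = v).
Proof. by split=> [[[? ?]|[? ?]]|[? [?|?]]]; [split; auto|split; auto|left|right]. Qed.

Lemma bdry_or_interior p : S p -> bdry S u v p \/ u < p.2 < v.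
Proof.
move=> Sp; have /andP[] := strip_bounds Sp.
rewrite le_eqVlt => /orP[/eqP e _|h1]; first by left; apply/bdryP; split; auto.
rewrite le_eqVlt => /orP[/eqP e|h2]; first by left; apply/bdryP; split; auto.
by right; rewrite h1.
Qed.

Lemma bdry_not_interior p : bdry S u v p -> u < p.2 < v -> False.
Proof. by move=> /bdryP[_ [->|->]]; rewrite ltxx ?andbF. Qed.

Lemma boundary_interval_component p : bdry S u v p ->
  boundary_interval S u v (connected_component (bdry S u v) p) /\
  connected_component (bdry S u v) p p.
Proof. by move=> bp; split; [exists p|exact: connected_component_refl]. Qed.

Lemma boundary_interval_eq X Y p :
  boundary_interval S u v X -> boundary_interval S u v Y -> X p -> Y p -> X = Y.
Proof.
move=> [x bx ->] [y bY ->] /same_connected_component -> /same_connected_component -> //.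
Qed.

Lemma boundary_interval_sub X : boundary_interval S u v X -> X `<=` bdry S u v.
Proof. by move=> [x bx ->]; exact: connected_component_sub. Qed.

Lemma boundary_interval_neq0 X : boundary_interval S u v X -> X !=set0.
Proof. by move=> [x bx ->]; exists x; exact: connected_component_refl. Qed.

Lemma boundary_interval_connected X : boundary_interval S u v X -> connected X.
Proof. by move=> [x bx ->]; exact: component_connected. Qed.

(** The heights of a component form an interval, and [(u + v) / 2] is not a boundary height. *)
Lemma boundary_interval_level X : boundary_interval S u v X ->
  exists2 c, c = u \/ c = v & forall p, X p -> p.2 = c.
Proof.
move=> bX; have [x Xx] := boundary_interval_neq0 bX.
have lv p : X p -> p.2 = u \/ p.2 = v.
  by move=> /(boundary_interval_sub bX)/bdryP[].
exists x.2; first exact: lv.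
move=> p Xp; have iX := is_interval_snd (boundary_interval_connected bX).
have mid a b : X a -> X b -> a.2 = u -> b.2 = v -> False.
  move=> Xa Xb au bv.
  have [||| c /lv lc e] := iX a.2 b.2 _ _ ((u + v) / 2).
  - by exists a.
  - by exists b.
  - by move: uv; rewrite au bv => ?; apply/andP; split; lra.
  by move: uv; case: lc; rewrite e; lra.
case: (lv _ Xx) (lv _ Xp) => xl [] pl; rewrite xl pl //; exfalso.
- exact: (mid x p).
- exact: (mid p x).
Qed.

Lemma boundary_interval_convex X p r x : boundary_interval S u v X ->
  X p -> X r -> p.1 <= x <= r.1 -> X (x, p.2).
Proof.
move=> bX Xp Xr hx; have [c _ lv] := boundary_interval_level bX.
have iX := is_interval_fst (boundary_interval_connected bX).
have [y] : exists y, X (x, y).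
  by apply: (iX p.1 r.1) => //=; [exists p.2|exists r.2]; rewrite -surjective_pairing.
by move=> Xy; rewrite (lv _ Xp) -(lv _ Xy).
Qed.

(** A short horizontal segment through [p] lies in the boundary because [S] is relatively open, and
    being connected it stays in the component. *)
Lemma boundary_interval_open X p : boundary_interval S u v X -> X p ->
  exists2 e, 0 < e & forall x, `|x - p.1| < e -> X (x, p.2).
Proof.
move=> bX Xp; have /bdryP[Sp lp] := boundary_interval_sub bX Xp.
have [e e0 He] := strip_open Sp; exists e => // x xe.
pose I := [set z : R | `|z - p.1| < e].
have XE : X = connected_component (bdry S u v) p.
  by case: bX Xp => y by' -> /same_connected_component.
rewrite XE; apply: (@connected_component_max _ _ ((fun z => (z, p.2)) @` I)).
- by exists p.1; [rewrite /I /= subrr normr0|rewrite -surjective_pairing].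
- move=> _ [z Iz <-]; apply/bdryP; split => //; apply: He.
    exact: strip_bounds Sp.
  by split => //=; rewrite subrr normr0.
- apply: connected_continuous_connected.
    apply/connected_intervalP => a b Ia Ib c; move: Ia Ib; rewrite /I /=.
    by rewrite !ltr_norml; lra.
  by apply/continuous_subspaceT/continuous_pair => z; [exact: cvg_id|exact: cvg_cst].
- by exists x.
Qed.

(** For disjoint convex sets on one line, a single ordered pair of points decides the order. *)
Lemma boundary_interval_lt X Y p r : boundary_interval S u v X ->
  boundary_interval S u v Y -> X <> Y -> X p -> Y r -> p.2 = r.2 -> p.1 < r.1 ->
  int_lt X Y.
Proof.
move=> bX bY XY Xp Yr pr2 pr a b Xa Yb; rewrite ltNge; apply/negP => ba.
have dis q : X q -> Y q -> False by move=> Xq Yq; exact: XY (boundary_interval_eq bX bY Xq Yq).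
have [c _ lX] := boundary_interval_level bX.
have [d _ lY] := boundary_interval_level bY.
have cd : c = d by rewrite -(lX _ Xp) pr2 (lY _ Yr).
case: (leP b.1 p.1) => [bp|pb].
  apply: (dis p) => //; have := boundary_interval_convex (x := p.1) bY Yb Yr.
  rewrite bp (ltW pr) => /(_ isT).
  by rewrite (lY _ Yb) -cd -(lX _ Xp) -surjective_pairing.
apply: (dis b) => //; have := boundary_interval_convex (x := b.1) bX Xp Xa.
rewrite ba (ltW pb) => /(_ isT).
by rewrite (lX _ Xp) cd -(lY _ Yb) -surjective_pairing.
Qed.

End Strips.

(** * Fibers of the quotient map *)

Section AtlasFibers.
Variables (R : realType) (A : atlas_data R).
Notation P2 := (R * R)%type.
Hypothesis hA : is_striped_atlas A.
Implicit Types (l m n : Lam A) (p r : P2) (X Y : set P2).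

Lemma atlas_strip l : is_strip (St A l) (su A l) (sv A l).
Proof. by case: hA => -[]. Qed.

Lemma atlas_bounds l : su A l < sv A l. Proof. by case: (atlas_strip l). Qed.

Lemma halfedge_boundary l X : halfedge A (l, X) ->
  boundary_interval (St A l) (su A l) (sv A l) X.
Proof. by []. Qed.

Lemma halfedge_sub l X : halfedge A (l, X) -> X `<=` St A l.
Proof. by move=> bX p /(boundary_interval_sub bX)/bdryP[]. Qed.

Lemma q_cts l : cts (St A l) (q A l).
Proof.
case: hA => _ [_ _ qt _] p Sp V /qt /(_ l) /relopenP[_ H] Vp.
have [e e0 He] := H p (conj Sp Vp).
by exists e => // r Sr pr; case: (He r Sr pr).
Qed.

Definition inner l p := su A l < p.2 < sv A l.

Lemma inner_St l p : inner l p -> St A l p.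
Proof. exact: strip_interior (atlas_strip l) _. Qed.

Lemma halfedge_not_inner l X p : halfedge A (l, X) -> X p -> ~ inner l p.
Proof. by move=> bX Xp; exact: (bdry_not_interior (boundary_interval_sub bX Xp)). Qed.


(** The closed edges as a symmetric relation on half-edges, without the fixed points that [xi_rel]
    carries. *)
Definition glu (H K : Lam A * set P2) := exists g : Gam A,
  (H = Xg A g /\ K = Yg A g) \/ (H = Yg A g /\ K = Xg A g).

Lemma glu_sym H K : glu H K -> glu K H.
Proof. by move=> [g [[-> ->]|[-> ->]]]; exists g; auto. Qed.

Lemma glu_halfedge H K : glu H K -> halfedge A H.
Proof. by case: hA => -[_ _ hg] _ [g [[-> _]|[-> _]]]; case: (hg g). Qed.

Lemma glu_neq H K : glu H K -> H <> K.
Proof. by case: hA => _ [[_ _ n] _ _ _] [g [[-> ->]|[-> ->]]] => [|/esym]; exact: n. Qed.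

Lemma glu_fun H K K' : glu H K -> glu H K' -> K = K'.
Proof.
case: hA => _ [[iX iY n] _ _ _] [g [[-> ->]|[-> ->]]] [g' [[e ->]|[e ->]]].
- by rewrite (iX _ _ e).
- by case: (n _ _ e).
- by case: (n _ _ (esym e)).
- by rewrite (iY _ _ e).
Qed.

Lemma gluedP l p : glued A l p <-> exists X K, glu (l, X) K /\ X p.
Proof.
split=> [[g [[e gp]|[e gp]]]|[X [K [[g [[e _]|[e _]]] Xp]]]].
- exists (Xg A g).2, (Yg A g); split => //; exists g; left.
  by rewrite -e -surjective_pairing.
- exists (Yg A g).2, (Xg A g); split => //; exists g; right.
  by rewrite -e -surjective_pairing.
- by exists g; left; rewrite -e.
- by exists g; right; rewrite -e.
Qed.

Lemma inner_not_glued l p : inner l p -> ~ glued A l p.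
Proof.
move=> ip /gluedP[X [K [gXK Xp]]].
exact: halfedge_not_inner (glu_halfedge gXK) Xp ip.
Qed.

Lemma glu_homeo l X K : glu (l, X) K -> homeo_on X (qimage A (l, X)) (q A l).
Proof.
case: hA => _ [_ _ _ [_ _ _ h]] [g [[e _]|[e _]]]; have [h1 h2 _ _] := h g.
  by move: h1; rewrite -e.
by move: h2; rewrite -e.
Qed.

Lemma glu_inj l X K p r : glu (l, X) K -> X p -> X r -> q A l p = q A l r -> p = r.
Proof.
move=> /glu_homeo[g [[_ _ gK _] _]] Xp Xr e.
by rewrite -(gK _ Xp) -(gK _ Xr) e.
Qed.

Lemma glu_qimage H K : glu H K -> qimage A H = qimage A K.
Proof.
by case: hA => _ [_ _ _ [_ _ h _]] [g [[-> ->]|[-> ->]]]; rewrite h.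
Qed.

(** [t] is the gluing map from [X] to [Y], with arbitrary values off [X]. *)
Lemma glu_map l X m Y : glu (l, X) (m, Y) -> exists t : P2 -> P2,
  cts X t /\ forall p, X p -> Y (t p) /\ q A m (t p) = q A l p.
Proof.
move=> gXY; have qe := glu_qimage gXY.
have [f [_ [cf _]]] := glu_homeo gXY.
have [g [[_ gY _ gK] [_ cg]]] := glu_homeo (glu_sym gXY).
have XY p : X p -> qimage A (m, Y) (q A l p) by move=> Xp; rewrite -qe; exists p.
exists (g \o q A l); split.
  by apply/withinP; exact: within_comp cf XY cg.
by move=> p Xp; split; [exact/gY/XY|exact/gK/XY].
Qed.

Lemma glu_partner l X m Y p : glu (l, X) (m, Y) -> X p ->
  exists2 r, Y r & q A m r = q A l p.
Proof. by move=> /glu_map[t [_ h]] /h[]; exists (t p). Qed.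

Lemma inner_dense l p e : St A l p -> 0 < e ->
  exists2 r, inner l r & near2 e p r.
Proof.
move=> Sp e0; have uv := atlas_bounds l.
pose c : P2 := (p.1, (su A l + sv A l) / 2); pose d := sv A l - su A l.
have d0 : 0 < d by rewrite subr_gt0.
pose s := Num.min 1 (e / (2 * d)).
have s0 : 0 < s by rewrite lt_min ltr01 divr_gt0 // mulr_gt0.
have bp := strip_bounds (atlas_strip l) Sp.
exists (seg p c s).
  apply: seg_interior => //; first by rewrite /=; lra.
  by rewrite s0 ge_min lexx.
split; rewrite /= ?subrr ?mulr0 ?addr0 ?subrr ?normr0 // addrC addKr normrM gtr0_norm //.
have : `|(su A l + sv A l) / 2 - p.2| <= d by rewrite ler_norml /d; lra.
have : s * d <= e / 2.
  have : s <= e / (2 * d) by rewrite ge_min lexx orbT.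
  rewrite -(ler_pM2r d0) => /le_trans; apply.
  by rewrite invfM mulrA divfK ?gt_eqF.
move=> h1 h2; have := ler_wpM2l (ltW s0) h2; lra.
Qed.

(** [D] lists the points of a disk whose image covers the neighborhood [V]. If [b] maps into [V],
    then so do the inner points close to [b]; their images are covered by [D], and by [inj] these
    points themselves belong to [D]. So the disk comes arbitrarily close to [b]. *)
Lemma disk_trap (D : Lam A -> P2 -> Prop) (V : set (Zsp A)) n b e :
  open V -> (forall z, V z -> exists l p, D l p /\ q A l p = z) ->
  (forall l p m c, D l p -> inner m c -> q A l p = q A m c -> (l, p) = (m, c)) ->
  St A n b -> V (q A n b) -> 0 < e ->
  exists c, [/\ inner n c, near2 e b c & D n c].
Proof.
move=> oV VD inj Sb Vb e0; have [d d0 Hd] := q_cts Sb oV Vb.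
have [||c ic bc] := @inner_dense n b (Num.min d e) => //; first by rewrite lt_min d0.
exists c; split => //; first by apply: near2_le bc; rewrite ge_min lexx orbT.
have [|l [p [Dp /(inj _ _ _ _ Dp ic) [<- <-]]]//] := VD (q A n c).
by apply: Hd; [exact: inner_St|apply: near2_le bc; rewrite ge_min lexx].
Qed.

Lemma manifold_Z : two_manifold R (Zsp A).
Proof. by case: hA => _ [_ _ _ []]. Qed.

Lemma q_inj_unglued l p m r : St A l p -> St A m r -> ~ glued A l p ->
  ~ glued A m r -> q A l p = q A m r -> (l, p) = (m, r).
Proof.
by case: hA => _ [_ _ _ [_ h _ _]] Sp Sr gp gr e; have [-> ->] := h _ _ _ _ Sp Sr gp gr e.
Qed.

Lemma inner_saturated l a m b : inner l a -> St A m b -> q A l a = q A m b ->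
  (l, a) = (m, b).
Proof.
move=> ia Sb e; have [gb|ngb] := pselect (glued A m b); last first.
  exact: q_inj_unglued (inner_St ia) Sb (inner_not_glued ia) ngb e.
exfalso; have /andP[ua av] := ia.
(* Half the distance from [a] to the boundary lines: the square of half-side [d] around [a] stays at
   distance at least [d] from them, while [disk_trap] brings one of its points closer than [d] to
   the boundary point [b]. *)
pose d := Num.min (a.2 - su A l) (sv A l - a.2) / 2.
have d0 : 0 < d by rewrite divr_gt0 // lt_min !subr_gt0 ua av.
have du : d * 2 <= a.2 - su A l by rewrite divfK // ge_min lexx.
have dv : d * 2 <= sv A l - a.2 by rewrite divfK // ge_min lexx orbT.
pose T (p : P2) : P2 := (a.1 + d * p.1, a.2 + d * p.2).
have bT (x : R) : `|x| <= 1 -> `|d * x| <= d.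
  by move=> x1; rewrite normrM (gtr0_norm d0) ler_piMr // ltW.
have iT p : sq 1 p -> inner l (T p).
  move=> [_ /bT]; rewrite ler_norml /inner /= => /andP[h1 h2].
  by apply/andP; split; lra.
have cT : cts (sq 1) (q A l \o T).
  apply: (cts_comp (B := St A l)); last exact: q_cts.
    apply/cts_continuous/continuous_pair; apply: continuousDf;
      try (by move=> z; exact: cvg_cst); apply: continuousMf => z;
      (exact: cvg_cst || exact: cvg_fst || exact: cvg_snd).
  by move=> p sp; exact/inner_St/iT.
have [|V [oV V0 VF]] := two_manifold_disk manifold_Z cT.
  move=> p r sp sr /= h.
  have := q_inj_unglued (inner_St (iT _ sp)) (inner_St (iT _ sr))
    (inner_not_glued (iT _ sp)) (inner_not_glued (iT _ sr)) h.
  move=> [/addrI /(mulfI (lt0r_neq0 d0)) h1 /addrI /(mulfI (lt0r_neq0 d0)) h2].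
  by case: p r h1 h2 {sp sr h} => ? ? [? ?] /= -> ->.
pose D n p := n = l /\ exists2 r, sq 1 r & p = T r.
have [|||||c [_ [_ bc] [ml [r [_ sr] ct]]]] := @disk_trap D V m b d oV => //.
- by move=> z /VF[r sr <-]; exists l, (T r); split => //; split => //; exists r.
- move=> l' p' m' c' [-> [r sr ->]] ic' h.
  exact: q_inj_unglued (inner_St (iT _ sr)) (inner_St ic') (inner_not_glued (iT _ sr))
    (inner_not_glued ic') h.
- by rewrite -e; move: V0; rewrite /= /T !mulr0 !addr0 -surjective_pairing.
move: gb => /gluedP[X [K [/glu_halfedge bX Xb]]].
have /bdryP[_ lb] := boundary_interval_sub bX Xb.
move: bc (bT _ sr); rewrite ct /= !ltr_norml !ler_norml => /andP[h1 h2] /andP[h3 h4].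
clear e ct; subst m; case: lb => /= lb; rewrite lb in h1 h2; lra.
Qed.

End AtlasFibers.

(** * Fibers over glued boundary intervals *)

Section AtlasGluing.
Variables (R : realType) (A : atlas_data R).
Notation P2 := (R * R)%type.
Hypothesis hA : is_striped_atlas A.
Implicit Types (l m n : Lam A) (p r : P2) (X Y : set P2).

Let mid l : R := (su A l + sv A l) / 2.

(** Half-disks rise by at most a quarter of the height of the strip, so those based on opposite
    sides of one strip stay apart; [half_level] reads the side off the height. *)
Lemma half_height l c b : c = su A l \/ c = sv A l -> 0 <= b <= 1 ->
  `|b * ((mid l - c) / 2)| * 4 <= sv A l - su A l.
Proof.
move=> hc /andP[b0 b1]; have uv := atlas_bounds hA l.
have : `|mid l - c| * 2 = sv A l - su A l.
  rewrite /mid; case: hc => ->.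
    by rewrite ger0_norm; lra.
  by rewrite ler0_norm; lra.
have h : b * `|mid l - c| <= `|mid l - c| by rewrite ler_piMl.
rewrite mulrA !normrM (ger0_norm b0) (@gtr0_norm _ 2^-1) ?invr_gt0 //; lra.
Qed.

Lemma half_inner l c b x : c = su A l \/ c = sv A l -> 0 < b <= 1 ->
  inner l (x, c + b * ((mid l - c) / 2)).
Proof.
move=> hc /andP[b0 b1]; have uv := atlas_bounds hA l.
rewrite /inner /mid /=; case: hc => ->.
  have e : b * (((su A l + sv A l) / 2 - su A l) / 2) = b * (sv A l - su A l) / 4 by field.
  have h : b * (sv A l - su A l) <= (sv A l - su A l) by rewrite ler_piMl // subr_ge0 ltW.
  have h' : 0 < b * (sv A l - su A l) by rewrite mulr_gt0 // subr_gt0.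
  by rewrite e; lra.
have e : b * (((su A l + sv A l) / 2 - sv A l) / 2) = - (b * (sv A l - su A l) / 4) by field.
have h : b * (sv A l - su A l) <= (sv A l - su A l) by rewrite ler_piMl // subr_ge0 ltW.
have h' : 0 < b * (sv A l - su A l) by rewrite mulr_gt0 // subr_gt0.
by rewrite e; lra.
Qed.

Lemma half_level l c c' b : c = su A l \/ c = sv A l -> c' = su A l \/ c' = sv A l ->
  0 <= b <= 1 ->
  `|c + b * ((mid l - c) / 2) - c'| < (sv A l - su A l) / 2 -> c = c'.
Proof.
move=> hc hc' b01; have := half_height hc b01; have uv := atlas_bounds hA l.
move: (b * _) => t; rewrite ltr_norml => h1 /andP[h2 h3].
have /andP[h4 h5] : - `|t| <= t <= `|t| by rewrite -ler_norml.
by case: hc => ec; case: hc' => ec'; rewrite ec ec' // in h2 h3 *; lra.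
Qed.

Lemma cts_paste (Z : topologicalType) (F1 F2 : P2 -> Z) (D : set P2) :
  cts (D `&` [set p | 0 <= p.2]) F1 -> cts (D `&` [set p | p.2 <= 0]) F2 ->
  (forall p, D p -> p.2 = 0 -> F1 p = F2 p) ->
  cts D (fun p => if 0 <= p.2 then F1 p else F2 p).
Proof.
move=> c1 c2 agree p Dp V oV.
case: (ltgtP 0 p.2) => [p0|p0|p0] Vp.
- have [e e0 He] := c1 p (conj Dp (ltW p0)) V oV Vp.
  exists (Num.min e p.2); first by rewrite lt_min e0.
  move=> r Dr pr; have r0 : 0 <= r.2.
    have hm : Num.min e p.2 <= p.2 by rewrite ge_min lexx orbT.
    have [_] := near2_le hm pr.
    by rewrite ltr_norml => /andP[]; lra.
  by rewrite r0; apply: He => //; apply: near2_le pr; rewrite ge_min lexx.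
- have [e e0 He] := c2 p (conj Dp (ltW p0)) V oV Vp.
  exists (Num.min e (- p.2)); first by rewrite lt_min e0 oppr_gt0.
  move=> r Dr pr; have r0 : r.2 < 0.
    have hm : Num.min e (- p.2) <= - p.2 by rewrite ge_min lexx orbT.
    have [_] := near2_le hm pr.
    by rewrite ltr_norml => /andP[]; lra.
  rewrite leNgt r0 /=; apply: He; first by split => //; exact: ltW.
  by apply: near2_le pr; rewrite ge_min lexx.
- have p0' : 0 <= p.2 by rewrite p0.
  have p0'' : p.2 <= 0 by rewrite p0.
  have [e e0 He] := c1 p (conj Dp p0') V oV Vp.
  have [|e' e0' He'] := c2 p (conj Dp p0'') V oV; first by rewrite -agree.
  exists (Num.min e e'); first by rewrite lt_min e0.
  move=> r Dr pr; case: leP => r0.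
    by apply: He => //; apply: near2_le pr; rewrite ge_min lexx.
  apply: He'; first by split => //; exact: ltW.
  by apply: near2_le pr; rewrite ge_min lexx orbT.
Qed.

Lemma glu_level l X K : glu (l, X) K ->
  exists2 c, c = su A l \/ c = sv A l & forall p, X p -> p.2 = c.
Proof.
move=> /(glu_halfedge hA) bX.
exact (@boundary_interval_level R (St A l) (su A l) (sv A l) (atlas_strip hA l) X bX).
Qed.

(* A point of a glued pair of boundary intervals has a disk neighbourhood made
   of a half-disk on each side; its image is open by invariance of domain, so
   no further sheet of the atlas can reach that point. *)
Lemma glu_saturated l X m Y x y n b : glu (l, X) (m, Y) -> X x -> Y y ->
  q A l x = q A m y -> St A n b -> q A n b = q A l x ->
  (n, b) = (l, x) \/ (n, b) = (m, y).
Proof.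
move=> gXY Xx Yy exy Sb eb.
have bX := glu_halfedge hA gXY; have bY := glu_halfedge hA (glu_sym gXY).
have hSl := atlas_strip hA l; have hSm := atlas_strip hA m.
have [bb|ib] := bdry_or_interior (atlas_strip hA n) Sb; last first.
  by left; apply: (inner_saturated hA) ib _ eb; exact: halfedge_sub bX _ Xx.
have [c hc lX] := glu_level gXY; have [d hd lY] := glu_level (glu_sym gXY).
have [t [ct tXY]] := glu_map hA gXY.
have tY p : X p -> Y (t p) by move=> /tXY[].
have qt p : X p -> q A m (t p) = q A l p by move=> /tXY[].
have tx : t x = y.
  by apply: (glu_inj hA (glu_sym gXY)) => //; [exact: tY|rewrite qt].
have [eX eX0 HX] := boundary_interval_open hSl bX Xx.
have [eY eY0 HY] := boundary_interval_open hSm bY Yy.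
have [dt dt0 Ht] := (cts_near2 X t).1 ct x Xx (eY / 2) (divr_gt0 eY0 (ltr0Sn _ 1)).
pose e := Num.min eX dt / 2.
have e0 : 0 < e by rewrite divr_gt0 // lt_min eX0.
have eX2 : e * 2 <= eX by rewrite divfK // ge_min lexx.
have edt : e < dt.
  have : e * 2 <= dt by rewrite divfK // ge_min lexx orbT.
  lra.
pose xp (a : R) : P2 := (x.1 + e * a, c).
have bxp (a : R) : `|a| <= 1 -> `|e * a| <= e.
  by move=> a1; rewrite normrM (gtr0_norm e0) ler_piMr // ltW.
have Xxp (a : R) : `|a| <= 1 -> X (xp a).
  move=> /bxp a1; rewrite /xp -(lX _ Xx); apply: HX; rewrite addrC addKr.
  by apply: le_lt_trans a1 _; lra.
have yxp (a : R) : `|a| <= 1 -> `|(t (xp a)).1 - y.1| < eY / 2.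
  move=> a1; rewrite -tx; apply: (Ht _ (Xxp _ a1) _).1; rewrite /xp; split => /=.
    by rewrite addrC addKr; apply: le_lt_trans (bxp _ a1) _.
  by rewrite (lX _ Xx) subrr normr0.
(* The upper half of the square goes affinely into strip [l], the lower half into strip [m]; the
   horizontal coordinate of [T2] follows the gluing map [t], so both halves agree under [q] on the
   diameter. *)
pose T1 (p : P2) : P2 := (x.1 + e * p.1, c + p.2 * ((mid l - c) / 2)).
pose T2 (p : P2) : P2 := ((t (xp p.1)).1, d + - p.2 * ((mid m - d) / 2)).
have T10 (p : P2) : p.2 = 0 -> T1 p = xp p.1 by move=> p0; rewrite /T1 p0 mul0r addr0.
have T20 (p : P2) : sq 1 p -> p.2 = 0 -> T2 p = t (xp p.1).
  move=> [/Xxp/tY Yt _] p0; rewrite /T2 p0 oppr0 mul0r addr0 -(lY _ Yt).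
  by rewrite -surjective_pairing.
have iT1 (p : P2) : sq 1 p -> 0 < p.2 -> inner l (T1 p).
  by move=> [_ p1] p0; apply: half_inner => //; rewrite p0 (le_trans (ler_norm _) p1).
have iT2 (p : P2) : sq 1 p -> p.2 < 0 -> inner m (T2 p).
  move=> [_ p1] p0; apply: half_inner => //; rewrite oppr_gt0 p0 /=.
  by apply: le_trans p1; rewrite -normrN ler_norm.
have ST1 (p : P2) : sq 1 p -> 0 <= p.2 -> St A l (T1 p).
  move=> sp; rewrite le_eqVlt => /orP[/eqP/esym p0|p0]; last exact/inner_St/iT1.
  by rewrite T10 //; apply: (halfedge_sub bX); apply: Xxp; case: sp.
have ST2 (p : P2) : sq 1 p -> p.2 <= 0 -> St A m (T2 p).
  move=> sp; rewrite le_eqVlt => /orP[/eqP p0|p0]; last exact/inner_St/iT2.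
  by rewrite T20 //; apply/(halfedge_sub bY)/tY/Xxp; case: sp.
pose dp (p : P2) := if 0 <= p.2 then (l, T1 p) else (m, T2 p).
pose F (p : P2) := if 0 <= p.2 then q A l (T1 p) else q A m (T2 p).
have Fdp p : F p = q A (dp p).1 (dp p).2 by rewrite /F /dp; case: ifP.
have cst (a : R) : continuous (fun p : P2 => a) by move=> p; exact: cvg_cst.
have cfst : continuous (fun p : P2 => p.1) by move=> p; exact: cvg_fst.
have csnd : continuous (fun p : P2 => p.2) by move=> p; exact: cvg_snd.
have cxp : continuous (fun p : P2 => xp p.1).
  by apply: continuous_pair => //; apply: continuousDf => //; exact: continuousMf.
have cF : cts (sq 1) F.
  apply: (cts_paste (F1 := q A l \o T1) (F2 := q A m \o T2)).
  - apply: (cts_comp (B := St A l)); last exact: q_cts.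
      apply/cts_continuous/continuous_pair; apply: continuousDf => //; exact: continuousMf.
    by move=> p [sp p0]; exact: ST1.
  - apply: (cts_comp (B := St A m)); last exact: q_cts.
      apply/cts_pair; split.
        apply: (cts_subset (B := sq 1)); first by move=> p [].
        have /cts_pair[c1 _] : cts (sq 1) (t \o (fun p : P2 => xp p.1)).
          by apply: (cts_comp (B := X)) => // [|p [/Xxp]//]; exact: cts_continuous.
        exact: c1.
      apply/cts_continuous; apply: continuousDf => //; apply: continuousMf => //.
      by move=> p; apply: cvgN; exact: csnd.
    by move=> p [sp p0]; exact: ST2.
  - move=> p sp p0; rewrite /= T10 // T20 // qt //; apply: Xxp; by case: sp.
have idp p : sq 1 p -> p.2 != 0 -> inner (dp p).1 (dp p).2.
  by move=> sp p0; rewrite /dp; case: ltgtP p0 => // h _; [exact: iT1|exact: iT2].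
have Sdp p : sq 1 p -> St A (dp p).1 (dp p).2.
  by move=> sp; rewrite /dp; case: leP => h; [exact: ST1|exact/ST2/ltW].
(* A strip may be glued to itself. For [l = m] a common point forces [c = d]; then [X] and [Y] share
   a point and coincide, against [glu_neq]. *)
have T12 p r : sq 1 p -> sq 1 r -> 0 <= p.2 -> r.2 < 0 -> (l, T1 p) <> (m, T2 r).
  move=> [p1 p2] [r1 r2] p0 r0 [lm e1 e2]; subst m.
  have cd : c = d.
    apply: (half_level (l := l) (b := p.2)) => //.
      by rewrite p0 (le_trans (ler_norm _) p2).
    have h1 : 0 <= - r.2 <= 1.
      by rewrite oppr_ge0 (ltW r0) /= (le_trans _ r2) // -normrN ler_norm.
    have := half_height hd h1; have := atlas_bounds hA l.
    rewrite e2 (addrC d) addrK; lra.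
  apply: (glu_neq hA gXY); congr (_, _).
  apply: (boundary_interval_eq bX bY) (Xxp _ p1) _.
  rewrite /xp e1; have Yt := tY _ (Xxp _ r1).
  by rewrite cd -(lY _ Yt) -surjective_pairing.
have dp_inj p r : sq 1 p -> sq 1 r -> dp p = dp r -> p = r.
  move=> sp sr; rewrite /dp; case: leP => p0; case: leP => r0.
  - have e0' := lt0r_neq0 e0.
    have uv := atlas_bounds hA l.
    have h0 : (mid l - c) / 2 != 0.
      by rewrite mulf_neq0 // subr_eq0 /mid; case: hc => ->; apply/eqP; lra.
    move=> [/addrI/(mulfI e0') h1 /addrI/(mulIf h0) h2].
    by case: p r h1 h2 {sp sr p0 r0} => ? ? [? ?] /= -> ->.
  - by move=> /T12 h; case: h.
  - by move=> /esym /T12 h; case: h.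
  - have uv := atlas_bounds hA m.
    have h0 : (mid m - d) / 2 != 0.
      by rewrite mulf_neq0 // subr_eq0 /mid; case: hd => ->; apply/eqP; lra.
    case: (sp) (sr) => [/Xxp Xp _] [/Xxp Xr _].
    move=> [h1 /addrI/(mulIf h0)/oppr_inj h2].
    have ht : t (xp p.1) = t (xp r.1).
      rewrite [LHS]surjective_pairing [RHS]surjective_pairing h1.
      by rewrite (lY _ (tY _ Xp)) (lY _ (tY _ Xr)).
    have [/addrI/(mulfI (lt0r_neq0 e0)) h3] : xp p.1 = xp r.1.
      by apply: (glu_inj hA gXY) => //; rewrite -!qt // ht.
    by case: p r h2 h3 {sp sr p0 r0 Xp Xr h1 ht} => ? ? [? ?] /= -> ->.
have F_inj0 p r : sq 1 p -> sq 1 r -> p.2 != 0 -> F p = F r -> p = r.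
  move=> sp sr p0; rewrite !Fdp => h; apply: dp_inj => //.
  have := inner_saturated hA (idp _ sp p0) (Sdp _ sr) h.
  by rewrite -!surjective_pairing.
have F_inj p r : sq 1 p -> sq 1 r -> F p = F r -> p = r.
  move=> sp sr h; have [p0|p0] := eqVneq p.2 0; last exact: F_inj0.
  have [r0|r0] := eqVneq r.2 0; last by apply/esym/F_inj0.
  apply: dp_inj => //; move: h; rewrite /F /dp p0 r0 lexx !T10 // => h; congr (_, _).
  by apply: (glu_inj hA gXY) h; apply: Xxp; [case: sp|case: sr].
have [V [oV V0 VF]] := two_manifold_disk (manifold_Z hA) cF F_inj.
pose D n p := exists2 r, sq 1 r & dp r = (n, p).
have /bdryP[_ lb] := bb.
have uvn := atlas_bounds hA n.
(* The bounds [e] and [eY / 2] keep [b] horizontally inside the known parts of [X] and [Y] around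
   [x] and [y]; the quarter height determines the side on which [b] lies. *)
pose w := Num.min (Num.min e (eY / 2)) ((sv A n - su A n) / 4).
have w0 : 0 < w by rewrite !lt_min e0 !divr_gt0 //; lra.
have [|||||p [ip [bp1 bp2] [r sr dr]]] := @disk_trap _ _ hA D V n b w oV => //.
- by move=> z /VF[r sr <-]; exists (dp r).1, (dp r).2; split => //; exists r; rewrite // -surjective_pairing.
- move=> l' p' m' c' [r sr er] ic' h; apply/esym.
  apply: (inner_saturated hA) ic' _ (esym h).
  by have := Sdp _ sr; rewrite er.
- rewrite eb; suff -> : q A l x = F (0, 0) by [].
  rewrite /F lexx T10 //= /xp mulr0 addr0 -(lX _ Xx).
  by rewrite -surjective_pairing.
have we : w <= e by rewrite !ge_min lexx.
have wY : w <= eY / 2 by rewrite !ge_min lexx !orbT.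
have wn : w <= (sv A n - su A n) / 4 by rewrite ge_min lexx orbT.
have [sr1 sr2] := sr.
move: dr; rewrite /dp; case: leP => r0 [nE pE]; subst n.
- left; congr (_, _); apply: (glu_inj hA gXY) => //.
  have cb : c = b.2.
    apply: (half_level (l := l) (b := r.2)) => //.
      by rewrite r0 (le_trans (ler_norm _) sr2).
    by move: bp2; rewrite -pE /= => bp2; lra.
  have : X (b.1, x.2).
    apply: HX; move: bp1 (bxp _ sr1); rewrite -pE /= !ltr_norml ler_norml; lra.
  by rewrite (lX _ Xx) cb -surjective_pairing.
- right; congr (_, _); apply: (glu_inj hA (glu_sym gXY)) => //; last by rewrite eb.
  have db : d = b.2.
    apply: (half_level (l := m) (b := - r.2)) => //.
      by rewrite oppr_ge0 (ltW r0) /= (le_trans _ sr2) // -normrN ler_norm.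
    by move: bp2; rewrite -pE /= => bp2; lra.
  have : Y (b.1, y.2).
    apply: HY; move: bp1 (yxp _ sr1); rewrite -pE /= !ltr_norml; lra.
  by rewrite (lY _ Yy) db -surjective_pairing.
Qed.

(** If one point is glued, [glu_saturated] leaves only the point itself and its partner; if neither
    is glued, the injectivity axiom of the atlas applies. *)
Theorem q_fibers l p m r : St A l p -> St A m r -> q A l p = q A m r ->
  (l, p) = (m, r) \/ exists X Y, [/\ glu (l, X) (m, Y), X p & Y r].
Proof.
move=> Sp Sr e.
have main l1 p1 m1 r1 : St A m1 r1 -> q A l1 p1 = q A m1 r1 -> glued A l1 p1 ->
    (l1, p1) = (m1, r1) \/ exists X Y, [/\ glu (l1, X) (m1, Y), X p1 & Y r1].
  move=> S1 e1 /gluedP[X [[k Y] [g Xp]]].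
  have [y Yy ey] := glu_partner hA g Xp.
  have [<-|[-> ->]] := glu_saturated g Xp Yy (esym ey) S1 (esym e1); first by left.
  by right; exists X, Y.
have [gp|ngp] := pselect (glued A l p); first exact: main.
have [gr|ngr] := pselect (glued A m r); last by left; exact: q_inj_unglued.
have [<-|[X [Y [g Xr Yp]]]] := main _ _ _ _ Sp (esym e) gr; first by left.
by right; exists Y, X; split => //; exact: glu_sym.
Qed.

End AtlasGluing.

(** * Sign calculus for monotone maps *)

Section Signs.
Variable R : realType.
Implicit Types (d x y : R) (s t : int).

Lemma signP s : sign s -> s%:~R = 1 :> R \/ s%:~R = -1 :> R.
Proof. by move=> [->|->]; [left|right]. Qed.

(** Monotonicity is recorded as an equation between values of [Num.sg], so that composing and
    inverting monotone maps becomes multiplication of signs. *)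
Lemma sg_strict d x1 x2 y1 y2 : d = 1 \/ d = -1 ->
  (x1 < x2 -> 0 < d * (y2 - y1)) -> (x2 < x1 -> 0 < d * (y1 - y2)) ->
  (x1 = x2 -> y1 = y2) -> Num.sg (y2 - y1) = d * Num.sg (x2 - x1).
Proof.
move=> hd h1 h2 h3; case: (ltgtP x1 x2) => h.
- have := h1 h; rewrite [Num.sg (x2 - x1)]gtr0_sg ?subr_gt0 // mulr1.
  case: hd => ->; rewrite ?mul1r ?mulN1r ?oppr_gt0 => ?.
    exact: gtr0_sg.
  exact: ltr0_sg.
- have := h2 h; rewrite [Num.sg (x2 - x1)]ltr0_sg ?subr_lt0 // mulrN1 -opprB.
  case: hd => ->; rewrite ?mul1r ?mulN1r ?opprK ?oppr_gt0 => ?.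
    exact: ltr0_sg.
  exact: gtr0_sg.
- by rewrite (h3 h) h !subrr sgr0 mulr0.
Qed.

Lemma sg_pos d x1 x2 y1 y2 : d = 1 \/ d = -1 ->
  Num.sg (y2 - y1) = d * Num.sg (x2 - x1) -> x1 < x2 -> 0 < d * (y2 - y1).
Proof.
move=> hd e x12; rewrite -sgr_gt0 sgrM e [Num.sg (x2 - x1)]gtr0_sg ?subr_gt0 //.
by case: hd => ->; rewrite ?sgrN sgr1 ?mulN1r ?opprK ?mulr1 ?opprK ltr01.
Qed.

End Signs.

(** * Orientation of the gluing maps *)

Section Orientation.
Variables (R : realType) (A : atlas_data R).
Notation P2 := (R * R)%type.
Hypothesis hA : is_striped_atlas A.
Implicit Types (l m n : Lam A) (p r : P2) (X Y : set P2).

(** Stated through pairs of points identified by [q], so that exchanging the two half-edges needs no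
    inverse map. *)
Definition gsgn (H K : Lam A * set P2) (s : R) := forall x1 x2 y1 y2 : P2,
  H.2 x1 -> H.2 x2 -> K.2 y1 -> K.2 y2 -> q A H.1 x1 = q A K.1 y1 ->
  q A H.1 x2 = q A K.1 y2 -> Num.sg (y2.1 - y1.1) = s * Num.sg (x2.1 - x1.1).

Lemma gsgn_sym H K s : s = 1 \/ s = -1 -> gsgn H K s -> gsgn K H s.
Proof.
move=> hs h x1 x2 y1 y2 Kx1 Kx2 Hy1 Hy2 e1 e2.
rewrite (h y1 y2 x1 x2) // mulrA.
by case: hs => ->; rewrite ?mulr1 ?mulrNN ?mulr1 mul1r.
Qed.

Lemma level_inj l X p r : halfedge A (l, X) -> X p -> X r -> p.1 = r.1 -> p = r.
Proof.
move=> bX Xp Xr e.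
have [c _ lX] := boundary_interval_level (atlas_strip hA l) (halfedge_boundary bX).
by rewrite [p]surjective_pairing [r]surjective_pairing e !lX.
Qed.

Lemma halfedge_two l X : halfedge A (l, X) -> exists p r, [/\ X p, X r & p.1 < r.1].
Proof.
move=> bX; have [p Xp] := boundary_interval_neq0 (halfedge_boundary bX).
have [e e0 He] := boundary_interval_open (atlas_strip hA l) (halfedge_boundary bX) Xp.
exists p, (p.1 + e / 2, p.2); split => //=; last by rewrite ltrDl divr_gt0.
by apply: He; rewrite addrC addKr ger0_norm; lra.
Qed.

Lemma halfedge_seg l X p c t : halfedge A (l, X) -> X p -> X c -> 0 <= t <= 1 ->
  X (seg p c t).
Proof.
move=> bX Xp Xc /andP[t0 t1].
have hl := atlas_strip hA l; have hX := halfedge_boundary bX.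
have [d _ lX] := boundary_interval_level hl hX.
have -> : seg p c t = (p.1 + t * (c.1 - p.1), p.2).
  by rewrite /seg !lX // subrr mulr0 addr0.
case: (leP p.1 c.1) => h.
  apply: (boundary_interval_convex hl hX Xp Xc).
  have h1 : 0 <= c.1 - p.1 by lra.
  have := mulr_ge0 t0 h1; have := ler_piMl h1 t1; lra.
have -> : p.2 = c.2 by rewrite !lX.
apply: (boundary_interval_convex hl hX Xc Xp).
have h1 : 0 <= p.1 - c.1 by lra.
have e : c.1 - p.1 = - (p.1 - c.1) by ring.
have := mulr_ge0 t0 h1; have := ler_piMl h1 t1; rewrite e mulrN; lra.
Qed.

(** The gluing map is injective on a convex set, so two ordered pairs can be deformed into each
    other through ordered pairs whose images never meet. *)
Lemma glu_gsgn l X m Y : glu (l, X) (m, Y) ->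
  exists s, (s = 1 \/ s = -1) /\ gsgn (l, X) (m, Y) s.
Proof.
move=> g; have bX := glu_halfedge hA g; have bY := glu_halfedge hA (glu_sym g).
have [t [ct tXY]] := glu_map hA g.
have [p [r [Xp Xr pr]]] := halfedge_two bX.
have tinj a b : X a -> X b -> (t a).1 = (t b).1 -> a = b.
  move=> Xa Xb e; have [Ya qa] := tXY _ Xa; have [Yb qb] := tXY _ Xb.
  by apply: (glu_inj hA g) => //; rewrite -qa -qb (level_inj bY Ya Yb e).
have [ct1 _] := (cts_pair X t).1 ct.
have neq a b c d : X a -> X b -> X c -> X d -> a.1 < b.1 -> c.1 < d.1 ->
    forall u, 0 <= u <= 1 -> (t (seg a c u)).1 <> (t (seg b d u)).1.
  move=> Xa Xb Xc Xd ab cd u u1 /tinj e.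
  have := e (halfedge_seg bX Xa Xc u1) (halfedge_seg bX Xb Xd u1).
  move=> [e1 _]; have : 0 < (1 - u) * (b.1 - a.1) + u * (d.1 - c.1).
    move: u1 => /andP[u0 u1].
    have h1 : 0 <= (1 - u) * (b.1 - a.1) by rewrite mulr_ge0 ?subr_ge0 // ltW.
    have h2 : 0 <= u * (d.1 - c.1) by rewrite mulr_ge0 ?subr_ge0 // ltW.
    rewrite lt_neqAle addr_ge0 // andbT eq_sym paddr_eq0 // !mulf_eq0 !subr_eq0.
    rewrite [b.1 == _]gt_eqF // [d.1 == _]gt_eqF // !orbF.
    by apply/negP => /andP[/eqP <-]; rewrite oner_eq0.
  have -> : (1 - u) * (b.1 - a.1) + u * (d.1 - c.1) =
    (b.1 + u * (d.1 - b.1)) - (a.1 + u * (c.1 - a.1)) by ring.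
  by rewrite e1 subrr ltxx.
have cmp a b c d : X a -> X b -> X c -> X d -> a.1 < b.1 -> c.1 < d.1 ->
    (t a).1 < (t b).1 -> (t c).1 < (t d).1.
  move=> Xa Xb Xc Xd ab cd.
  apply: (seg_sign (p1 := a) (p2 := b) ct1 ct1) => u; try exact: (halfedge_seg bX).
  exact: (neq _ _ _ _ Xa Xb Xc Xd ab cd).
have cmp' a b c d : X a -> X b -> X c -> X d -> a.1 < b.1 -> c.1 < d.1 ->
    (t b).1 < (t a).1 -> (t d).1 < (t c).1.
  move=> Xa Xb Xc Xd ab cd.
  apply: (seg_sign (p1 := b) (p2 := a) ct1 ct1) => u; try exact: (halfedge_seg bX).
  by move=> u1 /esym; exact: (neq _ _ _ _ Xa Xb Xc Xd ab cd).
have matched x y : X x -> Y y -> q A l x = q A m y -> y = t x.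
  move=> Xx Yy e; have [Yt qt] := tXY _ Xx.
  by apply: (glu_inj hA (glu_sym g)) => //; rewrite qt.
have [s hs Hs] : exists2 s : R, s = 1 \/ s = -1 &
    forall a b, X a -> X b -> a.1 < b.1 -> 0 < s * ((t b).1 - (t a).1).
  case: (ltgtP (t p).1 (t r).1) => [h|h|/tinj e].
  - exists 1; first by left.
    by move=> a b Xa Xb ab; rewrite mul1r subr_gt0; exact: cmp h.
  - exists (-1); first by right.
    by move=> a b Xa Xb ab; rewrite mulN1r opprB subr_gt0; exact: cmp' h.
  - by move: pr; rewrite e // ltxx.
exists s; split => // x1 x2 y1 y2 /= Xx1 Xx2 Yy1 Yy2 e1 e2.
rewrite (matched _ _ Xx1 Yy1 e1) (matched _ _ Xx2 Yy2 e2).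
apply: sg_strict => //; [exact: Hs|exact: Hs|].
by move=> /(level_inj bX Xx1 Xx2) ->.
Qed.

Lemma gsgn_uniq l X m Y s s' : glu (l, X) (m, Y) -> gsgn (l, X) (m, Y) s ->
  gsgn (l, X) (m, Y) s' -> s = s'.
Proof.
move=> g h h'; have [p [r [Xp Xr pr]]] := halfedge_two (glu_halfedge hA g).
have [a Ya ea] := glu_partner hA g Xp; have [b Yb eb] := glu_partner hA g Xr.
have := h p r a b Xp Xr Ya Yb (esym ea) (esym eb).
rewrite (h' p r a b Xp Xr Ya Yb (esym ea) (esym eb)).
by rewrite gtr0_sg ?subr_gt0 // !mulr1.
Qed.

(** [orient] is -1 whenever the test for increase fails; by [glu_gsgn] such a failure means
    decrease. *)
Lemma orient_gsgn (g : Gam A) : sign (orient A g) /\ gsgn (Yg A g) (Xg A g) (orient A g)%:~R.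
Proof.
case eX : (Xg A g) => [l X]; case eY : (Yg A g) => [m Y].
have gg : glu (m, Y) (l, X) by exists g; right; rewrite eX eY.
have [s [hs Hs]] := glu_gsgn gg.
rewrite /orient eX eY /=; case: asboolP => H; (split; first by [left|right]).
  case: hs => es; first by rewrite es in Hs.
  have [p [r [Yp Yr pr]]] := halfedge_two (glu_halfedge hA gg).
  have [a Xa ea] := glu_partner hA gg Yp; have [b Xb eb] := glu_partner hA gg Yr.
  have := H p r a b Yp Yr Xa Xb ea eb pr.
  have /= := Hs p r a b Yp Yr Xa Xb (esym ea) (esym eb).
  rewrite es [Num.sg (r.1 - _)]gtr0_sg ?subr_gt0 // mulr1 => /eqP.
  by rewrite sgr_cp0 subr_lt0 => h /(lt_trans h); rewrite ltxx.
case: hs => es; last by rewrite es in Hs.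
exfalso; apply: H => y1 y2 x1 x2 Yy1 Yy2 Xx1 Xx2 e1 e2 y12.
have /= := Hs y1 y2 x1 x2 Yy1 Yy2 Xx1 Xx2 (esym e1) (esym e2).
by rewrite es [Num.sg (y2.1 - _)]gtr0_sg ?subr_gt0 // mul1r => /eqP; rewrite sgr_cp0 subr_gt0.
Qed.

Lemma sigma_gsgn H K s : sigma_rel A H K s -> [/\ sign s, glu H K & gsgn H K s%:~R].
Proof.
move=> [g [h ->]]; have [so go] := orient_gsgn g.
split => //; first by exists g.
by case: h => -[-> ->] //; apply: gsgn_sym => //; exact: signP.
Qed.

Lemma glu_sigma H K : glu H K -> exists s, sigma_rel A H K s.
Proof. by move=> [g h]; exists (orient A g), g. Qed.

Lemma xi_relP H K : xi_rel A H K <->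
  glu H K \/ [/\ halfedge A H, (forall K', ~ glu H K') & K = H].
Proof.
split=> [[[g h]|[[g h]|[bH nH ->]]]|[[g [h|h]]|[bH nH ->]]].
- by left; exists g; left.
- by left; exists g; right.
- by right; split => // K' [g [[e _]|[e _]]]; case: (nH g).
- by left; exists g.
- by right; left; exists g.
- right; right; split => // g; split=> e.
    by apply: (nH (Yg A g)); exists g; left.
  by apply: (nH (Xg A g)); exists g; right.
Qed.

Lemma xi_rel_ex H : halfedge A H -> exists K, xi_rel A H K.
Proof.
move=> bH; have [[K g]|nH] := pselect (exists K, glu H K).
  by exists K; apply/xi_relP; left.
exists H; apply/xi_relP; right; split => // K g; apply: nH; by exists K.
Qed.

End Orientation.

(** * Equivalences induce graph isomorphisms *)

Section Leaves.
Variables (R : realType) (A : atlas_data R).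
Notation P2 := (R * R)%type.
Hypothesis hA : is_striped_atlas A.

Lemma strip_leaf_sub l M : strip_leaf (St A l) (su A l) (sv A l) M -> M `<=` St A l.
Proof.
case=> [[t [ht ->]] p /= pt|bM]; first by apply/(inner_St hA); rewrite /inner pt.
exact: (@halfedge_sub _ A l M bM).
Qed.

Lemma strip_leaf_neq0 l M : strip_leaf (St A l) (su A l) (sv A l) M -> M !=set0.
Proof.
case=> [[t [ht ->]]|/boundary_interval_neq0 //]; by exists (0, t).
Qed.

Lemma strip_leaf_inner l M p : strip_leaf (St A l) (su A l) (sv A l) M -> M p ->
  inner l p -> M = [set r | r.2 = p.2].
Proof.
case=> [[t [ht ->]] /= -> //|bM Mp ip].
by case: (@halfedge_not_inner _ A l M p bM Mp ip).
Qed.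

Lemma strip_leaf_bdry l M p : strip_leaf (St A l) (su A l) (sv A l) M -> M p ->
  bdry (St A l) (su A l) (sv A l) p -> halfedge A (l, M).
Proof. by case=> [[t [ht ->]] /= pt|//] /bdry_not_interior []; rewrite pt. Qed.

Lemma strip_leaf_eq l M M' p : strip_leaf (St A l) (su A l) (sv A l) M ->
  strip_leaf (St A l) (su A l) (sv A l) M' -> M p -> M' p -> M = M'.
Proof.
move=> hM hM' Mp Mp'.
have [bp|ip] := bdry_or_interior (atlas_strip hA l) (strip_leaf_sub hM Mp).
  exact: boundary_interval_eq (strip_leaf_bdry hM Mp bp) (strip_leaf_bdry hM' Mp' bp) Mp Mp'.
by rewrite (strip_leaf_inner hM Mp ip) (strip_leaf_inner hM' Mp' ip).
Qed.

Lemma sleaf_neq0 L : sleaf A L -> exists2 x, L x & dom A x.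
Proof.
move=> [l [M [hM ->]]]; have [p Mp] := strip_leaf_neq0 hM.
by exists (l, p) => //; exact: strip_leaf_sub hM _ Mp.
Qed.

Lemma sleaf_dom L : sleaf A L -> L `<=` dom A.
Proof.
by move=> [l [M [hM ->]]] [m p] /= [-> Mp]; exact: strip_leaf_sub hM _ Mp.
Qed.

Lemma sleaf_eq L L' x : sleaf A L -> sleaf A L' -> L x -> L' x -> L = L'.
Proof.
move=> [l [M [hM ->]]] [l' [M' [hM' ->]]] [xl Mx] [xl' Mx'].
subst l l'; by rewrite (strip_leaf_eq hM hM' Mx Mx').
Qed.

Lemma strip_leaf_ex l p : St A l p ->
  exists2 M, strip_leaf (St A l) (su A l) (sv A l) M & M p.
Proof.
move=> Sp; have [bp|ip] := bdry_or_interior (atlas_strip hA l) Sp.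
  by have [? ?] := boundary_interval_component bp; exists (connected_component (bdry (St A l) (su A l) (sv A l)) p) => //; right.
by exists [set r | r.2 = p.2] => //; left; exists p.2.
Qed.

End Leaves.

(** * Leaf-preserving homeomorphisms of disjoint unions of strips *)

Section FoliatedMaps.
Variables (R : realType) (A A' : atlas_data R).
Notation P2 := (R * R)%type.
Hypotheses (hA : is_striped_atlas A) (hA' : is_striped_atlas A').
Variables (h : Lam A * P2 -> Lam A' * P2) (g : Lam A' * P2 -> Lam A * P2).

Definition fol_inverse := [/\ [/\ forall x, dom A x -> dom A' (h x),
   forall y, dom A' y -> dom A (g y), forall x, dom A x -> g (h x) = x &
   forall y, dom A' y -> h (g y) = y],
   forall U, sopen A' U -> sopen A (dom A `&` h @^-1` U),
   forall U, sopen A U -> sopen A' (dom A' `&` g @^-1` U) &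
   forall L, sleaf A L -> sleaf A' (h @` L)].

Hypothesis hg : fol_inverse.

(** The leaf through [g y] is carried by [h] to a leaf through [y], and leaves of [A'] through a
    common point coincide. *)
Lemma fol_inverse_leaf L : sleaf A' L -> sleaf A (g @` L).
Proof.
have [[hd gd gK hK] _ _ hL] := hg.
move=> sL; have [y Ly dy] := sleaf_neq0 hA' sL.
have gdy := gd _ dy; case gy : (g y) gdy => [l p] gdy.
have [M hM Mp] := strip_leaf_ex hA gdy.
pose K := [set x : Lam A * P2 | x.1 = l /\ M x.2].
have sK : sleaf A K by exists l, M.
have e : h @` K = L.
  by apply: (sleaf_eq hA' (x := y)) => //; [exact: hL|exists (l, p) => //; rewrite -gy hK].
rewrite -e (_ : g @` _ = K) //; apply/seteqP; split=> [_ [_ [x Kx <-] <-]|x Kx].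
  by rewrite gK //; exact: sleaf_dom sK _ Kx.
by exists (h x); [exists x|rewrite gK //; exact: sleaf_dom sK _ Kx].
Qed.

Definition strip_center (l : Lam A) : P2 := (0, (su A l + sv A l) / 2).
Definition strip_index (l : Lam A) : Lam A' := (h (l, strip_center l)).1.
Definition strip_map (l : Lam A) (p : P2) : P2 := (h (l, p)).2.

Lemma center_inner l : inner l (strip_center l).
Proof. by have := atlas_bounds hA l; rewrite /inner /strip_center /=; lra. Qed.

Lemma center_dom l : dom A (l, strip_center l). Proof. exact/(inner_St hA)/center_inner. Qed.

Lemma sopen_strips (P : Lam A' -> Prop) : sopen A' [set x | dom A' x /\ P x.1].
Proof.
split=> [x [dx _] //|m]; apply/relopenP; split=> [p [Sp _] //|p [Sp Pm]].
by exists 1.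
Qed.

(** Strips are open in the disjoint union, so the indicator [f] of the target index, with values 1
    and -1, is continuous; it has no zero, hence keeps its sign. *)
Lemma strip_index_const l p : St A l p -> (h (l, p)).1 = strip_index l.
Proof.
have [[hd gd gK hK] ho go hL] := hg.
move=> Sp; pose f p : R := if pselect ((h (l, p)).1 = strip_index l) then 1 else -1.
have cf : cts (St A l) f.
  apply/ctsR => r Sr e e0.
  have [_ /(_ l)/relopenP[_ H]] := ho _ (sopen_strips (fun m => m = (h (l, r)).1)).
  have [|d d0 Hd] := H r; first by split => //; split => //; exact: hd.
  exists d => // s Ss rs; have [_ /= [_ hs]] := Hd s Ss rs.
  by rewrite /f hs subrr normr0.
have : 0 < f p.
  apply: (strip_sign (atlas_strip hA l) (A := St A l) _ _ cf _ (center_dom l)) => //.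
  - by move=> r; exact: inner_St.
  - by move=> r _; rewrite /f; case: pselect => ? /=; apply/eqP; rewrite ?oppr_eq0 oner_eq0.
  - by rewrite /f; case: pselect => //; rewrite /strip_index.
by rewrite /f; case: pselect => // ?; rewrite ltr0N1.
Qed.

Lemma strip_mapE l p : St A l p -> h (l, p) = (strip_index l, strip_map l p).
Proof. by move=> Sp; rewrite -(strip_index_const Sp) -surjective_pairing. Qed.

Lemma strip_map_St l p : St A l p -> St A' (strip_index l) (strip_map l p).
Proof.
have [[hd _ _ _] _ _ _] := hg.
by move=> Sp; have := hd (l, p) Sp; rewrite strip_mapE.
Qed.

Lemma strip_map_cts l : cts (St A l) (strip_map l).
Proof.
have [[hd gd gK hK] ho go hL] := hg.
move=> p Sp V oV Vp.
have oU : sopen A' [set x | dom A' x /\ V x.2].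
  split=> [x [dx _] //|m]; apply/relopenP; split=> [r [Sr _] //|r [Sr Vr]].
  have /nbhs_near2[e e0 He] : nbhs r V by exact: open_nbhs_nbhs.
  by exists e => // s Ss rs; split => //; exact: He.
have [_ /(_ l)/relopenP[_ H]] := ho _ oU.
have [|d d0 Hd] := H p; first by split => //; split => //; exact: hd.
by exists d => // s Ss rs; have [_ [_ ?]] := Hd s Ss rs.
Qed.

End FoliatedMaps.

Lemma fol_inverse_sym (R : realType) (A A' : atlas_data R)
  (hA : is_striped_atlas A) (hA' : is_striped_atlas A') h g :
  fol_inverse h g -> @fol_inverse R A' A g h.
Proof.
move=> hg; have [[hd gd gK hK] ho go hL] := hg; split => //.
exact: fol_inverse_leaf hg.
Qed.

Section StripMaps.
Variables (R : realType) (A A' : atlas_data R).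
Notation P2 := (R * R)%type.
Hypotheses (hA : is_striped_atlas A) (hA' : is_striped_atlas A').
Variables (h : Lam A * P2 -> Lam A' * P2) (g : Lam A' * P2 -> Lam A * P2).
Hypothesis hg : fol_inverse h g.

Let nu := strip_index h.
Let hh := strip_map h.

Lemma strip_indexK : cancel nu (strip_index g).
Proof.
have [[hd gd gK hK] _ _ _] := hg; move=> l.
have gh := fol_inverse_sym hA hA' hg.
have Sc := center_dom hA l; have Sc' := strip_map_St hA hg Sc.
rewrite -(strip_index_const hA' gh Sc') /nu /hh -(strip_mapE hA hg) //.
by rewrite gK.
Qed.

Lemma strip_mapK l p : St A l p -> strip_map g (nu l) (hh l p) = p.
Proof.
have [[hd gd gK hK] _ _ _] := hg; move=> Sp.
by rewrite /strip_map /nu /hh -(strip_mapE hA hg) // gK.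
Qed.

Lemma strip_map_inj l p r : St A l p -> St A l r -> hh l p = hh l r -> p = r.
Proof. by move=> Sp Sr e; rewrite -(strip_mapK Sp) -(strip_mapK Sr) e. Qed.

Lemma leaf_image l M : strip_leaf (St A l) (su A l) (sv A l) M ->
  strip_leaf (St A' (nu l)) (su A' (nu l)) (sv A' (nu l)) (hh l @` M).
Proof.
have [[hd gd gK hK] _ _ hL] := hg; move=> hM.
have [|m [N [hN e]]] := hL [set x | x.1 = l /\ M x.2]; first by exists l, M.
have MS := strip_leaf_sub hA hM.
have [p Mp] := strip_leaf_neq0 hM.
have em : m = nu l.
  have : (h @` [set x | x.1 = l /\ M x.2]) (h (l, p)) by exists (l, p).
  by rewrite e (strip_mapE hA hg) //; [case|exact: MS].
suff -> : hh l @` M = N by rewrite -em.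
apply/seteqP; split=> [_ [r Mr <-]|y Ny].
  have : (h @` [set x | x.1 = l /\ M x.2]) (h (l, r)) by exists (l, r).
  by rewrite e (strip_mapE hA hg) //; [case|exact: MS].
have : [set x | x.1 = m /\ N x.2] (m, y) by [].
rewrite -e => -[[l' r] /= [-> Mr] hr]; exists r => //.
by rewrite /hh /strip_map hr.
Qed.

(* An interior line separates its strip, whereas the complement of a boundary
   interval is connected. *)
Lemma inner_map_aux l p : inner l p -> inner (nu l) (hh l p).
Proof.
move=> ip; have Sp := inner_St hA ip.
have Sp' := strip_map_St hA hg Sp.
have [bp|//] := bdry_or_interior (atlas_strip hA' (nu l)) Sp'; exfalso.
have hM : strip_leaf (St A l) (su A l) (sv A l) [set r | r.2 = p.2].
  by left; exists p.2.
pose B := hh l @` [set r | r.2 = p.2].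
have hB : halfedge A' (nu l, B).
  by apply: strip_leaf_bdry (leaf_image hM) _ bp; exists p.
pose T := St A' (nu l) `\` B; pose gg := strip_map g (nu l).
have gh := fol_inverse_sym hA hA' hg.
have ggK r : St A' (nu l) r -> hh l (gg r) = r.
  move=> Sr; have [[hd gd gK hK] _ _ _] := hg.
  rewrite /hh /gg /strip_map (_ : (l, _) = g (nu l, r)) ?hK //.
  by rewrite (strip_mapE hA' gh Sr) strip_indexK.
(* This function vanishes only on [B], hence nowhere on [T], yet it takes both signs at the images
   of [r1] and [r2], which lie on the two sides of the line through [p]. *)
have ct : cts T (fun r => (gg r).2 - p.2).
  apply: (cts_subset (B := St A' (nu l))); first by move=> r [].
  have /cts_pair[_ /ctsR c2] := strip_map_cts gh (l := nu l).
  apply/ctsR => r Sr e e0; have [d d0 Hd] := c2 r Sr e e0.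
  exists d => // s Ss rs; have := Hd s Ss rs.
  by rewrite (_ : _ - p.2 - _ = (gg s).2 - (gg r).2) //; ring.
have /andP[pu pv] := ip.
pose r1 : P2 := (0, (su A l + p.2) / 2); pose r2 : P2 := (0, (p.2 + sv A l) / 2).
have i1 : inner l r1 by rewrite /inner /=; lra.
have i2 : inner l r2 by rewrite /inner /=; lra.
have TP r : inner l r -> r.2 != p.2 -> T (hh l r).
  move=> /(inner_St hA) ir rp; split; first exact: (strip_map_St hA hg).
  move=> [s /= sp] /strip_map_inj e; move/eqP: rp; apply; rewrite -e //.
  by apply/(inner_St hA); rewrite /inner sp.
have := strip_sign (atlas_strip hA' (nu l)) (A := T) _ _ ct _
  (TP _ i2 _) (TP _ i1 _).
rewrite /gg !strip_mapK; [|exact: inner_St..] => /=.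
move=> H; have : 0 < (su A l + p.2) / 2 - p.2.
  apply: H; try (by apply/eqP; lra); try lra; try by move=> r [].
  - move=> r ir; split; first exact: inner_St.
    by move=> Br; exact: (@halfedge_not_inner _ A' (nu l) B r hB Br ir).
  - move=> r [Sr nB] /eqP; rewrite subr_eq0 => /eqP e; apply: nB.
    by exists (gg r) => //; rewrite ggK.
lra.
Qed.

End StripMaps.

Section StripShape.
Variables (R : realType) (A A' : atlas_data R).
Notation P2 := (R * R)%type.
Hypotheses (hA : is_striped_atlas A) (hA' : is_striped_atlas A').
Variables (h : Lam A * P2 -> Lam A' * P2) (g : Lam A' * P2 -> Lam A * P2).
Hypothesis hg : fol_inverse h g.

Let nu := strip_index h.
Let hh := strip_map h.
Let gh := fol_inverse_sym hA hA' hg.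

Lemma inner_map l p : St A l p -> inner (nu l) (hh l p) <-> inner l p.
Proof.
move=> Sp; split=> [ip|]; last exact: (inner_map_aux hA hA' hg).
have := inner_map_aux hA' hA gh ip.
by rewrite (strip_indexK hA hA' hg) (strip_mapK hA hg).
Qed.

(** The leaf through an inner point is its full horizontal line, and both [h] and its inverse carry
    leaves to leaves. *)
Lemma inner_level l p r : inner l p -> inner l r ->
  (hh l p).2 = (hh l r).2 <-> p.2 = r.2.
Proof.
have main B B' (hB : is_striped_atlas B) (hB' : is_striped_atlas B') k k'
    (hk : @fol_inverse R B B' k k') m a b : inner m a -> inner m b -> a.2 = b.2 ->
    (strip_map k m a).2 = (strip_map k m b).2.
  move=> ia ib e; have Sa := inner_St hB ia.
  have hM : strip_leaf (St B m) (su B m) (sv B m) [set r | r.2 = a.2] by left; exists a.2.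
  have hL := leaf_image hB hk hM.
  have ia' := inner_map_aux hB hB' hk ia.
  have La : (strip_map k m @` [set r | r.2 = a.2]) (strip_map k m a) by exists a.
  have := strip_leaf_inner hL La ia' => e'.
  have : (strip_map k m @` [set r | r.2 = a.2]) (strip_map k m b) by exists b.
  by rewrite e' => /= ->.
move=> ip ir; split=> [e|]; last exact: (main _ _ hA hA' h g hg).
have := main _ _ hA' hA g h gh (nu l) _ _ (inner_map_aux hA hA' hg ip)
  (inner_map_aux hA hA' hg ir) e.
by rewrite !(strip_mapK hA hg) //; exact: inner_St.
Qed.

Lemma seg_inner l p c t : St A l p -> inner l c -> 0 < t <= 1 -> inner l (seg p c t).
Proof.
by move=> Sp ic t1; exact: (seg_interior (strip_bounds (atlas_strip hA l) Sp) ic).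
Qed.

(** Being inner depends on the height only, so an inner point and a boundary point never have images
    of equal height. *)
Lemma half_inner_level_neq l p r : St A l p -> St A l r -> inner l p \/ inner l r ->
  p.2 <> r.2 -> (hh l p).2 <> (hh l r).2.
Proof.
move=> Sp Sr; have [ip|nip] := pselect (inner l p).
  have [ir|nir] := pselect (inner l r); first by move=> _ pr /(inner_level ip ir).
  move=> _ _ e; apply: nir; apply/(inner_map Sr); move/(inner_map Sp): ip.
  by rewrite /inner e.
move=> [//|ir] _ e; apply: nip; apply/(inner_map Sp); move/(inner_map Sr): ir.
by rewrite /inner e.
Qed.

Lemma seg_lt2 p r c d t : p.2 < r.2 -> c.2 < d.2 -> 0 <= t <= 1 ->
  (seg p c t : P2).2 < (seg r d t : P2).2.
Proof.
move=> pr cd /andP[t0 t1]; rewrite -subr_gt0 /=.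
have -> : r.2 + t * (d.2 - r.2) - (p.2 + t * (c.2 - p.2)) =
  (1 - t) * (r.2 - p.2) + t * (d.2 - c.2) by ring.
move: t0; rewrite le_eqVlt => /orP[/eqP <-|t0]; first by rewrite subr0 mul1r mul0r addr0 subr_gt0.
apply: ltr_wpDl; first by rewrite mulr_ge0 ?subr_ge0 // ltW.
by rewrite mulr_gt0 // subr_gt0.
Qed.

(** Pairs with at least one inner point are deformed to the fixed pair [c1], [c2]; pairs of boundary
    points at different heights are compared through the center of the strip. *)
Lemma level_sgn l : exists e : R, (e = 1 \/ e = -1) /\ forall p r, St A l p -> St A l r ->
  Num.sg ((hh l r).2 - (hh l p).2) = e * Num.sg (r.2 - p.2).
Proof.
have uv := atlas_bounds hA l; have uv' := atlas_bounds hA' (nu l).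
have cen := center_inner hA l; have Scen := center_dom hA l.
pose c1 : P2 := (0, (2 * su A l + sv A l) / 3).
pose c2 : P2 := (0, (su A l + 2 * sv A l) / 3).
have i1 : inner l c1 by rewrite /inner /=; lra.
have i2 : inner l c2 by rewrite /inner /=; lra.
have S1 := inner_St hA i1; have S2 := inner_St hA i2.
have c12 : c1.2 < c2.2 by rewrite /=; lra.
have /cts_pair[_ ch] := strip_map_cts hg (l := l).
have neq p r : St A l p -> St A l r -> inner l p \/ inner l r -> p.2 < r.2 ->
   forall t, 0 <= t <= 1 -> (hh l (seg p c1 t)).2 <> (hh l (seg r c2 t)).2.
  move=> Sp Sr ipr pr t t01; have lt := seg_lt2 pr c12 t01.
  apply: half_inner_level_neq; try (by apply: (seg_strip (atlas_strip hA l))).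
    move: t01 => /andP[]; rewrite le_eqVlt => /orP[/eqP <-|t0 t1]; first by rewrite !seg0.
    by left; apply: seg_inner => //; rewrite t0.
  by move=> e; move: lt; rewrite e ltxx.
have up p r : St A l p -> St A l r -> inner l p \/ inner l r -> p.2 < r.2 ->
    (hh l p).2 < (hh l r).2 -> (hh l c1).2 < (hh l c2).2.
  move=> Sp Sr ipr pr.
  apply: (seg_sign (p1 := p) (p2 := r) ch ch) => t t1; try exact: (seg_strip (atlas_strip hA l)).
  exact: neq.
have down p r : St A l p -> St A l r -> inner l p \/ inner l r -> p.2 < r.2 ->
    (hh l r).2 < (hh l p).2 -> (hh l c2).2 < (hh l c1).2.
  move=> Sp Sr ipr pr.
  apply: (seg_sign (p1 := r) (p2 := p) ch ch) => t t1; try exact: (seg_strip (atlas_strip hA l)).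
  by apply/nesym/neq.
have [e he He] : exists2 e : R, e = 1 \/ e = -1 &
    forall p r, St A l p -> St A l r -> inner l p \/ inner l r -> p.2 < r.2 ->
      0 < e * ((hh l r).2 - (hh l p).2).
  case: (ltgtP (hh l c1).2 (hh l c2).2) => [hc|hc|/(inner_level i1 i2) e].
  - exists 1; first by left.
    move=> p r Sp Sr ipr pr; rewrite mul1r subr_gt0.
    case: ltgtP => // [/(down _ _ Sp Sr ipr pr)/(lt_trans hc)|/half_inner_level_neq []//].
      by rewrite ltxx.
    by move=> e; move: pr; rewrite e ltxx.
  - exists (-1); first by right.
    move=> p r Sp Sr ipr pr; rewrite mulN1r opprB subr_gt0.
    case: ltgtP => // [/(up _ _ Sp Sr ipr pr)/(lt_trans hc)|/esym/half_inner_level_neq []//].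
      by rewrite ltxx.
    by move=> e; move: pr; rewrite e ltxx.
  - by move: c12; rewrite e ltxx.
have He' p r : St A l p -> St A l r -> p.2 < r.2 -> 0 < e * ((hh l r).2 - (hh l p).2).
  move=> Sp Sr pr; have [ip|nip] := pselect (inner l p); first by apply: He; auto.
  have [ir|nir] := pselect (inner l r); first by apply: He; auto.
  have /andP[p1 p2] := strip_bounds (atlas_strip hA l) Sp.
  have /andP[r1 r2] := strip_bounds (atlas_strip hA l) Sr.
  have [bp|//] := bdry_or_interior (atlas_strip hA l) Sp.
  have [br|//] := bdry_or_interior (atlas_strip hA l) Sr.
  have /andP[ce1 ce2] := cen.
  have pc : p.2 < (strip_center l).2 by case/bdryP: bp => _ [->|ep] //; move: pr r2; rewrite ep; lra.
  have cr : (strip_center l).2 < r.2 by case/bdryP: br => _ [er|->] //; move: pr p1; rewrite er; lra.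
  have h1 := He p _ Sp Scen (or_intror cen) pc.
  have h2 := He _ r Scen Sr (or_introl cen) cr.
  by have := addr_gt0 h1 h2; rewrite -mulrDr addrC subrKA.
exists e; split => // p r Sp Sr; apply: sg_strict => //; [exact: He'|exact: He'|move=> pr].
have [ip|nip] := pselect (inner l p).
  by apply/inner_level => //; rewrite /inner -pr.
(* Points of one boundary line may lie in different boundary intervals, so leaves do not relate
   their images. Both images are boundary points on the same side of the image of the center, which
   fixes their common height. *)
have [bp|//] := bdry_or_interior (atlas_strip hA l) Sp.
have nip' : ~ inner (nu l) (hh l p) by move/(inner_map Sp).
have nir' : ~ inner (nu l) (hh l r) by move/(inner_map Sr); rewrite /inner -pr.
have [/bdryP[_ lp]|//] := bdry_or_interior (atlas_strip hA' (nu l)) (strip_map_St hA hg Sp).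
have [/bdryP[_ lr]|//] := bdry_or_interior (atlas_strip hA' (nu l)) (strip_map_St hA hg Sr).
have : inner (nu l) (hh l (strip_center l)) by apply/inner_map.
rewrite /inner => /andP[ci1 ci2].
have /andP[ce1 ce2] := cen.
case/bdryP: bp => _ [pu|pv].
  have hp := He' p _ Sp Scen; rewrite pu in hp; have {}hp := hp ce1.
  have hr := He' r _ Sr Scen; rewrite -pr pu in hr; have {}hr := hr ce1.
  rewrite /nu /hh /= in lp lr ci1 ci2 hp hr *.
  by case: he hp hr => -> hp hr; case: lp => lp; case: lr => lr; rewrite lp lr // in hp hr *;
    move: hp hr ci1 ci2; lra.
have hp := He' _ p Scen Sp; rewrite pv in hp; have {}hp := hp ce2.
have hr := He' _ r Scen Sr; rewrite -pr pv in hr; have {}hr := hr ce2.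
rewrite /nu /hh /= in lp lr ci1 ci2 hp hr *.
by case: he hp hr => -> hp hr; case: lp => lp; case: lr => lr; rewrite lp lr // in hp hr *;
  move: hp hr ci1 ci2; lra.
Qed.

(** Images of a row share one height by [level_sgn], so injectivity separates their first
    coordinates, and an ordered pair on any row can be deformed to [c1], [c2]. *)
Lemma row_sgn l : exists d : R, (d = 1 \/ d = -1) /\ forall p r, St A l p -> St A l r ->
  p.2 = r.2 -> Num.sg ((hh l r).1 - (hh l p).1) = d * Num.sg (r.1 - p.1).
Proof.
have [e [he He]] := level_sgn l.
have lev p r : St A l p -> St A l r -> p.2 = r.2 -> (hh l p).2 = (hh l r).2.
  move=> Sp Sr pr; have := He p r Sp Sr; rewrite pr subrr sgr0 mulr0 => /eqP.
  by rewrite sgr_eq0 subr_eq0 => /eqP.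
have inj p r : St A l p -> St A l r -> p.2 = r.2 -> (hh l p).1 = (hh l r).1 -> p = r.
  move=> Sp Sr pr e1; apply: (strip_map_inj hA hg Sp Sr).
  by rewrite [LHS]surjective_pairing [RHS]surjective_pairing e1 (lev _ _ Sp Sr pr).
pose c1 : P2 := (0, (su A l + sv A l) / 2).
pose c2 : P2 := (1, (su A l + sv A l) / 2).
have uv := atlas_bounds hA l.
have i1 : inner l c1 by rewrite /inner /=; lra.
have i2 : inner l c2 by rewrite /inner /=; lra.
have /cts_pair[ch _] := strip_map_cts hg (l := l).
have neq p r : St A l p -> St A l r -> p.2 = r.2 -> p.1 < r.1 ->
   forall t, 0 <= t <= 1 -> (hh l (seg p c1 t)).1 <> (hh l (seg r c2 t)).1.
  move=> Sp Sr pr2 pr t t01 /inj e1.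
  have := e1 (seg_strip (atlas_strip hA l) Sp i1 t01) (seg_strip (atlas_strip hA l) Sr i2 t01).
  rewrite /seg /= pr2 => /(_ erefl)[].
  move: t01 => /andP[t0 t1] ee; have h1 := mulr_ge0 t0 (ltW (ltr01 : 0 < 1 :> R)).
  have h2 : 0 <= (1 - t) * (r.1 - p.1) by rewrite mulr_ge0 // ?subr_ge0 // ltW.
  have e3 : (1 - t) * (r.1 - p.1) + t = 0.
    transitivity (r.1 + t * (1 - r.1) - (p.1 + t * (0 - p.1))); first by ring.
    by rewrite ee subrr.
  have t00 : t = 0 by lra.
  by move: e3; rewrite t00 subr0 mul1r addr0; lra.
have up p r : St A l p -> St A l r -> p.2 = r.2 -> p.1 < r.1 ->
    (hh l p).1 < (hh l r).1 -> (hh l c1).1 < (hh l c2).1.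
  move=> Sp Sr pr2 pr.
  apply: (seg_sign (p1 := p) (p2 := r) ch ch) => t t1; try exact: (seg_strip (atlas_strip hA l)).
  exact: neq.
have down p r : St A l p -> St A l r -> p.2 = r.2 -> p.1 < r.1 ->
    (hh l r).1 < (hh l p).1 -> (hh l c2).1 < (hh l c1).1.
  move=> Sp Sr pr2 pr.
  apply: (seg_sign (p1 := r) (p2 := p) ch ch) => t t1; try exact: (seg_strip (atlas_strip hA l)).
  by apply/nesym/neq.
have [d hd Hd] : exists2 d : R, d = 1 \/ d = -1 &
    forall p r, St A l p -> St A l r -> p.2 = r.2 -> p.1 < r.1 ->
      0 < d * ((hh l r).1 - (hh l p).1).
  case: (ltgtP (hh l c1).1 (hh l c2).1) => [hc|hc|/inj e1].
  - exists 1; first by left.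
    move=> p r Sp Sr pr2 pr; rewrite mul1r subr_gt0.
    case: ltgtP => // [/(down _ _ Sp Sr pr2 pr)/(lt_trans hc)|/inj e1].
      by rewrite ltxx.
    by move: pr; rewrite e1 // ltxx.
  - exists (-1); first by right.
    move=> p r Sp Sr pr2 pr; rewrite mulN1r opprB subr_gt0.
    case: ltgtP => // [/(up _ _ Sp Sr pr2 pr)/(lt_trans hc)|/inj e1].
      by rewrite ltxx.
    by move: pr; rewrite e1 // ltxx.
  - have [] := e1 (inner_St hA i1) (inner_St hA i2) erefl.
    by move=> /eqP; rewrite eq_sym oner_eq0.
exists d; split => // p r Sp Sr pr2; apply: sg_strict => //; [exact: Hd| |].
  by apply: Hd.
move=> pr1; suff -> : p = r by [].
by rewrite [p]surjective_pairing [r]surjective_pairing pr1 pr2.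
Qed.

End StripShape.

(** * Graph data induced by an equivalence *)

Section EquivalenceToGraph.
Variables (R : realType) (A A' : atlas_data R).
Notation P2 := (R * R)%type.
Hypotheses (hA : is_striped_atlas A) (hA' : is_striped_atlas A').
Variables (h : Lam A * P2 -> Lam A' * P2) (g : Lam A' * P2 -> Lam A * P2).
Hypothesis hg : fol_inverse h g.

Let mu := strip_index h.
Let hh := strip_map h.
Let gh := fol_inverse_sym hA hA' hg.

Lemma strip_map_surj l p' : St A' (mu l) p' -> exists2 p, St A l p & hh l p = p'.
Proof.
move=> Sp'; exists (strip_map g (mu l) p').
  have := strip_map_St hA' gh Sp'.
  by rewrite (strip_indexK hA hA' hg).
have := strip_mapK hA' gh Sp'.
by rewrite (strip_indexK hA hA' hg).
Qed.

Lemma strip_image l : [set h (l, p) | p in St A l] = [set (mu l, p') | p' in St A' (mu l)].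
Proof.
apply/seteqP; split=> [_ [p Sp <-]|_ [p' Sp' <-]].
  by rewrite (strip_mapE hA hg Sp); exists (strip_map h l p) => //; exact: (strip_map_St hA hg).
have [p Sp <-] := strip_map_surj Sp'.
by exists p => //; rewrite (strip_mapE hA hg Sp).
Qed.

Lemma induced_exists : exists nu eta delta tau, induced_by A A' h nu eta delta tau.
Proof.
exists mu, (fun H => (mu H.1, [set (h (H.1, p)).2 | p in H.2])).
exists (fun l => if `[< forall y x1 x2 : R, su A l < y < sv A l -> x1 < x2 ->
  (h (l, (x1, y))).2.1 < (h (l, (x2, y))).2.1 >] then 1 else -1).
exists (fun l => if `[< forall p1 p2 : P2, St A l p1 -> St A l p2 -> p1.2 < p2.2 ->
  (h (l, p1)).2.2 < (h (l, p2)).2.2 >] then 1 else -1).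
by split => //; exact: strip_image.
Qed.

Lemma bdry_map l p : St A l p -> bdry (St A l) (su A l) (sv A l) p ->
  bdry (St A' (mu l)) (su A' (mu l)) (sv A' (mu l)) (hh l p).
Proof.
move=> Sp bp; have [//|] := bdry_or_interior (atlas_strip hA' (mu l)) (strip_map_St hA hg Sp).
by move=> /(inner_map hA hA' hg Sp) /(bdry_not_interior bp).
Qed.

Lemma halfedge_image l X : halfedge A (l, X) -> halfedge A' (mu l, hh l @` X).
Proof.
move=> bX; have [p Xp] := boundary_interval_neq0 (halfedge_boundary bX).
apply: (strip_leaf_bdry (p := hh l p)); [|by exists p|].
  by apply: (leaf_image hA hg); right.
by apply: bdry_map; [exact: halfedge_sub bX _ Xp|exact: (boundary_interval_sub (halfedge_boundary bX))].
Qed.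

Variables (nu : Lam A -> Lam A') (eta : Lam A * set P2 -> Lam A' * set P2).
Variables (delta tau : Lam A -> int).
Hypothesis ind : induced_by A A' h nu eta delta tau.

Lemma induced_nu l : nu l = mu l.
Proof.
have [hn _ _ _] := ind; have Sc := center_dom hA l.
have : [set h (l, p) | p in St A l] (h (l, strip_center l)) by exists (strip_center l).
by rewrite hn => -[p' _ e]; rewrite /mu /strip_index -e.
Qed.

Lemma induced_eta l X : halfedge A (l, X) -> eta (l, X) = (mu l, hh l @` X).
Proof. by have [_ he _ _] := ind; move=> bX; rewrite he // induced_nu. Qed.

(** The test that defines [delta] sees interior rows only; [row_sgn] carries its sign to the
    boundary lines, where the conditions on half-edges live. *)
Lemma induced_delta l : sign (delta l) /\ forall p r, St A l p -> St A l r ->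
  p.2 = r.2 -> Num.sg ((hh l r).1 - (hh l p).1) = (delta l)%:~R * Num.sg (r.1 - p.1).
Proof.
have [_ _ hd _] := ind; have [d [dd Hd]] := row_sgn hA hA' hg l.
have uv := atlas_bounds hA l.
rewrite hd; case: asboolP => H; (split; first by [left|right]).
  case: dd => ed; first by rewrite ed in Hd.
  exfalso; pose y := (su A l + sv A l) / 2.
  have yi : su A l < y < sv A l by rewrite /y; lra.
  have i0 : St A l (0, y) by exact: (inner_St hA).
  have i1 : St A l (1, y) by exact: (inner_St hA).
  have := Hd _ _ i0 i1 erefl; have := H y 0 1 yi ltr01.
  rewrite -/(strip_map h l (0, y)) -/(strip_map h l (1, y)) -/hh -subr_gt0 => /gtr0_sg ->.
  by rewrite ed /= subr0 sgr1 mulr1 => /eqP; rewrite -subr_eq0 opprK -mulr2n pnatr_eq0.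
case: dd => ed; last by rewrite ed in Hd.
exfalso; apply: H => y x1 x2 yi x12.
have i1 : St A l (x1, y) by exact: (inner_St hA).
have i2 : St A l (x2, y) by exact: (inner_St hA).
have e0 := Hd _ _ i1 i2 erefl; rewrite ed in e0.
by have := sg_pos (or_introl erefl) e0 x12; rewrite mul1r subr_gt0.
Qed.

Lemma induced_tau l : sign (tau l) /\ forall p r, St A l p -> St A l r ->
  Num.sg ((hh l r).2 - (hh l p).2) = (tau l)%:~R * Num.sg (r.2 - p.2).
Proof.
have [_ _ _ hd] := ind; have [d [dd Hd]] := level_sgn hA hA' hg l.
have uv := atlas_bounds hA l.
rewrite hd; case: asboolP => H; (split; first by [left|right]).
  case: dd => ed; first by rewrite ed in Hd.
  exfalso; pose p : P2 := (0, (2 * su A l + sv A l) / 3).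
  pose r : P2 := (0, (su A l + 2 * sv A l) / 3).
  have i0 : St A l p by apply: (inner_St hA); rewrite /inner /p /=; lra.
  have i1 : St A l r by apply: (inner_St hA); rewrite /inner /r /=; lra.
  have pr : p.2 < r.2 by rewrite /p /r /=; lra.
  have := Hd _ _ i0 i1; have := H p r i0 i1 pr.
  rewrite -/(strip_map h l p) -/(strip_map h l r) -/hh -subr_gt0 => /gtr0_sg ->.
  rewrite ed (@gtr0_sg _ (r.2 - p.2)) ?subr_gt0 // mulr1 => /eqP.
  by rewrite -subr_eq0 opprK -mulr2n pnatr_eq0.
case: dd => ed; last by rewrite ed in Hd.
exfalso; apply: H => p r Sp Sr pr.
have e0 := Hd _ _ Sp Sr; rewrite ed in e0.
by have := sg_pos (or_introl erefl) e0 pr; rewrite mul1r subr_gt0.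
Qed.

End EquivalenceToGraph.

Section Sides.
Variables (R : realType) (A : atlas_data R).
Notation P2 := (R * R)%type.
Hypothesis hA : is_striped_atlas A.

Lemma halfedge_eq l X Y p : halfedge A (l, X) -> halfedge A (l, Y) -> X p -> Y p -> X = Y.
Proof. exact: boundary_interval_eq. Qed.

Definition side_level (s : int) (l : Lam A) : R := if s < 0 then su A l else sv A l.

Lemma signM s t : sign s -> sign t -> sign (s * t).
Proof. by move=> [->|->] [->|->]; [left|right|right|left]. Qed.

Lemma sign_sq s : sign s -> s * s = 1. Proof. by case=> ->. Qed.

(** The side is recognized by the sign of the height relative to an inner point; in this form
    [induced_tau] turns the passage to the image into multiplication by [tau]. *)
Lemma side_levelP s l p c : sign s -> St A l p -> inner l c ->
  p.2 = side_level s l <-> bdry (St A l) (su A l) (sv A l) p /\ Num.sg (p.2 - c.2) = s%:~R.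
Proof.
move=> hs Sp /andP[c1 c2]; rewrite /side_level; split=> [e|[/bdryP[_ lp]]].
  split; first by apply/bdryP; split => //; rewrite e; case: ifP; auto.
  case: hs e => -> /= ->.
    by rewrite gtr0_sg // subr_gt0.
  by rewrite ltr0_sg // subr_lt0.
case: lp => ->.
  rewrite ltr0_sg ?subr_lt0 //; case: hs => -> //= /eqP.
  by rewrite eq_sym -subr_eq0 opprK -mulr2n pnatr_eq0.
rewrite gtr0_sg ?subr_gt0 //; case: hs => -> //= /eqP.
by rewrite -subr_eq0 opprK -mulr2n pnatr_eq0.
Qed.

End Sides.

Section EquivalenceGraphIso.
Variables (R : realType) (A A' : atlas_data R).
Notation P2 := (R * R)%type.
Hypotheses (hA : is_striped_atlas A) (hA' : is_striped_atlas A').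
Variables (h : Lam A * P2 -> Lam A' * P2) (g : Lam A' * P2 -> Lam A * P2).
Hypothesis hg : fol_inverse h g.
Variable (k : Zsp A -> Zsp A').
Hypothesis k_inj : injective k.
Hypothesis hk : forall l p, St A l p -> q A' (h (l, p)).1 (h (l, p)).2 = k (q A l p).
Variables (nu : Lam A -> Lam A') (eta : Lam A * set P2 -> Lam A' * set P2).
Variables (delta tau : Lam A -> int).
Hypothesis ind : induced_by A A' h nu eta delta tau.

Let mu := strip_index h.
Let hh := strip_map h.
Let gh := fol_inverse_sym hA hA' hg.
Let etaE := @induced_eta _ _ _ hA _ _ _ _ _ ind.
Let nuE := induced_nu hA ind.

Lemma q_strip_map l p : St A l p -> q A' (mu l) (hh l p) = k (q A l p).
Proof. by move=> Sp; rewrite -hk // (strip_mapE hA hg Sp). Qed.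

Lemma strip_index_inj : injective mu.
Proof. exact: can_inj (strip_indexK hA hA' hg). Qed.

Lemma q_strip_map_eq l p m r : St A l p -> St A m r ->
  q A' (mu l) (hh l p) = q A' (mu m) (hh m r) <-> q A l p = q A m r.
Proof.
move=> Sp Sr; rewrite !q_strip_map //; split=> [/k_inj //|-> //].
Qed.

Lemma eta_surj l' X' : halfedge A' (l', X') ->
  exists l X, [/\ halfedge A (l, X), l' = mu l & X' = hh l @` X].
Proof.
move=> bX'; exists (strip_index g l'), (strip_map g l' @` X').
have := strip_indexK hA' hA gh l'; rewrite -/mu => e.
split => //; first exact: (halfedge_image hA' hA gh bX').
apply/seteqP; split=> [p Xp|_ [_ [p Xp <-] <-]].
  exists (strip_map g l' p); first by exists p.
  by rewrite /hh (strip_mapK hA' gh) //; exact: (halfedge_sub bX' Xp).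
by rewrite /hh (strip_mapK hA' gh) //; exact: (halfedge_sub bX' Xp).
Qed.

Lemma strip_map_image_inj l X Y : halfedge A (l, X) -> halfedge A (l, Y) ->
  hh l @` X = hh l @` Y -> X = Y.
Proof.
have main Z W : halfedge A (l, Z) -> halfedge A (l, W) ->
    hh l @` Z = hh l @` W -> Z `<=` W.
  move=> bZ bW e p Zp; have : (hh l @` Z) (hh l p) by exists p.
  rewrite e => -[r Wr er].
  have <- // := strip_map_inj hA hg (halfedge_sub bW Wr) (halfedge_sub bZ Zp) er.
by move=> bX bY e; apply/seteqP; split; apply: main.
Qed.

(** One pair of identified points suffices: [q A'] identifies their images, [q_fibers] supplies
    glued half-edges there, and a half-edge is determined by any of its points. *)
Lemma glu_strip_map l X m Y : glu (l, X) (m, Y) ->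
  glu (mu l, hh l @` X) (mu m, hh m @` Y).
Proof.
move=> gXY; have bX := glu_halfedge hA gXY; have bY := glu_halfedge hA (glu_sym gXY).
have [x Xx] := boundary_interval_neq0 (halfedge_boundary bX).
have [y Yy e] := glu_partner hA gXY Xx.
have Sx := halfedge_sub bX Xx; have Sy := halfedge_sub bY Yy.
have /(q_fibers hA' (strip_map_St hA hg Sx) (strip_map_St hA hg Sy)) :=
  (q_strip_map_eq Sx Sy).2 (esym e).
case=> [[/strip_index_inj lm]|[X' [Y' [g' X'x Y'y]]]].
  subst m => /(strip_map_inj hA hg Sx Sy) xy; subst y.
  by case: (glu_neq hA gXY); rewrite (halfedge_eq bX bY Xx Yy).
have bX' := glu_halfedge hA' g'; have bY' := glu_halfedge hA' (glu_sym g').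
rewrite (halfedge_eq (halfedge_image hA hA' hg bX) bX' (p := hh l x)) //; last by exists x.
by rewrite (halfedge_eq (halfedge_image hA hA' hg bY) bY' (p := hh m y)) //; exists y.
Qed.

Lemma glu_strip_map_inv l X K' : halfedge A (l, X) -> glu (mu l, hh l @` X) K' ->
  exists K, glu (l, X) K.
Proof.
move=> bX g'; have bX' := glu_halfedge hA' g'.
case: K' g' => l' Y' g'; have bY' := glu_halfedge hA' (glu_sym g').
have [m [Y [bY em eY]]] := eta_surj bY'; subst l' Y'.
have [x Xx] := boundary_interval_neq0 (halfedge_boundary bX).
have X'x : (hh l @` X) (hh l x) by exists x.
have [_ [y Yy <-] e] := glu_partner hA' g' X'x.
have Sx := halfedge_sub bX Xx; have Sy := halfedge_sub bY Yy.
have /(q_fibers hA Sx Sy) := (q_strip_map_eq Sx Sy).1 (esym e).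
case=> [[lm xy]|[X1 [Y1 [g1 X1x _]]]].
  subst m y; case: (glu_neq hA' g'); congr (_, _).
  by rewrite (halfedge_eq bX bY Xx Yy).
exists (m, Y1).
by rewrite (halfedge_eq bX (glu_halfedge hA g1) Xx X1x).
Qed.

Lemma side_level_map s l p : sign s -> St A l p ->
  (hh l p).2 = side_level (tau l * s) (mu l) <-> p.2 = side_level s l.
Proof.
move=> hs Sp; have [ht Ht] := induced_tau hA hA' hg ind l.
have ic := center_inner hA l; have Sc := center_dom hA l.
have ic' := (inner_map hA hA' hg Sc).2 ic.
have Sp' := strip_map_St hA hg Sp.
have e : Num.sg ((hh l p).2 - (hh l (strip_center l)).2) =
   (tau l)%:~R * Num.sg (p.2 - (strip_center l).2) by exact: Ht.
have tt : (tau l)%:~R * (tau l)%:~R = 1 :> R by rewrite -intrM sign_sq.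
rewrite (side_levelP (signM ht hs) Sp' ic') (side_levelP hs Sp ic) e intrM; split=> -[bp hp].
  split; last by have := congr1 ( *%R (tau l)%:~R) hp; rewrite !mulrA tt !mul1r.
  have [//|ip] := bdry_or_interior (atlas_strip hA l) Sp.
  by case: (bdry_not_interior bp); apply/(inner_map hA hA' hg Sp).
by split; [exact: (bdry_map hA hA' hg)|rewrite hp].
Qed.

Lemma dside_map s l X : sign s -> halfedge A (l, X) ->
  dside A' (tau l * s) (mu l) (hh l @` X) <-> dside A s l X.
Proof.
move=> hs bX; split=> -[_ H]; split => //.
- move=> p Xp; apply: (side_level_map hs (halfedge_sub bX Xp)).1.
  by apply: H; exists p.
- exact: (halfedge_image hA hA' hg).
- move=> _ [p Xp <-]; apply: (side_level_map hs (halfedge_sub bX Xp)).2.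
  exact: H.
Qed.

(** The correspondence between the images runs back along [hh l], across the gluing and out along
    [hh m]; the three signs multiply. *)
Lemma gsgn_strip_map l X m Y s : glu (l, X) (m, Y) -> gsgn (l, X) (m, Y) s ->
  gsgn (mu l, hh l @` X) (mu m, hh m @` Y) ((delta l)%:~R * s * (delta m)%:~R).
Proof.
move=> gXY hs; have bX := glu_halfedge hA gXY; have bY := glu_halfedge hA (glu_sym gXY).
have [dl Hl] := induced_delta hA hA' hg ind l; have [dm Hm] := induced_delta hA hA' hg ind m.
have [c _ lX] := boundary_interval_level (atlas_strip hA l) (halfedge_boundary bX).
have [d _ lY] := boundary_interval_level (atlas_strip hA m) (halfedge_boundary bY).
move=> _ _ _ _ [x1 Xx1 <-] [x2 Xx2 <-] [y1 Yy1 <-] [y2 Yy2 <-] /=.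
have Sx1 := halfedge_sub bX Xx1; have Sx2 := halfedge_sub bX Xx2.
have Sy1 := halfedge_sub bY Yy1; have Sy2 := halfedge_sub bY Yy2.
move=> /(q_strip_map_eq Sx1 Sy1) e1 /(q_strip_map_eq Sx2 Sy2) e2.
rewrite (Hl x1 x2) ?lX // (Hm y1 y2) ?lY // (hs x1 x2 y1 y2) //.
have tt : (delta l)%:~R * (delta l)%:~R = 1 :> R by rewrite -intrM sign_sq.
move: (Num.sg _) (delta m)%:~R (delta l)%:~R tt => z dm' dl' tt.
transitivity (dl' * dl' * (dm' * (s * z))); first by rewrite tt mul1r.
ring.
Qed.

Theorem equiv_graph_iso : graph_iso A A' nu eta delta tau.
Proof.
split; split.
- exists (strip_index g) => l; first by rewrite nuE (strip_indexK hA hA' hg).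
  by rewrite nuE (strip_indexK hA' hA gh).
- split.
  + by move=> [l X] bX; rewrite etaE //; exact: (halfedge_image hA hA' hg).
  + move=> [l X] [m Y] /set_mem bX /set_mem bY; rewrite !etaE // => -[/strip_index_inj lm].
    by subst m => /(strip_map_image_inj bX bY) ->.
  + move=> [l' X'] /eta_surj[l [X [bX -> ->]]]; exists (l, X) => //.
    by rewrite etaE.
- move=> l; split; [exact: (induced_delta hA hA' hg ind l).1|].
  exact: (induced_tau hA hA' hg ind l).1.
- move=> l s hs; split.
    apply/seteqP; split=> [_ [X dX <-]|_ [X' dX' <-]].
      have bX : halfedge A (l, X) by case: dX.
      rewrite etaE //; exists (hh l @` X); last by rewrite nuE.
      by rewrite nuE; exact: (dside_map hs bX).2.
    rewrite nuE in dX' *; have bX' : halfedge A' (mu l, X') by case: dX'.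
    have [m [X [bX /strip_index_inj lm eX]]] := eta_surj bX'; subst m X'.
    by exists X; [exact: (dside_map hs bX).1|rewrite etaE].
  move=> X X' [bX hX] [bX' hX'] XX'; rewrite !etaE //=.
  have [dl Hl] := induced_delta hA hA' hg ind l.
  case: ifP => d1 _ _ [a Xa <-] [b Xb <-].
    have e : a.2 = b.2 by rewrite (hX _ Xa) (hX' _ Xb).
    have := sg_pos (signP _ dl) (Hl _ _ (halfedge_sub bX Xa) (halfedge_sub bX' Xb) e) (XX' _ _ Xa Xb).
    by rewrite (eqP d1) mul1r subr_gt0.
  have e : b.2 = a.2 by rewrite (hX _ Xb) (hX' _ Xa).
  have := sg_pos (signP _ dl) (Hl _ _ (halfedge_sub bX Xb) (halfedge_sub bX' Xa) (esym _)) (XX' _ _ Xb Xa).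
  move=> /(_ (esym e)); case: dl d1 => -> // _.
  by rewrite mulN1r opprB subr_gt0.
- move=> [l X] [m Y] bX /xi_relP [gXY|[_ nX ->]]; apply/xi_relP.
    have bY := glu_halfedge hA (glu_sym gXY).
    by left; rewrite !etaE //; exact: glu_strip_map.
  right; split => //; first by rewrite etaE //; exact: (halfedge_image hA hA' hg).
  by move=> K'; rewrite etaE // => /(glu_strip_map_inv bX)[K /nX].
- move=> l m X Y s s' bX bY _ _ /(sigma_gsgn hA)[hs gXY Hs] /(sigma_gsgn hA')[hs' g' Hs'].
  have e : eta (l, X) = (mu l, hh l @` X) by exact: etaE.
  have e' : eta (m, Y) = (mu m, hh m @` Y) by exact: etaE.
  rewrite e e' in g' Hs'.
  have [dl Hl] := induced_delta hA hA' hg ind l; have [dm Hm] := induced_delta hA hA' hg ind m.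
  have := gsgn_uniq hA' g' Hs' (gsgn_strip_map gXY Hs).
  rewrite -!intrM => /intr_inj ->.
  by rewrite -mulrA sign_sq // mulr1.
Qed.

End EquivalenceGraphIso.

(** * Extending boundary maps over a strip *)

Section Envelope.
Variable R : realType.
Implicit Types (x y s t c : R).

(** One Lipschitz estimate for the shape of [penalty]; the slack [k] is split into a share [k1] for
    the maximum and a share [k2] for the added term. *)
Lemma min_max_shift (u v c a u' v' a' k1 k2 k : R) : u <= u' + k -> v <= v' + k1 -> 0 <= k1 ->
  a <= a' + k2 -> k1 + k2 <= k ->
  Num.min u (Num.max c v + a) <= Num.min u' (Num.max c v' + a') + k.
Proof.
move=> hu hv hk ha hkk; rewrite -lerBlDr le_min; apply/andP; split; rewrite lerBlDr.
  by apply: le_trans hu; rewrite ge_min lexx.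
apply: (@le_trans _ _ (Num.max c v + a)); first by rewrite ge_min lexx orbT.
have h : Num.max c v <= Num.max c v' + k1.
  rewrite ge_max; apply/andP; split.
    by apply: (@le_trans _ _ (Num.max c v')); rewrite ?lerDl // le_max lexx.
  by apply: le_trans hv _; rewrite lerD2r le_max lexx orbT.
lra.
Qed.

Arguments min_max_shift {u v c a u' v' a'} k1 k2 {k}.

Lemma clip_lip x y : x <= y -> Num.min 1 (Num.max 0 x) <= Num.min 1 (Num.max 0 y) /\
  Num.min 1 (Num.max 0 y) <= Num.min 1 (Num.max 0 x) + (y - x).
Proof.
move=> xy; rewrite -[Num.max 0 x]addr0 -[Num.max 0 y]addr0; split.
  by rewrite -[leRHS]addr0; apply: (min_max_shift 0 0); lra.
by apply: (min_max_shift (y - x) (0)); lra.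
Qed.

Section OneSide.
Variables (E : set R) (f : R -> R).

(** The added term vanishes for [s >= x]; its clip at 1 bounds the variation in [t] uniformly in
    [s], which gives continuity in [t]. *)
Definition penalty s x t : R :=
  Num.min (x + t) (Num.max (f s) (x - t) + t ^+ 2 * Num.min 1 (Num.max 0 (x - s))).
(** The member [x + t] keeps the set nonempty when [E] is empty, that is on a side without boundary
    intervals. *)
Definition penalties x t : set R := [set z | z = x + t \/ exists2 s, E s & z = penalty s x t].
(* An inf-convolution, truncated to [x - t, x + t]. As t tends to infinity the
   penalty forces s >= x, so that inf (penalties x t) tends to f x on E; the
   truncation makes it a self-map of the line even where f is unbounded. *)
Definition envelope x t : R := x / t + inf (penalties x t).

Let bump s x : R := Num.min 1 (Num.max 0 (x - s)).

Let bump_ge0 s x : 0 <= bump s x.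
Proof. by rewrite /bump le_min ler01 le_max lexx. Qed.

Let bump_le1 s x : bump s x <= 1.
Proof. by rewrite /bump ge_min lexx. Qed.

Let bump_mono s x y : x <= y -> bump s x <= bump s y.
Proof. by move=> xy; apply: (clip_lip _).1; rewrite lerD2r. Qed.

Let bump_lip s x y : x <= y -> bump s y <= bump s x + (y - x).
Proof.
move=> xy; apply: le_trans (clip_lip (_ : x - s <= y - s)).2 _; first by rewrite lerD2r.
by rewrite lerD2l; lra.
Qed.

Let penaltyE s x t :
  penalty s x t = Num.min (x + t) (Num.max (f s) (x - t) + t ^+ 2 * bump s x).
Proof. by []. Qed.

Lemma penalties_lbound x t : 0 <= t -> lbound (penalties x t) (x - t).
Proof.
move=> t0 z [->|[s Es ->]]; first by lra.
rewrite penaltyE le_min; apply/andP; split; first by lra.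
apply: (@le_trans _ _ (Num.max (f s) (x - t))); first by rewrite le_max lexx orbT.
by rewrite lerDl mulr_ge0 // sqr_ge0.
Qed.

Lemma envelope_ge x t : 0 <= t -> x / t + (x - t) <= envelope x t.
Proof.
move=> t0; rewrite lerD2l; apply: lb_le_inf; last exact: penalties_lbound.
by exists (x + t); left.
Qed.

Lemma inf_penalties_le x t z : 0 <= t -> penalties x t z -> inf (penalties x t) <= z.
Proof. by move=> t0 Pz; apply: ge_inf => //; exists (x - t); exact: penalties_lbound. Qed.

Lemma envelope_le x t : 0 <= t -> envelope x t <= x / t + (x + t).
Proof. by move=> t0; rewrite lerD2l; apply: inf_penalties_le => //; left. Qed.

Lemma inf_penalties_cmp x t x' t' c : 0 <= t -> 0 <= t' -> x' + t' <= x + t + c ->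
  (forall s, penalty s x' t' <= penalty s x t + c) ->
  inf (penalties x' t') <= inf (penalties x t) + c.
Proof.
move=> t0 t0' h1 h2; rewrite -lerBlDr; apply: lb_le_inf; first by exists (x + t); left.
move=> z [->|[s Es ->]]; rewrite lerBlDr.
  by apply: le_trans h1; apply: inf_penalties_le => //; left.
by apply: le_trans (h2 s); apply: inf_penalties_le => //; right; exists s.
Qed.

Lemma envelope_lt x y t : 0 < t -> x < y -> envelope x t < envelope y t.
Proof.
(* Strictness comes from the term [x / t]; for the infimum only monotonicity is shown. *)
move=> t0 xy; apply: ltr_leD; first by rewrite ltr_pM2r // invr_gt0.
rewrite -[leRHS]addr0; apply: (inf_penalties_cmp (ltW t0) (ltW t0)); first by lra.
move=> s; rewrite !penaltyE.
have h : t ^+ 2 * bump s x <= t ^+ 2 * bump s y.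
  by rewrite ler_wpM2l ?sqr_ge0 // bump_mono // ltW.
by apply: (min_max_shift 0 0); lra.
Qed.

Lemma envelope_lip x y t : 0 < t -> x <= y ->
  envelope y t <= envelope x t + (t^-1 + 1 + t ^+ 2) * (y - x).
Proof.
move=> t0 xy; rewrite /envelope.
have h : inf (penalties y t) <= inf (penalties x t) + (1 + t ^+ 2) * (y - x).
  have k : 0 <= t ^+ 2 * (y - x) by rewrite mulr_ge0 ?sqr_ge0 ?subr_ge0.
  apply: (inf_penalties_cmp (ltW t0) (ltW t0)); first by lra.
  move=> s; rewrite !penaltyE.
  have h : t ^+ 2 * bump s y <= t ^+ 2 * bump s x + t ^+ 2 * (y - x).
    by rewrite -mulrDr ler_wpM2l ?sqr_ge0 // bump_lip.
  by rewrite mulrDl mul1r; apply: (min_max_shift (y - x) (t ^+ 2 * (y - x))); lra.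
have -> : x / t + inf (penalties x t) + (t^-1 + 1 + t ^+ 2) * (y - x) =
  y / t + (inf (penalties x t) + (1 + t ^+ 2) * (y - x)) by ring.
by rewrite lerD2l.
Qed.

Lemma inf_penalties_lip_t x t t' : 0 < t -> t <= t' ->
  `|inf (penalties x t') - inf (penalties x t)| <= (t' - t) + (t' ^+ 2 - t ^+ 2).
Proof.
move=> t0 tt'; have t0' : 0 < t' by lra.
have sq : 0 <= t' ^+ 2 - t ^+ 2 by rewrite subr_ge0 ler_pXn2r // nnegrE ltW.
have key s : let a := t ^+ 2 * bump s x in let b := t' ^+ 2 * bump s x in
    a <= b /\ b <= a + (t' ^+ 2 - t ^+ 2).
  split; first by rewrite ler_wpM2r // -subr_ge0.
  rewrite -lerBlDl -mulrBl -[leRHS]mulr1 ler_wpM2l //.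
rewrite ler_norml; apply/andP; split.
  rewrite lerBrDl -lerBrDr opprK.
  apply: (inf_penalties_cmp (ltW t0') (ltW t0)); first by lra.
  move=> s; have [k1 k2] := key s; rewrite !penaltyE.
  by apply: (min_max_shift (t' - t) (0)); lra.
rewrite lerBlDl.
apply: (inf_penalties_cmp (ltW t0) (ltW t0')); first by lra.
move=> s; have [k1 k2] := key s; rewrite !penaltyE.
by apply: (min_max_shift (0) (t' ^+ 2 - t ^+ 2)); lra.
Qed.

Lemma envelope_cvg_t x t : 0 < t -> envelope x t' @[t' --> t] --> envelope x t.
Proof.
move=> t0; apply: cvgD.
  by apply: cvgM; [exact: cvg_cst|apply: cvgV; [rewrite gt_eqF|exact: cvg_id]].
apply/cvgrPdist_lt => e e0.
(* For [t'] below [2 * t], the bound of [inf_penalties_lip_t] is at most [1 + 3 * t] times the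
   distance from [t] to [t']. *)
have c0 : 0 < 1 + 3 * t by lra.
near=> t'.
have d1 : `|t - t'| < t by near: t'; apply: cvgr_dist_lt => //; exact: cvg_id.
have d2 : `|t - t'| < e / (1 + 3 * t).
  by near: t'; apply: cvgr_dist_lt; (exact: cvg_id || exact: divr_gt0).
have t0' : 0 < t' by move: d1; rewrite ltr_norml => /andP[]; lra.
rewrite ltr_pdivlMr // in d2.
have main a b : 0 < a -> 0 < b -> a <= b -> b < 2 * t -> a <= 2 * t -> a + b < 3 * t ->
    (b - a) * (1 + 3 * t) < e -> `|inf (penalties x b) - inf (penalties x a)| < e.
  move=> a0 b0 ab b2 a2 abt he; apply: le_lt_trans (inf_penalties_lip_t x a0 ab) _.
  apply: le_lt_trans he; rewrite mulrDr mulr1 lerD2l.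
  have -> : b ^+ 2 - a ^+ 2 = (b - a) * (a + b) by ring.
  by rewrite ler_wpM2l ?subr_ge0 // ltW.
move: d1; rewrite ltr_norml => /andP[d1 d1'].
case: (leP t t') => h; last first.
  apply: main; try lra.
  by move: d2; rewrite ger0_norm ?subr_ge0 // ltW.
rewrite distrC; apply: main; try lra.
by move: d2; rewrite ler0_norm ?subr_le0 // opprB.
Unshelve. all: by end_near. Qed.

Lemma envelope_cvg_pinfty x : E x -> (forall r s, E r -> E s -> r <= s -> f r <= f s) ->
  (forall e, 0 < e -> exists s, [/\ E s, s < x & f x - e < f s]) ->
  envelope x t @[t --> +oo] --> f x.
Proof.
move=> Ex fmono fleft; apply/cvgrPdist_lt => e e0.
have [s0 [Es0 s0x fs0]] := fleft (e / 2) (divr_gt0 e0 (ltr0Sn _ 1)).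
(* For [s < s0] the clipped distance is at least [m], so once [t > 2 / m] the added term is at least
   [2 * t] and lifts [x - t] above [f x]. For [s >= s0] monotonicity gives [f s > f x - e / 2]. *)
pose m := Num.min 1 (x - s0).
have m0 : 0 < m by rewrite lt_min ltr01 subr_gt0.
near=> t.
have t1 : 1 < t by near: t; by apply: nbhs_pinfty_gt; exact: num_real.
have tf : `|x - f x| < t by near: t; by apply: nbhs_pinfty_gt; exact: num_real.
have tm : 2 / m < t by near: t; by apply: nbhs_pinfty_gt; exact: num_real.
have te : `|x| / (e / 2) < t by near: t; by apply: nbhs_pinfty_gt; exact: num_real.
have t0 : 0 < t by lra.
have xt : `|x / t| < e / 2.
  by rewrite normrM normfV (gtr0_norm t0) ltr_pdivrMr // mulrC -ltr_pdivrMr // divr_gt0.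
move: tf; rewrite ltr_norml => /andP[tf1 tf2].
have up : inf (penalties x t) <= f x.
  apply: le_trans (inf_penalties_le (ltW t0) (or_intror (ex_intro2 _ _ x Ex erefl))) _.
  rewrite penaltyE /bump subrr maxxx (min_idPr ler01) mulr0 addr0.
  by rewrite ge_min ge_max lexx /=; apply/orP; right; lra.
have lo : f x - e / 2 <= inf (penalties x t).
  apply: lb_le_inf; first by exists (x + t); left.
  move=> z [->|[s Es ->]]; first by lra.
  rewrite penaltyE le_min; apply/andP; split; first by lra.
  case: (leP s0 s) => ss0.
    apply: (@le_trans _ _ (f s)); first exact: le_trans (ltW fs0) (fmono _ _ Es0 Es ss0).
    apply: (@le_trans _ _ (Num.max (f s) (x - t))); first by rewrite le_max lexx.
    by rewrite lerDl mulr_ge0 // sqr_ge0.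
  apply: (@le_trans _ _ (x - t + t ^+ 2 * m)); last first.
    apply: lerD; first by rewrite le_max lexx orbT.
    rewrite ler_wpM2l ?sqr_ge0 // /bump /m.
    apply: le_trans (clip_lip (_ : x - s0 <= x - s)).1; last by lra.
    by rewrite le_min !ge_min !le_max !lexx !orbT.
  have : t * 2 <= t ^+ 2 * m.
    by rewrite expr2 -mulrA ler_pM2l // -ler_pdivrMr // ltW.
  lra.
move: xt; rewrite /envelope !ltr_norml => /andP[x1 x2]; apply/andP; split; lra.
Unshelve. all: by end_near. Qed.

End OneSide.

(** [w] in (0, 1) is the relative height. As [w] tends to 0, the first envelope runs to time
    infinity and tends to [f0], while the second stays at times near 1 and loses its weight; at
    [w = 1] the roles are exchanged. *)
Definition blend (E0 E1 : set R) (f0 f1 : R -> R) (x w : R) : R :=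
  (1 - w) * envelope E0 f0 x w^-1 + w * envelope E1 f1 x (1 - w)^-1.

Lemma blend_sym E0 E1 f0 f1 x w : blend E0 E1 f0 f1 x w = blend E1 E0 f1 f0 x (1 - w).
Proof. by rewrite /blend (_ : 1 - (1 - w) = w) 1?addrC //; ring. Qed.

Lemma blend_lt E0 E1 f0 f1 x y w : 0 < w < 1 -> x < y ->
  blend E0 E1 f0 f1 x w < blend E0 E1 f0 f1 y w.
Proof.
move=> /andP[w0 w1] xy; have w1' : 0 < 1 - w by rewrite subr_gt0.
by apply: ltrD; rewrite ltr_pM2l // envelope_lt // invr_gt0.
Qed.

Lemma blend_surj E0 E1 f0 f1 w z : 0 < w < 1 -> exists x, blend E0 E1 f0 f1 x w = z.
Proof.
move=> /andP[w0 w1]; have w1' : 0 < 1 - w by rewrite subr_gt0.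
have i0 : 0 < w^-1 by rewrite invr_gt0.
have i1 : 0 < (1 - w)^-1 by rewrite invr_gt0.
set b := blend E0 E1 f0 f1.
pose L := (1 - w) * (w^-1^-1 + 1 + w^-1 ^+ 2) + w * ((1 - w)^-1^-1 + 1 + (1 - w)^-1 ^+ 2).
have L0 : 0 < L.
  have h (t : R) : 0 < t -> 0 < t^-1 + 1 + t ^+ 2.
    by move=> t0; rewrite !addr_gt0 ?invr_gt0 ?exprn_gt0.
  by rewrite addr_gt0 // mulr_gt0 // h.
have lip x y : x <= y -> b x w <= b y w <= b x w + L * (y - x).
  move=> xy; apply/andP; split.
    move: xy; rewrite le_eqVlt => /orP[/eqP -> //|xy]; apply/ltW/blend_lt => //.
    by rewrite w0.
  have -> : b x w + L * (y - x) =
    (1 - w) * (envelope E0 f0 x w^-1 + (w^-1^-1 + 1 + w^-1 ^+ 2) * (y - x)) +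
    w * (envelope E1 f1 x (1 - w)^-1 + ((1 - w)^-1^-1 + 1 + (1 - w)^-1 ^+ 2) * (y - x)).
    by rewrite /b /blend /L; ring.
  by apply: lerD; (apply: ler_wpM2l; [exact: ltW|exact: envelope_lip]).
have cb : continuous (fun x => b x w).
  move=> x; apply/cvgrPdist_lt => e e0; near=> y.
  have d : `|x - y| < e / L.
    by near: y; apply: cvgr_dist_lt; (exact: cvg_id || exact: divr_gt0).
  rewrite ltr_pdivlMr // mulrC in d.
  case: (leP x y) => xy.
    have /andP[h1 h2] := lip x y xy.
    rewrite ler0_norm ?subr_le0 // in d; rewrite ler0_norm ?subr_le0 //; lra.
  have /andP[h1 h2] := lip y x (ltW xy).
  rewrite ger0_norm ?subr_ge0 ?ltW // in d; rewrite ger0_norm ?subr_ge0 //; lra.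
(* The weighted mean of the two truncation widths: the blend is at least [x - K] for [x >= 0] and at
   most [x + K] for [x <= 0], so it is unbounded in both directions. *)
pose K := (1 - w) * w^-1 + w * (1 - w)^-1.
have K0 : 0 <= K by rewrite addr_ge0 // mulr_ge0 // ltW.
have big x : 0 <= x -> x - K <= b x w.
  move=> x0; have -> : x - K = (1 - w) * (x - w^-1) + w * (x - (1 - w)^-1).
    by rewrite /K; ring.
  apply: lerD; (apply: ler_wpM2l; [exact: ltW|]);
    (apply: le_trans (envelope_ge _ _ _ _); last exact: ltW);
    by rewrite lerDr mulr_ge0 // invr_ge0 ltW.
have small x : x <= 0 -> b x w <= x + K.
  move=> x0; have -> : x + K = (1 - w) * (x + w^-1) + w * (x + (1 - w)^-1).
    by rewrite /K; ring.
  apply: lerD; (apply: ler_wpM2l; [exact: ltW|]);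
    (apply: le_trans (envelope_le _ _ _ _) _; first exact: ltW);
    by rewrite gerDr mulr_le0_ge0 // invr_ge0 ltW.
pose x1 := Num.min 0 (z - K); pose x2 := Num.max 0 (z + K).
have h1 : b x1 w <= z.
  apply: le_trans (small _ _) _; first by rewrite ge_min lexx.
  by rewrite -lerBrDr ge_min lexx orbT.
have h2 : z <= b x2 w.
  apply: le_trans (big _ _); last by rewrite le_max lexx.
  by rewrite lerBrDr le_max lexx orbT.
have x12 : x1 <= x2 by apply: (@le_trans _ _ 0); rewrite ?ge_min ?le_max lexx.
have [x _ bx] : exists2 x, x \in `[x1, x2] & b x w = z.
  apply: IVT => //; first exact: continuous_subspaceT.
  by rewrite ge_min h1 le_max h2 orbT.
by exists x.
Unshelve. all: by end_near. Qed.

Lemma blend_cvg E0 E1 f0 f1 x (w : R) : 0 < w < 1 ->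
  blend E0 E1 f0 f1 x w' @[w' --> w] --> blend E0 E1 f0 f1 x w.
Proof.
move=> /andP[w0 w1]; have w1' : 0 < 1 - w by rewrite subr_gt0.
have c1 : 1 - w' @[w' --> w] --> 1 - w by apply: cvgB; [exact: cvg_cst|exact: cvg_id].
apply: cvgD; apply: cvgM => //.
- apply: (cvg_comp (fun w' => w'^-1) (envelope E0 f0 x)); last first.
    by apply: envelope_cvg_t; rewrite invr_gt0.
  by apply: cvgV; [rewrite gt_eqF|exact: cvg_id].
- apply: (cvg_comp (fun w' => (1 - w')^-1) (envelope E1 f1 x)); last first.
    by apply: envelope_cvg_t; rewrite invr_gt0.
  by apply: cvgV => //; rewrite gt_eqF.
Qed.

Lemma blend_cvg0 E0 E1 f0 f1 x : E0 x ->
  (forall r s, E0 r -> E0 s -> r <= s -> f0 r <= f0 s) ->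
  (forall e, 0 < e -> exists s, [/\ E0 s, s < x & f0 x - e < f0 s]) ->
  blend E0 E1 f0 f1 x w @[w --> 0^'+] --> f0 x.
Proof.
move=> Ex fmono fleft.
have id0 : (w : R) @[w --> 0^'+] --> (0 : R) by exact: cvg_at_right_filter cvg_id.
have c1 : 1 - (w : R) @[w --> 0^'+] --> 1 - (0 : R).
  by apply: cvgB => //; exact: cvg_cst.
have -> : f0 x = (1 - 0) * f0 x + 0 * envelope E1 f1 x (1 - 0)^-1.
  by rewrite subr0 mul1r mul0r addr0.
apply: cvgD; apply: cvgM => //.
- apply: (cvg_comp (fun w => w^-1) (envelope E0 f0 x)); last exact: envelope_cvg_pinfty.
  apply/cvgryPgt => K; near=> w.
  have w0 : 0 < w by near: w; exact: nbhs_right_gt.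
  have K0 : 0 < `|K| + 1 by rewrite ltr_wpDl.
  have wK : w < (`|K| + 1)^-1 by near: w; apply: nbhs_right_lt; rewrite invr_gt0.
  apply: (@lt_le_trans _ _ (`|K| + 1)); first by rewrite (le_lt_trans (ler_norm K)) // ltrDl.
  by rewrite -[leLHS]invrK lef_pV2 ?posrE ?invr_gt0 // ltW.
- apply: (cvg_comp (fun w => (1 - w)^-1) (envelope E1 f1 x)); last first.
    by apply: envelope_cvg_t; rewrite invr_gt0 subr0.
  by apply: cvgV => //; rewrite subr0 oner_eq0.
Unshelve. all: by end_near. Qed.

End Envelope.

Lemma half_min (R : realType) (n e : R) : 0 < n -> 0 < e ->
  [/\ 0 < Num.min n e / 2, Num.min n e / 2 < n & Num.min n e / 2 < e].
Proof. by move=> n0 e0; case: (lerP n e) => ?; split; lra. Qed.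

(* A fiberwise monotone bijection of strips that is continuous along vertical
   lines is a homeomorphism: values at two nearby points of a row squeeze the
   values in between. *)
Section FiberedHomeo.
Variable R : realType.
Notation P2 := (R * R)%type.
Variables (S S' : set P2) (u v u' v' : R).
Hypotheses (hS : is_strip S u v) (hS' : is_strip S' u' v').
Variables (H : P2 -> P2) (d b c : R).
Hypothesis hd : d = 1 \/ d = -1.
Hypothesis c0 : c != 0.
Hypothesis HS : forall p, S p -> S' (H p).
Hypothesis H2 : forall p, S p -> (H p).2 = b + c * p.2.
Hypothesis Hrow : forall p r, S p -> S r -> p.2 = r.2 -> p.1 < r.1 ->
  0 < d * ((H r).1 - (H p).1).
Hypothesis Hsurj : forall p', S' p' -> exists2 p, S p & H p = p'.
Hypothesis Hvert : forall p, S p -> forall e, 0 < e -> exists2 t, 0 < t &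
  forall y, S (p.1, y) -> `|y - p.2| < t -> `|(H (p.1, y)).1 - (H p).1| < e.

Let K p := d * (H p).1.

Let K_lt p r : S p -> S r -> p.2 = r.2 -> p.1 < r.1 -> K p < K r.
Proof. by move=> Sp Sr e pr; rewrite -subr_gt0 -mulrBr Hrow. Qed.

Let lt_K p r : S p -> S r -> p.2 = r.2 -> K p < K r -> p.1 < r.1.
Proof.
move=> Sp Sr e; case: (ltgtP p.1 r.1) => // [/(K_lt Sr Sp (esym e)) h /(lt_trans h)|e1].
  by rewrite ltxx.
by rewrite [p]surjective_pairing [r]surjective_pairing e1 e ltxx.
Qed.

Let normd x : `|d * x| = `|x|.
Proof. by case: hd => ->; rewrite ?mul1r ?mulN1r ?normrN. Qed.

Let dd : d * d = 1.
Proof. by case: hd => ->; rewrite ?mulrNN mul1r. Qed.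

Lemma fibered_inj p r : S p -> S r -> H p = H r -> p = r.
Proof.
move=> Sp Sr e; have e2 : p.2 = r.2.
  by apply: (mulfI c0); apply: (addrI b); rewrite -!H2 // e.
rewrite [p]surjective_pairing [r]surjective_pairing e2.
case: (ltgtP p.1 r.1) => [h|h|->//].
  by have := K_lt Sp Sr e2 h; rewrite /K e ltxx.
by have := K_lt Sr Sp (esym e2) h; rewrite /K e ltxx.
Qed.

Let KvertP p : S p -> forall e, 0 < e -> exists2 t, 0 < t &
  forall y, u <= y <= v -> `|y - p.2| < t -> S (p.1, y) /\ `|K (p.1, y) - K p| < e.
Proof.
move=> Sp e e0; have [t t0 Ht] := Hvert Sp e0; have [s s0 Hs] := strip_open hS Sp.
exists (Num.min t s); first by rewrite lt_min t0.
move=> y yuv; rewrite lt_min => /andP[yt ys].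
have Sy : S (p.1, y) by apply: Hs => //; split; rewrite //= subrr normr0.
by split => //; rewrite -mulrBr normd Ht.
Qed.

Lemma fibered_cts : cts S H.
Proof.
apply/cts_near2 => p Sp e e0.
have [n n0 Hn] := strip_open hS' (HS Sp).
pose m := Num.min n e / 2.
have [m0 mn _] := half_min n0 e0; rewrite -/m in m0 mn.
have me : m * 2 <= e by rewrite divfK // ge_min lexx orbT.
have bp := strip_bounds hS' (HS Sp).
(* [S'] contains the points of the row of [H p] at distance [m] on either side; their preimages lie
   in the row of [p] and will bracket the nearby points. *)
have ex (z : R) : `|z| = m -> exists a : R, S (a, p.2) /\ K (a, p.2) = K p + z.
  move=> zm; have : S' ((H p).1 + d * z, (H p).2).
    by apply: Hn => //; split; rewrite /= ?subrr ?normr0 // addrC addKr normd zm.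
  move=> /Hsurj[[a y] Sa Ha]; exists a.
  have ey : y = p.2.
    apply: (mulfI c0); apply: (addrI b); rewrite -(H2 Sp) -(H2 (p := (a, y)) Sa) Ha //.
  rewrite -ey; split => //.
  by rewrite /K Ha /= mulrDr mulrA dd mul1r.
have [a [Sa Ka]] : exists a : R, S (a, p.2) /\ K (a, p.2) = K p - m.
  by apply: ex; rewrite normrN gtr0_norm.
have [a' [Sa' Ka']] : exists a : R, S (a, p.2) /\ K (a, p.2) = K p + m.
  by apply: ex; rewrite gtr0_norm.
have ap : a < p.1 by apply: (lt_K Sa Sp) => //; rewrite Ka; lra.
have pa : p.1 < a' by apply: (lt_K Sp Sa') => //; rewrite Ka'; lra.
have [t t0 Ht] := KvertP Sa m0; have [t' t0' Ht'] := KvertP Sa' m0.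
have ec : 0 < e / `|c| by rewrite divr_gt0 ?normr_gt0.
exists (Num.min (Num.min (p.1 - a) (a' - p.1)) (Num.min (Num.min t t') (e / `|c|))).
  by rewrite !lt_min !subr_gt0 ap pa t0 t0' ec.
move=> r Sr []; rewrite !lt_min => /andP[/andP[r1 r2] _] /andP[_ /andP[/andP[r3 r4] r5]].
have br := strip_bounds hS Sr.
have [Ta Ka2] := Ht r.2 br r3; have [Ta' Ka2'] := Ht' r.2 br r4.
move: r1 r2; rewrite !ltr_norml => /andP[r1 _] /andP[_ r2].
split.
  rewrite -normd mulrBr -/(K r) -/(K p).
  have k1 : K (a, r.2) < K r by apply: K_lt => //=; lra.
  have k2 : K r < K (a', r.2) by apply: K_lt => //=; lra.
  move: Ka2 Ka2'; rewrite Ka Ka' !ltr_norml => /andP[? ?] /andP[? ?]; lra.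
rewrite !H2 // (_ : _ - _ = c * (r.2 - p.2)); last by ring.
by rewrite normrM mulrC -ltr_pdivlMr ?normr_gt0.
Qed.

Lemma fibered_inv_cts (G : P2 -> P2) :
  (forall p', S' p' -> S (G p') /\ H (G p') = p') -> cts S' G.
Proof.
move=> hG; apply/cts_near2 => p' Sp' e e0.
have [Sp Hp] := hG _ Sp'; set p := G p' in Sp Hp *.
have [n n0 Hn] := strip_open hS Sp.
pose m := Num.min n e / 2.
have [m0 mn me] := half_min n0 e0; rewrite -/m in m0 mn me.
have bp := strip_bounds hS Sp.
have Sm (z : R) : `|z| = m -> S (p.1 + z, p.2).
  by move=> zm; apply: Hn => //; split; rewrite /= ?subrr ?normr0 // addrC addKr zm.
have S1 : S (p.1 - m, p.2) by apply: Sm; rewrite normrN gtr0_norm.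
have S2 : S (p.1 + m, p.2) by apply: Sm; rewrite gtr0_norm.
have K1 : K (p.1 - m, p.2) < K p by apply: K_lt => //=; lra.
have K2 : K p < K (p.1 + m, p.2) by apply: K_lt => //=; lra.
(* Half the smaller gap: moving the two bracketing points vertically and passing from [p] to [r]
   changes each value of [K] by less than [w], so the order survives. *)
pose w := Num.min (K p - K (p.1 - m, p.2)) (K (p.1 + m, p.2) - K p) / 2.
have w0 : 0 < w by rewrite divr_gt0 // lt_min !subr_gt0 K1.
have w1 : w * 2 <= K p - K (p.1 - m, p.2) by rewrite divfK // ge_min lexx.
have w2 : w * 2 <= K (p.1 + m, p.2) - K p by rewrite divfK // ge_min lexx orbT.
have [t t0 Ht] := KvertP S1 w0; have [t' t0' Ht'] := KvertP S2 w0.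
pose s := Num.min (Num.min t t') e.
have s0 : 0 < s by rewrite !lt_min t0 t0'.
exists (Num.min w (s * `|c|)); first by rewrite lt_min w0 mulr_gt0 // normr_gt0.
move=> r' Sr' []; rewrite !lt_min => /andP[h1 _] /andP[_ h2].
have [Sr Hr] := hG _ Sr'; set r := G r' in Sr Hr *.
have yr : `|r.2 - p.2| < s.
  move: h2; rewrite -Hr -Hp !H2 // (_ : _ - _ = c * (r.2 - p.2)); last by ring.
  by rewrite normrM mulrC ltr_pM2r // normr_gt0.
have kr : `|K r - K p| < w by rewrite -mulrBr normd Hr Hp.
have br := strip_bounds hS Sr.
have [||Ta Ka] := Ht r.2 => //; first by apply: lt_le_trans yr _; rewrite !ge_min lexx.
have [||Ta' Ka'] := Ht' r.2 => //; first by apply: lt_le_trans yr _; rewrite !ge_min lexx orbT.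
rewrite /= in Ta Ta' Ka Ka'.
have l1 : p.1 - m < r.1.
  apply: (lt_K Ta Sr) => //; move: Ka kr; rewrite !ltr_norml => /andP[? ?] /andP[? ?]; lra.
have l2 : r.1 < p.1 + m.
  apply: (lt_K Sr Ta') => //; move: Ka' kr; rewrite !ltr_norml => /andP[? ?] /andP[? ?]; lra.
split; last by apply: lt_le_trans yr _; rewrite !ge_min lexx !orbT.
by rewrite ltr_norml; apply/andP; split; lra.
Qed.

End FiberedHomeo.

(** * Filling a strip between prescribed boundary maps *)

Section StripExtension.
Variable R : realType.
Notation P2 := (R * R)%type.
Variables (S S' : set P2) (u v u' v' : R).
Hypotheses (hS : is_strip S u v) (hS' : is_strip S' u' v').
Variables (d e : R).
Hypotheses (hd : d = 1 \/ d = -1) (he : e = 1 \/ e = -1).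
Variable bd : P2 -> P2.

(** Affine and centered at the midpoints, so that one formula serves both signs [e]. *)
Definition level_map (y : R) : R :=
  (u' + v') / 2 + e * ((v' - u') / (v - u)) * (y - (u + v) / 2).

Let uv : u < v. Proof. by case: hS. Qed.
Let uv' : u' < v'. Proof. by case: hS'. Qed.
Let slope_gt0 : 0 < (v' - u') / (v - u).
Proof. by rewrite divr_gt0 // subr_gt0. Qed.

Lemma level_map_affine y : level_map y =
  ((u' + v') / 2 - e * ((v' - u') / (v - u)) * ((u + v) / 2))
   + e * ((v' - u') / (v - u)) * y.
Proof. by rewrite /level_map; ring. Qed.

Lemma slope_neq0 : e * ((v' - u') / (v - u)) != 0.
Proof. by apply: mulf_neq0; [case: he => ->; rewrite ?oppr_eq0 oner_eq0|rewrite gt_eqF]. Qed.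

Lemma level_map_lt y z : y < z -> 0 < e * (level_map z - level_map y).
Proof.
move=> yz; rewrite (_ : e * _ = (e * e) * ((v' - u') / (v - u)) * (z - y)).
  by rewrite mulr_gt0 ?subr_gt0 //; case: he => ->; rewrite ?mulrNN !mul1r.
by rewrite /level_map; ring.
Qed.

Lemma level_map_ends : (e = 1 /\ level_map u = u' /\ level_map v = v') \/
  (e = -1 /\ level_map u = v' /\ level_map v = u').
Proof.
have n0 : v - u != 0 by rewrite gt_eqF // subr_gt0.
rewrite /level_map; case: he => ->; [left|right]; split => //; split; field.
all: by rewrite ?n0.
Qed.

Lemma level_map_inner y : (u' < level_map y < v') = (u < y < v).
Proof.
have main a b : (a < b) = (0 < e * (level_map b - level_map a)).
  case: (ltgtP a b) => [/level_map_lt -> //|/level_map_lt h|->].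
    by rewrite -opprB mulrN oppr_gt0 ltNge (ltW h).
  by rewrite subrr mulr0 ltxx.
rewrite (main u y) (main y v); case: level_map_ends => -[-> [-> ->]].
  by rewrite !mul1r !subr_gt0.
by rewrite !mulN1r !opprB !subr_gt0 andbC.
Qed.

Lemma level_map_surj y' : exists y, level_map y = y'.
Proof.
exists ((u + v) / 2 + (e * ((v' - u') / (v - u)))^-1 * (y' - (u' + v') / 2)).
by have := slope_neq0; rewrite /level_map; move: (e * _) => k k0; field.
Qed.

Hypothesis bd_bdry : forall p, bdry S u v p -> S' (bd p) /\ (bd p).2 = level_map p.2.
Hypothesis bd_row : forall p r, bdry S u v p -> bdry S u v r -> p.2 = r.2 -> p.1 < r.1 ->
  0 < d * ((bd r).1 - (bd p).1).
Hypothesis bd_surj : forall p', bdry S' u' v' p' -> exists2 p, bdry S u v p & bd p = p'.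

Let w (y : R) := (y - u) / (v - u).
Let edge (y : R) : set R := [set x | S (x, y)].
Let edge_map (y x : R) : R := d * (bd (x, y)).1.
Let alpha x y := blend (edge u) (edge v) (edge_map u) (edge_map v) x (w y).

(** The boundary values enter the blend as [d * bd], which is increasing on each side, and the
    result is multiplied by [d] again. *)
Definition strip_extension (p : P2) : P2 :=
  if u < p.2 < v then (d * alpha p.1 p.2, level_map p.2) else bd p.

Let ext := strip_extension.

Lemma strip_extension_inner p : u < p.2 < v ->
  ext p = (d * alpha p.1 p.2, level_map p.2).
Proof. by rewrite /ext /strip_extension => ->. Qed.

Lemma strip_extension_bdry p : bdry S u v p -> ext p = bd p.
Proof. by rewrite /ext /strip_extension; case: ifP => // ip /bdry_not_interior; case. Qed.

Let w01 y : u < y < v -> 0 < w y < 1.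
Proof.
move=> /andP[h1 h2]; have k : 0 < v - u by rewrite subr_gt0.
by rewrite /w divr_gt0 ?subr_gt0 //= ltr_pdivrMr // mul1r; lra.
Qed.

Let dd : d * d = 1.
Proof. by case: hd => ->; rewrite ?mulrNN mul1r. Qed.

Lemma strip_extension_St p : S p -> S' (ext p).
Proof.
move=> Sp; have [bp|ip] := bdry_or_interior hS Sp.
  by rewrite strip_extension_bdry //; case: (bd_bdry bp).
by rewrite strip_extension_inner //; apply: (strip_interior hS'); rewrite /= level_map_inner.
Qed.

Lemma strip_extension_level p : S p -> (ext p).2 = level_map p.2.
Proof.
move=> Sp; have [bp|ip] := bdry_or_interior hS Sp.
  by rewrite strip_extension_bdry //; case: (bd_bdry bp).
by rewrite strip_extension_inner.
Qed.

Lemma strip_extension_row p r : S p -> S r -> p.2 = r.2 -> p.1 < r.1 ->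
  0 < d * ((ext r).1 - (ext p).1).
Proof.
move=> Sp Sr e2 pr; have [bp|ip] := bdry_or_interior hS Sp.
  have br : bdry S u v r.
    by move/bdryP: bp => [_ lp]; apply/bdryP; rewrite -e2.
  by rewrite !strip_extension_bdry // bd_row.
have ir : u < r.2 < v by rewrite -e2.
rewrite !strip_extension_inner //= -mulrBr mulrA dd mul1r subr_gt0 /alpha e2.
by apply: blend_lt => //; exact: w01.
Qed.

Lemma strip_extension_surj p' : S' p' -> exists2 p, S p & ext p = p'.
Proof.
move=> Sp'; have [bp'|ip'] := bdry_or_interior hS' Sp'.
  have [p bp <-] := bd_surj bp'; exists p; first by case/bdryP: bp.
  by rewrite strip_extension_bdry.
have [y ey] := level_map_surj p'.2.
have iy : u < y < v by rewrite -level_map_inner ey.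
have [x ex] := blend_surj (edge u) (edge v) (edge_map u) (edge_map v) (d * p'.1) (w01 iy).
exists (x, y); first exact: (strip_interior hS).
rewrite strip_extension_inner //= /alpha ex mulrA dd mul1r ey.
by rewrite -surjective_pairing.
Qed.

Let edge_map_mono c : c = u \/ c = v -> forall r s, edge c r -> edge c s -> r <= s ->
  edge_map c r <= edge_map c s.
Proof.
move=> hc r s Er Es; rewrite le_eqVlt => /orP[/eqP -> //|rs].
rewrite -subr_ge0 -mulrBr ltW // bd_row //; apply/bdryP; split => //=.
Qed.

(** Approximation from the left comes from surjectivity: [S'] is open along its boundary lines, and
    a point slightly before [bd (x, c)] in the direction of [d] has a preimage, which is the
    required [s]. *)
Let edge_map_left c x : c = u \/ c = v -> edge c x -> forall z, 0 < z ->
  exists s, [/\ edge c s, s < x & edge_map c x - z < edge_map c s].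
Proof.
move=> hc Ex z z0; have bx : bdry S u v (x, c) by apply/bdryP.
have [Sb lb] := bd_bdry bx.
have [n n0 Hn] := strip_open hS' Sb.
pose m := Num.min n z / 2.
have [m0 mn mz] := half_min n0 z0; rewrite -/m in m0 mn mz.
have Sm : S' ((bd (x, c)).1 - d * m, (bd (x, c)).2).
  apply: Hn; first exact: (strip_bounds hS' Sb).
  split; rewrite /= ?subrr ?normr0 // addrC addKr normrN normrM (gtr0_norm m0).
  by case: hd => ->; rewrite ?normrN normr1 mul1r.
have bm : bdry S' u' v' ((bd (x, c)).1 - d * m, (bd (x, c)).2).
  apply/bdryP; split => //=; rewrite lb /=.
  by case: hc => ->; case: level_map_ends => -[_ [h1 h2]]; rewrite ?h1 ?h2; auto.
have [[s c'] bs es] := bd_surj bm.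
have [Ss ls] := bd_bdry bs.
have ec : c' = c.
  have : level_map c' = level_map c by rewrite -[level_map c]lb -[level_map c']ls es.
  by rewrite !level_map_affine => /addrI /(mulfI slope_neq0).
subst c'; have Es : edge c s by case/bdryP: bs.
exists s; have k : edge_map c s = edge_map c x - m.
  by rewrite /edge_map es /= mulrBr mulrA dd mul1r.
split => //; last by rewrite k; lra.
rewrite ltNge; apply/negP => /(edge_map_mono hc Ex Es); rewrite k; lra.
Qed.

Lemma strip_extension_vert p : S p -> forall z, 0 < z -> exists2 t, 0 < t &
  forall y, S (p.1, y) -> `|y - p.2| < t -> `|(ext (p.1, y)).1 - (ext p).1| < z.
Proof.
have k0 : 0 < v - u by rewrite subr_gt0.
have normd x : `|d * x| = `|x| by case: hd => ->; rewrite ?mul1r ?mulN1r ?normrN.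
case: p => x y0 Sp z z0 /=.
have wd y1 y2 : w y1 - w y2 = (y1 - y2) / (v - u) by rewrite /w -mulrBl; congr (_ / _); ring.
have [bp|ip] := bdry_or_interior hS Sp; last first.
  have /cvgrPdist_lt/(_ z z0)/nbhs_ballP[s /= s0 Hs] :=
    @blend_cvg R (edge u) (edge v) (edge_map u) (edge_map v) x _ (w01 ip).
  have /andP[iu iv] := ip; rewrite /= in iu iv.
  exists (Num.min (s * (v - u)) (Num.min (y0 - u) (v - y0))).
    by rewrite !lt_min mulr_gt0 // !subr_gt0 iu.
  move=> y Sy; rewrite !lt_min => /andP[h1 /andP[h2 h3]].
  have iy : u < y < v by move: h2 h3; rewrite !ltr_norml => /andP[? ?] /andP[? ?]; lra.
  rewrite !strip_extension_inner //= -mulrBr normd distrC; apply: Hs.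
  rewrite /ball /= distrC wd normrM normfV (gtr0_norm k0) ltr_pdivrMr //.
(* [g] is the blend with the side at height [c] listed first, as a function of the relative distance
   from that side; thus [blend_cvg0] serves both sides, the upper one by way of [blend_sym]. *)
have main c c' (g : R -> R -> R) : (c = u \/ c = v) -> edge c x -> 
    (forall y, u < y < v -> alpha x y = g x (`|y - c| / (v - u))) ->
    g x t @[t --> 0^'+] --> edge_map c x -> y0 = c -> c' = u + v - c ->
    exists2 t, 0 < t & forall y, S (x, y) -> `|y - y0| < t ->
      `|(ext (x, y)).1 - (ext (x, y0)).1| < z.
  move=> hc Ex ag /cvgrPdist_lt/(_ z z0) [s /= s0 Hs] -> _.
  exists (Num.min (s * (v - u)) (v - u)); first by rewrite lt_min mulr_gt0.
  move=> y Sy; rewrite lt_min => /andP[h1 h2].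
  have bc : bdry S u v (x, c) by apply/bdryP.
  have [by_|iy] := bdry_or_interior hS Sy.
    have -> : y = c.
      by case/bdryP: by_ => _ /= ly; case: hc => hc; case: ly => ly; rewrite hc ly // in h2 *;
         move: h2; rewrite ltr_norml; lra.
    by rewrite subrr normr0.
  rewrite /= in iy; rewrite strip_extension_inner // strip_extension_bdry //= ag //.
  rewrite -normd mulrBr mulrA dd mul1r -/(edge_map c x) distrC; apply: Hs.
    rewrite /ball /= sub0r normrN normrM normfV normr_id (gtr0_norm k0) ltr_pdivrMr //.
  rewrite divr_gt0 // normr_gt0 subr_eq0; apply/eqP => yc.
  by case: hc => hc; move: iy; rewrite yc hc ltxx ?andbF.
case/bdryP: (bp) => _ /= -[ey|ey].
  apply: (main u v (blend (edge u) (edge v) (edge_map u) (edge_map v))) => //; try by [left].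
  - by rewrite -ey.
  - by move=> y /andP[h1 h2]; rewrite ger0_norm ?subr_ge0 // ltW.
  - apply: blend_cvg0; [by rewrite -ey|apply: edge_map_mono; auto|].
    by apply: edge_map_left; [left|rewrite -ey].
  - by ring.
apply: (main v u (blend (edge v) (edge u) (edge_map v) (edge_map u))) => //; try by [right].
- by rewrite -ey.
- move=> y /andP[h1 h2]; rewrite /alpha blend_sym; congr blend.
  rewrite ler0_norm ?subr_le0 ?(ltW h2) // /w; field; by rewrite gt_eqF.
- apply: blend_cvg0; [by rewrite -ey|apply: edge_map_mono; auto|].
  by apply: edge_map_left; [right|rewrite -ey].
- by ring.
Qed.

Lemma strip_extension_cts : cts S ext.
Proof.
apply: (fibered_cts hS hS' hd slope_neq0 strip_extension_St _ strip_extension_row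
  strip_extension_surj strip_extension_vert) => p Sp.
by rewrite strip_extension_level // level_map_affine.
Qed.

Lemma strip_extension_inj p r : S p -> S r -> ext p = ext r -> p = r.
Proof.
apply: (fibered_inj slope_neq0 _ strip_extension_row) => q Sq.
by rewrite strip_extension_level // level_map_affine.
Qed.

Lemma strip_extension_inv_cts (G : P2 -> P2) :
  (forall p', S' p' -> S (G p') /\ ext (G p') = p') -> cts S' G.
Proof.
move=> hG; apply: (fibered_inv_cts hS hd slope_neq0 _ strip_extension_row strip_extension_vert hG) => p Sp.
by rewrite strip_extension_level // level_map_affine.
Qed.

End StripExtension.

(** * Graph isomorphisms are induced by equivalences *)

Section IntervalChart.
Variable R : realType.
Implicit Types (I : set R) (x y z : R).

(** The correction [u] makes [x + u x] unbounded toward the right end: 0 if [I] is unbounded above,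
    the reciprocal distance to [sup I] otherwise. *)
Lemma right_chart I x0 : I x0 -> (forall x, I x -> exists2 y, I y & x < y) ->
  exists u : R -> R, [/\ forall x y, I x -> I y -> x <= y -> u x <= u y,
    forall z, exists x, [/\ I x, x0 <= x & z <= x + u x] &
    forall x, I x -> {for x, continuous u}].
Proof.
move=> I0 oI; have [bI|nbI] := pselect (has_ubound I); last first.
  exists (fun=> 0); split => // [z|x _]; last exact: cvg_cst.
  apply: contrapT => H; apply: nbI; exists (Num.max x0 z) => x Ix.
  rewrite leNgt; apply/negP; rewrite gt_max => /andP[h1 h2].
  by apply: H; exists x; rewrite addr0; split => //; exact: ltW.
have sI : has_sup I by split => //; exists x0.
have ltI x : I x -> x < sup I.
  move=> /oI[y Iy xy]; apply: lt_le_trans xy _; exact: ub_le_sup.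
exists (fun x => (sup I - x)^-1); split.
- move=> x y Ix Iy xy; have := ltI _ Ix; have := ltI _ Iy => h1 h2.
  by rewrite lef_pV2 ?posrE ?subr_gt0 // lerD2l lerN2.
- move=> z; pose K := `|z - x0| + 1.
  have K0 : 0 < K by rewrite ltr_wpDl.
  have iK : 0 < K^-1 by rewrite invr_gt0.
  have [y Iy hy] := sup_adherent iK sI.
  pose x := Num.max x0 y.
  have Ix : I x by rewrite /x; case: leP.
  have xK : sup I - x < K^-1.
    have : y <= x by rewrite /x le_max lexx orbT.
    move=> h; lra.
  exists x; split => //; first by rewrite /x le_max lexx.
  have h1 : K <= (sup I - x)^-1.
    by rewrite -[K]invrK lef_pV2 ?posrE ?subr_gt0 ?ltI // ltW.
  have h2 : x0 <= x by rewrite /x le_max lexx.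
  have h3 := ler_norm (z - x0); rewrite /K in h1; lra.
- move=> x Ix; apply: cvgV; first by rewrite subr_eq0 gt_eqF // ltI.
  by apply: cvgB; [exact: cvg_cst|exact: cvg_id].
Qed.

(** Corrections at both ends, the left one obtained by reflection, turn the identity into an
    increasing map onto the line. *)
Lemma interval_chart I : I !=set0 -> is_interval I ->
  (forall x, I x -> exists y z, [/\ I y, I z, y < x & x < z]) ->
  exists f : R -> R, (forall x y, I x -> I y -> x < y -> f x < f y) /\
    (forall z, exists2 x, I x & f x = z).
Proof.
move=> [x0 I0] iI oI; pose J := [set x | I (- x)].
have [u [u1 u2 u3]] : exists u : R -> R, [/\ forall x y, I x -> I y -> x <= y -> u x <= u y,
    forall z, exists x, [/\ I x, x0 <= x & z <= x + u x] &
    forall x, I x -> {for x, continuous u}].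
  by apply: right_chart => // x /oI[y [z [_ ? _ ?]]]; exists z.
have [w [w1 w2 w3]] : exists u : R -> R, [/\ forall x y, J x -> J y -> x <= y -> u x <= u y,
    forall z, exists x, [/\ J x, - x0 <= x & z <= x + u x] &
    forall x, J x -> {for x, continuous u}].
  apply: right_chart; first by rewrite /J /= opprK.
  move=> x /oI[y [z [? _ ? _]]]; exists (- y); first by rewrite /J /= opprK.
  by rewrite ltrNr.
have JI x : I x -> J (- x) by rewrite /J /= opprK.
pose f x := x + u x - w (- x).
have fmono x y : I x -> I y -> x < y -> f x < f y.
  move=> Ix Iy xy; have h1 := u1 _ _ Ix Iy (ltW xy).
  have h2 : w (- y) <= w (- x) by apply: w1; [exact: JI|exact: JI|rewrite lerN2 ltW].
  rewrite /f; lra.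
exists f; split => // z.
have [x2 [Ix2 x02 zx2]] := u2 (z + w (- x0)).
have [x1 [Jx1 x01 zx1]] := w2 (u x0 - z).
have Ix1 : I (- x1) by [].
have h2 : z <= f x2.
  have : w (- x2) <= w (- x0) by apply: w1; [exact: JI|exact: JI|rewrite lerN2].
  rewrite /f; lra.
have x1x0 : - x1 <= x0 by lra.
have h1 : f (- x1) <= z.
  have := u1 _ _ Ix1 I0 x1x0; rewrite /f opprK; lra.
have x12 : - x1 <= x2 by lra.
have sub x : x \in `[- x1, x2] -> I x.
  by rewrite in_itv /= => h; exact: iI _ _ Ix1 Ix2 _ h.
have [x xin fx] : exists2 x, x \in `[- x1, x2] & f x = z.
  apply: IVT => //; last by rewrite ge_min h1 le_max h2 orbT.
  apply: continuous_in_subspaceT => x /set_mem /= xin.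
  have Ix : I x by apply: sub.
  apply: cvgB; first by apply: cvgD; [exact: cvg_id|exact: u3].
  apply: (cvg_comp -%R w); first by apply: cvgN; exact: cvg_id.
  by apply: w3; exact: JI.
by exists x => //; exact: sub.
Qed.

End IntervalChart.

(** * Compatible monotone bijections of boundary intervals *)

Section EdgeMaps.
Variables (R : realType) (A A' : atlas_data R).
Notation P2 := (R * R)%type.
Hypotheses (hA : is_striped_atlas A) (hA' : is_striped_atlas A').

Lemma halfedge_chart (B : atlas_data R) (hB : is_striped_atlas B) l X :
  halfedge B (l, X) -> exists f : R -> R,
  (forall p r, X p -> X r -> Num.sg (f r.1 - f p.1) = Num.sg (r.1 - p.1)) /\
  (forall z, exists2 p, X p & f p.1 = z).
Proof.
move=> bX; have hl := atlas_strip hB l; have hX := halfedge_boundary bX.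
have [c _ lX] := boundary_interval_level hl hX.
have XE p : X p -> X (p.1, c) by move=> Xp; rewrite -(lX _ Xp) -surjective_pairing.
have [|||f [f1 f2]] := @interval_chart R [set x | X (x, c)].
- by have [p /XE] := boundary_interval_neq0 hX; exists p.1.
- move=> x y /= Xx Xy z xyz.
  by have := boundary_interval_convex (x := z) hl hX Xx Xy xyz.
- move=> x /= Xx; have [e e0 He] := boundary_interval_open hl hX Xx.
  exists (x - e / 2), (x + e / 2); split; try lra; apply: He => /=.
    by rewrite addrC addKr normrN gtr0_norm; lra.
  by rewrite addrC addKr gtr0_norm; lra.
exists f; split=> [p r Xp Xr|z]; last by have [x Xx <-] := f2 z; exists (x, c).
rewrite -[RHS]mul1r; apply: sg_strict => [|h|h|->//]; first by left.
  by rewrite mul1r subr_gt0; apply: f1 => //; exact: XE.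
by rewrite mul1r subr_gt0; apply: f1 => //; exact: XE.
Qed.

Variables (nu : Lam A -> Lam A') (eta : Lam A * set P2 -> Lam A' * set P2).
Variables (delta tau : Lam A -> int).
Hypothesis hG : graph_iso A A' nu eta delta tau.

Lemma iso_signs l : sign (delta l) /\ sign (tau l).
Proof. by case: hG => -[_ _ h _]; exact: h. Qed.

Lemma iso_inj H K : halfedge A H -> halfedge A K -> eta H = eta K -> H = K.
Proof.
case: hG => -[_ [_ i _] _] _ bH bK; apply: i; exact: mem_set.
Qed.

Lemma iso_halfedge H : halfedge A H -> halfedge A' (eta H).
Proof. by case: hG => -[_ [f _ _] _] _ bH; exact: f. Qed.

Lemma halfedge_side (B : atlas_data R) (hB : is_striped_atlas B) l X :
  halfedge B (l, X) -> exists2 s, sign s & dside B s l X.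
Proof.
move=> bX; have [c hc lX] := boundary_interval_level (atlas_strip hB l) (halfedge_boundary bX).
case: hc => ec; [exists (-1)|exists 1]; try (by [left|right]); split => // p Xp /=;
  by rewrite (lX _ Xp).
Qed.

Lemma iso_side s l X : sign s -> dside A s l X ->
  exists2 X', eta (l, X) = (nu l, X') & dside A' (tau l * s) (nu l) X'.
Proof.
case: hG => _ [h _ _] hs dX; have [e _] := h l s hs.
have : [set eta (l, X) | X in dside A s l] (eta (l, X)) by exists X.
by rewrite e => -[X' dX' <-]; exists X'.
Qed.

Lemma iso_side_inv s l X' : sign s -> dside A' (tau l * s) (nu l) X' ->
  exists2 X, dside A s l X & eta (l, X) = (nu l, X').
Proof.
case: hG => _ [h _ _] hs dX; have [e _] := h l s hs.
have : [set (nu l, X') | X' in dside A' (tau l * s) (nu l)] (nu l, X') by exists X'.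
by rewrite -e => -[X dX' eX]; exists X.
Qed.

Lemma iso_nu l X : halfedge A (l, X) -> eta (l, X) = (nu l, (eta (l, X)).2).
Proof. by move=> /(halfedge_side hA)[s hs] /(iso_side hs)[X' -> _]. Qed.

Lemma iso_glu H K : glu H K -> glu (eta H) (eta K).
Proof.
case: hG => _ [_ h _] g; have bH := glu_halfedge hA g; have bK := glu_halfedge hA (glu_sym g).
have /h : xi_rel A H K by apply/xi_relP; left.
move=> /(_ bH)/xi_relP[//|[_ _ /(iso_inj bK bH) e]].
by case: (glu_neq hA g).
Qed.

(** Condition (b) speaks forward: [H] has some partner under [xi_rel], its image is a partner of
    [eta H], and glued partners are unique. *)
Lemma iso_glu_inv H K : halfedge A H -> halfedge A K -> glu (eta H) (eta K) -> glu H K.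
Proof.
case: hG => _ [_ h _] bH bK g; have [K0 x0] := xi_rel_ex bH.
have /xi_relP[g'|[_ n _]] := h _ _ bH x0; last by case: (n _ g).
have e := glu_fun hA' g g'.
case/xi_relP: x0 => [g0|[_ _ e0]].
  by rewrite (iso_inj bK (glu_halfedge hA (glu_sym g0)) e).
by case: (glu_neq hA' g'); rewrite e0.
Qed.

Lemma iso_sigma l X m Y (s s' : R) : glu (l, X) (m, Y) -> gsgn (l, X) (m, Y) s ->
  gsgn (eta (l, X)) (eta (m, Y)) s' -> (delta l)%:~R * s = s' * (delta m)%:~R.
Proof.
case: hG => _ [_ _ h] g hs hs'; have g' := iso_glu g.
have [t ht] := glu_sigma g; have [t' ht'] := glu_sigma g'.
have [_ _ Ht] := sigma_gsgn hA ht; have [_ _ Ht'] := sigma_gsgn hA' ht'.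
have bX := glu_halfedge hA g; have bY := glu_halfedge hA (glu_sym g).
have x0 : xi_rel A (l, X) (m, Y) by apply/xi_relP; left.
have e := h l m X Y t t' bX bY x0 (glu_neq hA g) ht ht'.
rewrite (gsgn_uniq hA g hs Ht).
have -> : s' = t'%:~R.
  move: g' hs' Ht'; rewrite (iso_nu bX) (iso_nu bY) => g' hs' Ht'.
  exact: (gsgn_uniq hA' g' hs' Ht').
by rewrite -!intrM e.
Qed.

Definition edge_map (H : Lam A * set P2) (f : P2 -> P2) := [/\
  forall p, H.2 p -> (eta H).2 (f p),
  forall p', (eta H).2 p' -> exists2 p, H.2 p & f p = p' &
  forall p r, H.2 p -> H.2 r ->
    Num.sg ((f r).1 - (f p).1) = (delta H.1)%:~R * Num.sg (r.1 - p.1)].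

(** Multiplication by [delta] on the line, conjugated by increasing charts of the two intervals. *)
Lemma edge_map_ex H : halfedge A H -> exists f, edge_map H f.
Proof.
case: H => l X bX; have bX' := iso_halfedge bX; have eX := iso_nu bX.
set X' := (eta (l, X)).2 in eX; rewrite eX in bX'.
have [f [f1 f2]] := halfedge_chart hA bX.
have [f' [f1' f2']] := halfedge_chart hA' bX'.
have [k hk] : {k : R -> P2 & forall z, X' (k z) /\ f' (k z).1 = z}.
  by apply: (@choice _ _ (fun z p => X' p /\ f' p.1 = z)) => z; have [p ? ?] := f2' z; exists p.
have [hd _] := iso_signs l; have hdR := signP R hd.
have dd : (delta l)%:~R * (delta l)%:~R = 1 :> R by rewrite -intrM sign_sq.
exists (fun p => k ((delta l)%:~R * f p.1)); split; rewrite ?eX /=.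
- by move=> p Xp; case: (hk ((delta l)%:~R * f p.1)).
- move=> p' Xp'; have [p Xp ep] := f2 ((delta l)%:~R * f' p'.1); exists p => //.
  rewrite ep mulrA dd mul1r; have [Xk ek] := hk (f' p'.1).
  apply: (level_inj hA' bX') => //; apply/eqP; rewrite -subr_eq0 -sgr_eq0.
  by rewrite -(f1' _ _ Xp' Xk) ek subrr sgr0.
- move=> p r Xp Xr; have [X1 e1] := hk ((delta l)%:~R * f p.1).
  have [X2 e2] := hk ((delta l)%:~R * f r.1).
  rewrite -(f1' _ _ X1 X2) e1 e2 -mulrBr sgrM f1 //; congr (_ * _).
  by case: hdR => ->; rewrite ?sgrN sgr1.
Qed.

Definition edge_compat (H K : Lam A * set P2) (f f' : P2 -> P2) :=
  forall x y, H.2 x -> K.2 y -> q A H.1 x = q A K.1 y ->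
    q A' (eta H).1 (f x) = q A' (eta K).1 (f' y).

(** Conjugating [f] by the two gluing maps produces the sign [s' * delta l * s], which condition (c)
    makes equal to [delta m]. *)
Lemma edge_map_transport H K f : glu H K -> edge_map H f ->
  exists2 f', edge_map K f' & edge_compat H K f f'.
Proof.
case: H K => l X [m Y] g [f1 f2 f3].
have bX := glu_halfedge hA g; have bY := glu_halfedge hA (glu_sym g).
have g' := iso_glu g; have eX := iso_nu bX; have eY := iso_nu bY.
have [s [hs Hs]] := glu_gsgn hA g.
rewrite eX eY in g'; have [s' [hs' Hs']] := glu_gsgn hA' g'.
have sig : (delta l)%:~R * s = s' * (delta m)%:~R.
  by apply: iso_sigma g Hs _; rewrite eX eY.
have [t [_ tP]] := glu_map hA (glu_sym g).
have [t' [_ tP']] := glu_map hA' g'.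
rewrite /= in f1 f2 f3.
have ft y : Y y -> (eta (l, X)).2 (f (t y)) by move=> /tP[Xt _]; exact: f1.
have tx x y : X x -> Y y -> q A l x = q A m y -> t y = x.
  by move=> Xx Yy e; have [Xt qt] := tP _ Yy; apply: (glu_inj hA g) => //; rewrite qt.
exists (t' \o (f \o t)); first split => /=.
- by move=> y /ft/tP'[].
- move=> p' Yp'; have [p'' Xp'' e''] := glu_partner hA' (glu_sym g') Yp'.
  have [x Xx ex] := f2 _ Xp''; have [y Yy ey] := glu_partner hA g Xx.
  exists y => //; rewrite (tx _ _ Xx Yy (esym ey)) ex.
  have [Y1 q1] := tP' _ Xp''.
  by apply: (glu_inj hA' (glu_sym g')) => //; rewrite q1.
- move=> p r Yp Yr; have [Y1 q1] := tP' _ (ft _ Yp); have [Y2 q2] := tP' _ (ft _ Yr).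
  have [X1 e1] := tP _ Yp; have [X2 e2] := tP _ Yr.
  rewrite (Hs' (f (t p)) (f (t r))) ?f3 //; try exact: ft.
  rewrite (gsgn_sym hs Hs (x1 := p) (x2 := r)) // !mulrA -(mulrA s') sig mulrA.
  have -> : s' * s' = 1 by case: hs' => ->; rewrite ?mulrNN mul1r.
  by rewrite mul1r.
- move=> x y /= Xx Yy e; have [Y1 q1] := tP' _ (ft _ Yy).
  by rewrite eX eY /= q1 (tx _ _ Xx Yy e).
Qed.

(** [B] is chosen freely and redefined on the half-edges [Yg A g] only. Each of these comes from a
    single [g] and none is an [Xg A g'], so the redefinitions do not interfere. *)
Lemma edge_maps : exists F : Lam A * set P2 -> P2 -> P2,
  (forall H, halfedge A H -> edge_map H (F H)) /\
  (forall H K, glu H K -> edge_compat H K (F H) (F K)).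
Proof.
have [B HB] : {B : Lam A * set P2 -> P2 -> P2 &
    forall H, halfedge A H -> edge_map H (B H)}.
  apply: (@choice _ _ (fun H f => halfedge A H -> edge_map H f)) => H.
  have [/edge_map_ex[f hf]|n] := pselect (halfedge A H); first by exists f.
  by exists id.
have [_ [[_ Yinj XY] _ _ _]] := hA.
have [F HF] : {F : Lam A * set P2 -> P2 -> P2 &
    forall H, [/\ halfedge A H -> edge_map H (F H),
      forall g, H = Yg A g -> edge_compat (Xg A g) H (B (Xg A g)) (F H) &
      (forall g, H <> Yg A g) -> F H = B H]}.
  apply: (@choice _ _ (fun H f => [/\ halfedge A H -> edge_map H f,
      forall g, H = Yg A g -> edge_compat (Xg A g) H (B (Xg A g)) f &
      (forall g, H <> Yg A g) -> f = B H])) => H.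
  have [[g eH]|n] := pselect (exists g, H = Yg A g).
    have gl : glu (Xg A g) H by exists g; left.
    have [f' h1 h2] := edge_map_transport gl (HB _ (glu_halfedge hA gl)).
    exists f'; split => // [g' eH'|/(_ g)//].
    by rewrite -(Yinj g g') // -eH -eH'.
  exists (B H); split => // [|g eH]; first exact: HB.
  by case: n; exists g.
exists F; split=> [H bH|H K [g [[eH eK]|[eH eK]]]]; first by case: (HF H) => h _ _; exact: h.
  have [_ h _] := HF K; have [_ _ hX] := HF H.
  by rewrite hX; [rewrite eH; exact: h|move=> g'; rewrite eH; exact: XY].
have [_ h _] := HF H; have [_ _ hX] := HF K.
rewrite hX; last by move=> g'; rewrite eK; exact: XY.
by move=> x y Hx Ky e; apply/esym; rewrite eK; apply: (h g eH); rewrite -?eK.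
Qed.

End EdgeMaps.

(** * Assembling the strip extensions into an equivalence *)

Section GraphToEquivalence.
Variables (R : realType) (A A' : atlas_data R).
Notation P2 := (R * R)%type.
Hypotheses (hA : is_striped_atlas A) (hA' : is_striped_atlas A').
Variables (nu : Lam A -> Lam A') (eta : Lam A * set P2 -> Lam A' * set P2).
Variables (delta tau : Lam A -> int).
Hypothesis hG : graph_iso A A' nu eta delta tau.
Variable F : Lam A * set P2 -> P2 -> P2.
Hypothesis FE : forall H, halfedge A H -> edge_map eta delta H (F H).
Hypothesis FC : forall H K, glu H K -> edge_compat eta H K (F H) (F K).

Let d l : R := (delta l)%:~R.
Let e l : R := (tau l)%:~R.
Let hd l : d l = 1 \/ d l = -1. Proof. exact: signP (iso_signs hG l).1. Qed.
Let he l : e l = 1 \/ e l = -1. Proof. exact: signP (iso_signs hG l).2. Qed.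

Definition edge_of (l : Lam A) (p : P2) :=
  connected_component (bdry (St A l) (su A l) (sv A l)) p.
Definition boundary_map (l : Lam A) (p : P2) : P2 := F (l, edge_of l p) p.

Lemma edge_ofP l p : bdry (St A l) (su A l) (sv A l) p ->
  halfedge A (l, edge_of l p) /\ edge_of l p p.
Proof. by move=> /boundary_interval_component. Qed.

Lemma boundary_mapE l X p : halfedge A (l, X) -> X p -> boundary_map l p = F (l, X) p.
Proof.
move=> bX Xp; have [bE Ep] := edge_ofP (boundary_interval_sub (halfedge_boundary bX) Xp).
by rewrite /boundary_map (halfedge_eq bE bX Ep Xp).
Qed.

Lemma iso_nu_inj : injective nu.
Proof. by case: hG => -[/bij_inj]. Qed.

Let lv l := level_map (su A l) (sv A l) (su A' (nu l)) (sv A' (nu l)) (e l).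

Lemma level_map_side l s : sign s -> lv l (side_level s l) = side_level (tau l * s) (nu l).
Proof.
move=> hs; rewrite /lv.
have nE : (1 : R) <> -1 by move/eqP; rewrite -subr_eq0 opprK -mulr2n pnatr_eq0.
have [[e1 [h1 h2]]|[e1 [h1 h2]]] :=
  level_map_ends (su A' (nu l)) (sv A' (nu l)) (atlas_strip hA l) (he l).
- have et : tau l = 1 by case: (iso_signs hG l).2 e1 => //; rewrite /e => -> /esym/nE.
  by rewrite et mul1r /side_level; case: ifP => _; rewrite ?h1 ?h2.
- have et : tau l = -1 by case: (iso_signs hG l).2 e1 => //; rewrite /e => -> /nE.
  by rewrite et /side_level; case: hs => -> /=; rewrite ?h1 ?h2.
Qed.

Let bdry_dside l p : bdry (St A l) (su A l) (sv A l) p -> exists2 s, sign s &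
  exists2 X, dside A s l X & X p.
Proof.
move=> bp; have [bE Ep] := edge_ofP bp; have [s hs ds] := halfedge_side hA bE.
by exists s => //; exists (edge_of l p).
Qed.

Lemma boundary_map_bdry l p : bdry (St A l) (su A l) (sv A l) p ->
  St A' (nu l) (boundary_map l p) /\ (boundary_map l p).2 = lv l p.2.
Proof.
move=> /bdry_dside[s hs [X dX Xp]]; have bX : halfedge A (l, X) by case: dX.
have [X' eX [bX' hX']] := iso_side hG hs dX.
have [F1 _ _] := FE bX; have := F1 p Xp; rewrite eX -(boundary_mapE bX Xp) /= => X'p.
split; first exact: halfedge_sub bX' _ X'p.
have -> : p.2 = side_level s l by case: dX => _; exact.
by rewrite level_map_side //; exact: hX'.
Qed.

(** Inside one interval the order is governed by its edge map, across two intervals of a side by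
    condition (a). *)
Lemma boundary_map_row l p r : bdry (St A l) (su A l) (sv A l) p ->
  bdry (St A l) (su A l) (sv A l) r -> p.2 = r.2 -> p.1 < r.1 ->
  0 < d l * ((boundary_map l r).1 - (boundary_map l p).1).
Proof.
move=> /bdry_dside[s hs [X dX Xp]] /bdry_dside[t ht [Y dY Yr]] e2 pr.
have bX : halfedge A (l, X) by case: dX.
have bY : halfedge A (l, Y) by case: dY.
have uv := atlas_bounds hA l.
have st : s = t.
  have lp : p.2 = side_level s l by case: dX => _; exact.
  have lr : r.2 = side_level t l by case: dY => _; exact.
  move: e2; rewrite lp lr /side_level.
  by case: hs => ->; case: ht => -> //= h; move: uv; rewrite h ltxx.
subst t; rewrite (boundary_mapE bX Xp) (boundary_mapE bY Yr).
have [XY|XY] := pselect (X = Y).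
  subst Y; have [_ _ F3] := FE bX; exact: sg_pos (hd l) (F3 p r Xp Yr) pr.
have lt : int_lt X Y.
  exact: (boundary_interval_lt (atlas_strip hA l) (halfedge_boundary bX) (halfedge_boundary bY) XY Xp Yr e2 pr).
have [F1 _ _] := FE bX; have [F2 _ _] := FE bY.
case: hG => _ [h _ _]; have [_ /(_ X Y dX dY lt)] := h l s hs.
rewrite /d; case: (iso_signs hG l).1 => -> /= lt'.
  by rewrite mul1r subr_gt0; apply: lt'; [exact: F1|exact: F2].
by rewrite mulN1r opprB subr_gt0; apply: lt'; [exact: F2|exact: F1].
Qed.

Lemma boundary_map_surj l p' : bdry (St A' (nu l)) (su A' (nu l)) (sv A' (nu l)) p' ->
  exists2 p, bdry (St A l) (su A l) (sv A l) p & boundary_map l p = p'.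
Proof.
move=> /boundary_interval_component[bX' X'p]; set X' := connected_component _ _ in bX' X'p.
have bX2 : halfedge A' (nu l, X') by [].
have [s hs dX'] := halfedge_side hA' bX2.
have [_ ht] := iso_signs hG l.
have tts : tau l * (tau l * s) = s by rewrite mulrA sign_sq // mul1r.
have [|X dX eX] := @iso_side_inv _ _ _ _ _ _ _ hG (tau l * s) l X' (signM ht hs).
  by rewrite tts.
have bX : halfedge A (l, X) by case: dX.
have [_ F2 _] := FE bX; rewrite eX /= in F2; have [p Xp <-] := F2 _ X'p.
exists p; first exact: (boundary_interval_sub (halfedge_boundary bX) Xp).
exact: boundary_mapE.
Qed.

Definition strip_ext (l : Lam A) : P2 -> P2 :=
  strip_extension (St A l) (su A l) (sv A l) (su A' (nu l)) (sv A' (nu l)) (d l) (e l)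
    (boundary_map l).

Let ext := strip_ext.

Lemma strip_ext_St l p : St A l p -> St A' (nu l) (ext l p).
Proof.
exact: (strip_extension_St (atlas_strip hA l) (atlas_strip hA' (nu l)) (d l) (he l)
  (@boundary_map_bdry l)).
Qed.

Lemma strip_ext_level l p : St A l p -> (ext l p).2 = lv l p.2.
Proof. exact: (strip_extension_level (atlas_strip hA l) (d l) (@boundary_map_bdry l)). Qed.

Lemma strip_ext_row l p r : St A l p -> St A l r -> p.2 = r.2 -> p.1 < r.1 ->
  0 < d l * ((ext l r).1 - (ext l p).1).
Proof.
exact: (strip_extension_row _ _ (atlas_strip hA l) _ (hd l) (@boundary_map_row l)).
Qed.

Lemma strip_ext_surj l p' : St A' (nu l) p' -> exists2 p, St A l p & ext l p = p'.
Proof.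
exact: (strip_extension_surj (atlas_strip hA l) (atlas_strip hA' (nu l)) (hd l) (he l)
  (@boundary_map_surj l)).
Qed.

Lemma strip_ext_inj l p r : St A l p -> St A l r -> ext l p = ext l r -> p = r.
Proof.
exact: (strip_extension_inj (atlas_strip hA l) (atlas_strip hA' (nu l)) (hd l) (he l)
  (@boundary_map_bdry l) (@boundary_map_row l)).
Qed.

Lemma strip_ext_cts l : cts (St A l) (ext l).
Proof.
exact: (strip_extension_cts (atlas_strip hA l) (atlas_strip hA' (nu l)) (hd l) (he l)
  (@boundary_map_bdry l) (@boundary_map_row l) (@boundary_map_surj l)).
Qed.

Lemma strip_ext_inv_cts l (G : P2 -> P2) :
  (forall p', St A' (nu l) p' -> St A l (G p') /\ ext l (G p') = p') ->
  cts (St A' (nu l)) G.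
Proof.
exact: (strip_extension_inv_cts (atlas_strip hA l) (atlas_strip hA' (nu l)) (hd l) (he l)
  (@boundary_map_bdry l) (@boundary_map_row l) (@boundary_map_surj l)).
Qed.

Lemma strip_ext_edge l X p : halfedge A (l, X) -> X p -> ext l p = F (l, X) p.
Proof.
move=> bX Xp; rewrite /ext /strip_ext strip_extension_bdry; first exact: boundary_mapE.
exact: (boundary_interval_sub (halfedge_boundary bX) Xp).
Qed.

Lemma strip_ext_inner l p : St A l p -> inner (nu l) (ext l p) <-> inner l p.
Proof.
move=> Sp; rewrite /inner strip_ext_level // /lv.
by rewrite (level_map_inner (atlas_strip hA l) (atlas_strip hA' (nu l)) (he l)).
Qed.

Lemma strip_ext_edge_image l X : halfedge A (l, X) -> ext l @` X = (eta (l, X)).2.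
Proof.
move=> bX; have [F1 F2 _] := FE bX.
apply/seteqP; split=> [_ [p Xp <-]|p' /F2[p Xp <-]].
  by rewrite (strip_ext_edge bX Xp); exact: F1.
by exists p => //; exact: strip_ext_edge.
Qed.

Lemma strip_ext_glue l p m r : St A l p -> St A m r -> q A l p = q A m r ->
  q A' (nu l) (ext l p) = q A' (nu m) (ext m r).
Proof.
move=> Sp Sr pr; have := q_fibers hA Sp Sr pr.
case=> [[lm pr']|[X [Y [g Xp Yr]]]]; first by subst m r.
have bX := glu_halfedge hA g; have bY := glu_halfedge hA (glu_sym g).
have := FC g Xp Yr pr; rewrite (iso_nu hA hG bX) (iso_nu hA hG bY) /=.
by rewrite -(strip_ext_edge bX Xp) -(strip_ext_edge bY Yr).
Qed.

Lemma strip_ext_halfedge l p X' : St A l p -> halfedge A' (nu l, X') -> X' (ext l p) ->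
  exists X, [/\ halfedge A (l, X), X p & eta (l, X) = (nu l, X')].
Proof.
move=> Sp bX' X'p; have [bp|ip] := bdry_or_interior (atlas_strip hA l) Sp; last first.
  by case: (halfedge_not_inner bX' X'p); apply/strip_ext_inner.
have [bX Xp] := edge_ofP bp; exists (edge_of l p); split => //.
have eX := iso_nu hA hG bX; have bX2 := iso_halfedge hG bX; rewrite eX in bX2.
rewrite eX (halfedge_eq bX2 bX' _ X'p) // -(strip_ext_edge_image bX).
by exists p.
Qed.

(** A gluing of the images comes from a gluing in [A] by [iso_glu_inv]; the partner [y] of [p] then
    has the same image as [r], because [q] is injective on a glued interval. *)
Lemma strip_ext_unglue l p m r : St A l p -> St A m r ->
  q A' (nu l) (ext l p) = q A' (nu m) (ext m r) -> q A l p = q A m r.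
Proof.
move=> Sp Sr pr; have := q_fibers hA' (strip_ext_St Sp) (strip_ext_St Sr) pr.
case=> [[/iso_nu_inj lm pr']|[X' [Y' [g' X'p Y'r]]]].
  by subst m; rewrite (strip_ext_inj Sp Sr pr').
have [X [bX Xp eX]] := strip_ext_halfedge Sp (glu_halfedge hA' g') X'p.
have [Y [bY Yr eY]] := strip_ext_halfedge Sr (glu_halfedge hA' (glu_sym g')) Y'r.
have g : glu (l, X) (m, Y) by apply: (iso_glu_inv hA hA' hG bX bY); rewrite eX eY.
have [y Yy ey] := glu_partner hA g Xp.
have Sy := halfedge_sub bY Yy.
have Y'y : Y' (ext m y).
  have := strip_ext_edge_image bY; rewrite eY /= => <-; by exists y.
rewrite -ey; congr (q A m _); apply: (strip_ext_inj Sy Sr).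
apply: (glu_inj hA' (glu_sym g')) => //.
by rewrite -pr; apply: strip_ext_glue.
Qed.

Definition iso_map (x : Lam A * P2) : Lam A' * P2 := (nu x.1, ext x.1 x.2).
Let h := iso_map.

Lemma iso_map_dom x : dom A x -> dom A' (h x).
Proof. by case: x => l p; exact: strip_ext_St. Qed.

Lemma iso_map_inj x y : dom A x -> dom A y -> h x = h y -> x = y.
Proof.
case: x y => l p [m r] Sp Sr [/iso_nu_inj lm]; rewrite /= in lm *; subst m.
by move=> /(strip_ext_inj Sp Sr) /= ->.
Qed.

Lemma iso_map_surj y : dom A' y -> exists2 x, dom A x & h x = y.
Proof.
case: hG => -[[nui nuK nuiK] _ _] _; case: y => l' p' Sp'.
rewrite -(nuiK l') /dom /= in Sp' *.
by have [p Sp <-] := strip_ext_surj Sp'; exists (nui l', p).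
Qed.

Lemma iso_map_leaf L : sleaf A L -> sleaf A' (h @` L).
Proof.
move=> [l [M [hM ->]]].
have -> : h @` [set x | x.1 = l /\ M x.2] = [set x | x.1 = nu l /\ (ext l @` M) x.2].
  apply/seteqP; split=> [_ [[m p] /= [-> Mp] <-]|[m' _] /= [-> [p Mp <-]]].
    by split => //; exists p.
  by exists (l, p).
exists (nu l), (ext l @` M); split => //.
case: hM => [[t [ht ->]]|bM]; last first.
  right; rewrite (strip_ext_edge_image bM).
  by have := iso_halfedge hG (bM : halfedge A (l, M)); rewrite (iso_nu hA hG bM).
left; exists (lv l t).
have inn : inner (nu l) ((0 : R), lv l t).
  by rewrite /inner /= /lv (level_map_inner (atlas_strip hA l) (atlas_strip hA' (nu l)) (he l)).
split; first exact: inn.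
apply/seteqP; split=> [_ [p /= pt <-]|p' /= pt'].
  by rewrite strip_ext_level ?pt //; apply: (inner_St hA); rewrite /inner pt.
have Sp' : St A' (nu l) p' by apply: (inner_St hA'); rewrite /inner pt'.
have [p Sp ep] := strip_ext_surj Sp'; exists p => //=.
have := strip_ext_level Sp; rewrite -/ext ep pt' /lv !level_map_affine.
by move=> /addrI/(mulfI (slope_neq0 (atlas_strip hA l) (atlas_strip hA' (nu l)) (he l))).
Qed.

Lemma iso_map_induced : induced_by A A' h nu eta delta tau.
Proof.
split.
- move=> l; apply/seteqP; split=> [_ [p Sp <-]|_ [p' Sp' <-]].
    by exists (ext l p) => //; exact: strip_ext_St.
  by have [p Sp <-] := strip_ext_surj Sp'; exists p.
- move=> l X bX; rewrite (iso_nu hA hG bX) -(strip_ext_edge_image bX) //.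
- move=> l; have uv := atlas_bounds hA l.
  have row y x1 x2 (hy : su A l < y < sv A l) (x12 : x1 < x2) :
      0 < d l * ((ext l (x2, y)).1 - (ext l (x1, y)).1).
    by apply: strip_ext_row => //; exact: (inner_St hA).
  case: asboolP => H; case: (iso_signs hG l).1 => // el.
    exfalso; pose y := (su A l + sv A l) / 2.
    have hy : su A l < y < sv A l by rewrite /y; lra.
    have h1 : (ext l (0, y)).1 < (ext l (1, y)).1 by exact: (H y 0 1 hy ltr01).
    have := row y 0 1 hy ltr01; rewrite /d el mulN1r opprB subr_gt0 => h2.
    by move: (lt_trans h1 h2); rewrite ltxx.
  exfalso; apply: H => y x1 x2 hy x12.
  by have := row y x1 x2 hy x12; rewrite /d el mul1r subr_gt0.
- move=> l; have uv := atlas_bounds hA l.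
  have lev p1 p2 (S1 : St A l p1) (S2 : St A l p2) (p12 : p1.2 < p2.2) :
      0 < e l * ((ext l p2).2 - (ext l p1).2).
    rewrite !strip_ext_level //.
    exact: (level_map_lt (atlas_strip hA l) (atlas_strip hA' (nu l)) (he l) p12).
  case: asboolP => H; case: (iso_signs hG l).2 => // el.
    exfalso; pose p1 : P2 := (0, (2 * su A l + sv A l) / 3).
    pose p2 : P2 := (0, (su A l + 2 * sv A l) / 3).
    have S1 : St A l p1 by apply: (inner_St hA); rewrite /inner /p1 /=; lra.
    have S2 : St A l p2 by apply: (inner_St hA); rewrite /inner /p2 /=; lra.
    have p12 : p1.2 < p2.2 by rewrite /p1 /p2 /=; lra.
    have h1 : (ext l p1).2 < (ext l p2).2 by exact: (H p1 p2 S1 S2 p12).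
    have := lev p1 p2 S1 S2 p12; rewrite /e el mulN1r opprB subr_gt0 => h2.
    by move: (lt_trans h1 h2); rewrite ltxx.
  exfalso; apply: H => p1 p2 S1 S2 p12.
  by have := lev p1 p2 S1 S2 p12; rewrite /e el mul1r subr_gt0.
Qed.

Lemma q_open (B : atlas_data R) (hB : is_striped_atlas B) (V : set (Zsp B)) :
  (forall l, exists2 f : P2 -> Prop, (forall p, St B l p -> V (q B l p) <-> f p) &
    relopen (St B l) (St B l `&` f)) -> open V.
Proof.
case: hB => _ [_ _ qt _] H; apply/qt => l; have [f fE rf] := H l.
suff -> : St B l `&` q B l @^-1` V = St B l `&` f by [].
by apply/seteqP; split=> p [Sp] /(fE _ Sp) ?; split.
Qed.

Lemma cts_relopen (T : topologicalType) (D : set P2) (f : P2 -> T) (V : set T) :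
  cts D f -> open V -> relopen D (D `&` f @^-1` V).
Proof.
move=> cf oV; apply/relopenP; split=> [p [Dp _] //|p [Dp Vp]].
by have [t t0 Ht] := cf p Dp V oV Vp; exists t => // r Dr pr; split => //; exact: Ht.
Qed.

Lemma q_rep (B : atlas_data R) (hB : is_striped_atlas B) :
  {rep : Zsp B -> Lam B * P2 & forall z, dom B (rep z) /\ q B (rep z).1 (rep z).2 = z}.
Proof.
apply: (@choice _ _ (fun z x => dom B x /\ q B x.1 x.2 = z)) => z.
by case: hB => _ [_ sq _ _]; have [l [p [Sp e']]] := sq z; exists (l, p).
Qed.

Theorem iso_map_equiv : exists k, atlas_equiv A A' h k.
Proof.
have nu_bij : bijective nu by case: hG => -[].
have [nui nuK nuiK] := nu_bij.
have [g Hg] : {g : Lam A' * P2 -> Lam A * P2 &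
    forall y, dom A' y -> dom A (g y) /\ h (g y) = y}.
  apply: (@choice _ _ (fun y x => dom A' y -> dom A x /\ h x = y)) => y.
  have [dy|ndy] := pselect (dom A' y); last by exists (nui y.1, (0, 0)).
  by have [x dx ex] := iso_map_surj dy; exists x.
have gh x : dom A x -> g (h x) = x.
  move=> dx; have [d1 d2] := Hg _ (iso_map_dom dx).
  exact: iso_map_inj d1 dx d2.
have gE l p' : St A' (nu l) p' -> g (nu l, p') = (l, (g (nu l, p')).2) /\
    St A l (g (nu l, p')).2 /\ ext l (g (nu l, p')).2 = p'.
  move=> Sp'; have [] := Hg (nu l, p') Sp'; case: (g _) => m r /= Sr [/iso_nu_inj ml].
  by subst m.
have cg l : cts (St A' (nu l)) (fun p' => (g (nu l, p')).2).
  by apply: strip_ext_inv_cts => p' /gE[_].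
have [rep Hrep] := q_rep hA; have [rep' Hrep'] := q_rep hA'.
(* Defined on chosen representatives: [strip_ext_glue] makes [k] independent of the choice, and
   [strip_ext_unglue] does so for [k']. *)
pose k z := q A' (h (rep z)).1 (h (rep z)).2.
pose k' z' := q A (g (rep' z')).1 (g (rep' z')).2.
have kE x : dom A x -> k (q A x.1 x.2) = q A' (h x).1 (h x).2.
  move=> dx; have [dr er] := Hrep (q A x.1 x.2).
  exact: (strip_ext_glue dr dx er).
have k'E y : dom A' y -> k' (q A' y.1 y.2) = q A (g y).1 (g y).2.
  move=> dy; have [dr er] := Hrep' (q A' y.1 y.2).
  have [d1 e1] := Hg _ dr; have [d2 e2] := Hg _ dy.
  apply: (strip_ext_unglue d1 d2).
  by rewrite -[ext _ _]/(h _).2 -[nu _]/(h (g (rep' _))).1 e1 -[ext _ _]/(h _).2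
    -[nu _]/(h (g y)).1 e2.
have kk' : cancel k k'.
  move=> z; have [dr er] := Hrep z.
  by rewrite -[in LHS]er kE // k'E ?gh //; exact: iso_map_dom.
have k'k : cancel k' k.
  move=> z; have [dr er] := Hrep' z; have [d1 e1] := Hg _ dr.
  by rewrite -[in LHS]er k'E // kE // e1.
exists k; split.
- split; last exact: iso_map_leaf.
  exists g; split; first split.
  + exact: iso_map_dom.
  + by move=> y /Hg[].
  + exact: gh.
  + by move=> y /Hg[].
  split=> U [Ud oU]; split=> [x [dx _] //|l].
    have /relopenP[_ oUl] := oU (nu l).
    apply/relopenP; split=> [p [Sp _] //|p [Sp Up]].
    have [t t0 Ht] := oUl (ext l p) Up.
    have [t' t0' Ht'] := (cts_near2 _ _).1 (@strip_ext_cts l) p Sp t t0.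
    exists t' => // r Sr pr; split => //; apply: Ht; first exact: strip_ext_St.
    exact: Ht'.
  rewrite -(nuiK l); move: (nui l) => m {l}.
  have /relopenP[_ oUl] := oU m.
  apply/relopenP; split=> [p [Sp _] //|p [Sp Up]].
  have [e1 [S1 _]] := gE _ _ Sp; rewrite /= e1 in Up.
  have [t t0 Ht] := oUl _ Up.
  have [t' t0' Ht'] := (cts_near2 _ _).1 (cg m) p Sp t t0.
  exists t' => // r Sr pr; split => //=; have [e2 [S2 _]] := gE _ _ Sr.
  by rewrite e2; apply: Ht => //; exact: Ht'.
- split.
    exists k'; split => //; apply/continuousP => V oV.
      apply: (q_open hA) => l; exists (fun p => V (q A' (nu l) (ext l p))).
        by move=> p Sp /=; rewrite (kE (l, p) Sp).
      apply: cts_relopen oV; apply: (cts_comp (@strip_ext_cts l)).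
        by move=> p; exact: strip_ext_St.
      exact: q_cts.
    apply: (q_open hA') => l'; rewrite -(nuiK l'); move: (nui l') => l {l'}.
    exists (fun p' => V (q A l (g (nu l, p')).2)).
      by move=> p' Sp' /=; rewrite (k'E (nu l, p') Sp') (gE _ _ Sp').1.
    apply: (@cts_relopen _ _ (q A l \o (fun p' => (g (nu l, p')).2))) oV.
    apply: (cts_comp (cg l)); last exact: q_cts.
    by move=> p' Sp'; case: (gE _ _ Sp') => _ [].
  move=> W [L sL ->]; exists (h @` L); first exact: iso_map_leaf.
  have dL := sleaf_dom hA sL.
  apply/seteqP; split=> [_ [_ [x Lx <-] <-]|_ [_ [x Lx <-] <-]].
    by exists (h x); [exists x|rewrite kE //; exact: dL].
  by exists (q A x.1 x.2); [exists x|rewrite kE //; exact: dL].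
- by move=> l p Sp; rewrite -(kE (l, p) Sp).
Qed.

End GraphToEquivalence.

Theorem mainTheorem7 (R : realType) (A A' : atlas_data R) :
  is_striped_atlas A -> is_striped_atlas A' ->
  (forall (h : Lam A * (R * R) -> Lam A' * (R * R)) (k : Zsp A -> Zsp A'),
     atlas_equiv A A' h k ->
     (exists nu eta delta tau, induced_by A A' h nu eta delta tau) /\
     (forall nu eta delta tau, induced_by A A' h nu eta delta tau ->
        graph_iso A A' nu eta delta tau)) /\
  (forall nu eta delta tau, graph_iso A A' nu eta delta tau ->
     exists h k, atlas_equiv A A' h k /\ induced_by A A' h nu eta delta tau).
Proof.
move=> hA hA'; split=> [h k [[[g [hg [ho go]]] hL] [[k' [kK k'K _ _]] _] hk]|nu eta delta tau hG].
  have fi : fol_inverse h g by split.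
  split; first exact: induced_exists hA hA' h g fi.
  move=> nu eta delta tau ind.
  exact: (equiv_graph_iso hA hA' fi (can_inj kK) hk ind).
have [F [FE FC]] := edge_maps hA hA' hG.
have [k hk] := iso_map_equiv hA hA' hG FE FC.
exists (iso_map nu delta tau F), k; split => //.
exact: iso_map_induced.
Qed.
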